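(* Let $0\le u_0<u_1<\infty$. There exists a weakly mixing space-time stationary random field $u(t,x)$, $(t,x)\in\mathbb{R}\times\mathbb{R}$, whose realizations are $C^\infty$ functions with $u(t,x)\in[u_0,u_1]$ for all $(t,x)$, such that with probability $1$, for every $(t_0,x_0)\in\mathbb{R}^2$ the solution $(x_{(t_0,x_0)}(t))_{t\ge t_0}$ of $\dot x(t)=u(t,x(t))$, $x(t_0)=x_0$, satisfies $$\liminf_{t\to+\infty}\frac{x_{(t_0,x_0)}(t)}{t}=u_0,\qquad \limsup_{t\to+\infty}\frac{x_{(t_0,x_0)}(t)}{t}=u_1 .$$
   Context: A random field $u$ on $\mathbb{R}^2$ (coordinates $(t,x)$) is space-time stationary and weakly mixing if $u^\omega(t,x)=\bar u(T_{(t,x)}\omega)$ for a measurable $\bar u$ and a weakly mixing measure-preserving $\mathbb{R}^2$-action $(T_g)$ on a probability space $(\Omega,\mathcal{F},P)$. Weak mixing of an $\mathbb{R}^2$-action means: for all measurable $A,B$, $\lim_{R\to\infty}(2R)^{-2}\int_{|g|\le R}|P(T_gA\cap B)-P(A)P(B)|\,dg=0$, with $|g|=\max_i|g_i|$; equivalently the diagonal action on $\Omega\times\Omega$ with $P\otimes P$ is ergodic. *)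

(* Defs.v *)
From HB Require Import structures.
From mathcomp Require Import all_boot all_order all_algebra.
From mathcomp Require Import all_classical all_reals all_analysis.
Set Implicit Arguments. Unset Strict Implicit. Unset Printing Implicit Defensive.
Import Order.TTheory GRing.Theory Num.Theory numFieldNormedType.Exports.
Local Open Scope classical_set_scope.
Local Open Scope ring_scope.

Fixpoint Ck {R : realType} (k : nat) (f : R * R -> R) : Prop :=
  continuous f /\
  match k with
  | 0 => True
  | k'.+1 => (forall p : R * R, derivable f p (1, 0) /\ derivable f p (0, 1))
             /\ Ck k' ('D_(1, 0) f) /\ Ck k' ('D_(0, 1) f)
  end.

Definition smooth2 {R : realType} (f : R * R -> R) : Prop := forall k, Ck k f.

Definition supnorm2 {R : realType} (g : R * R) : R := Num.max `|g.1| `|g.2|.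

Definition mp_action {R : realType} {d} {Omega : measurableType d}
  (P : probability Omega R) (T : R * R -> Omega -> Omega) : Prop :=
  [/\ (forall w, T (0, 0) w = w),
      (forall g h w, T (g.1 + h.1, g.2 + h.2) w = T g (T h w)),
      measurable_fun setT (fun z : (R * R) * Omega => T z.1 z.2),
      (forall g, measurable_fun setT (T g)) &
      (forall g A, measurable A -> P (T g @^-1` A) = P A)].

Definition weakly_mixing {R : realType} {d} {Omega : measurableType d}
  (P : probability Omega R) (T : R * R -> Omega -> Omega) : Prop :=
  forall A B : set Omega, measurable A -> measurable B ->
    (((((2 * r) ^- 2)%R)%:E *
      \int[(lebesgue_measure \x lebesgue_measure)%E]_(g in [set g : R * R | (supnorm2 g <= r)%R])
         `| P (T g @` A `&` B) - P A * P B |)%E)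
      @[r --> +oo%R] --> 0%E.

Definition ode_solution {R : realType} (u : R * R -> R) (t0 x0 : R) (x : R -> R) : Prop :=
  [/\ x t0 = x0,
      {within `[t0, +oo[, continuous x} &
      (forall t, t0 < t -> derivable x t 1 /\ derive1 x t = u (t, x t))].

(* Main.v *)
(** In the coordinates α = u1 t - x and β = x - u0 t every path with slope in
[u0, u1] is nondecreasing.  For each n take an independent Poisson process of
points in the (α, β)-plane, at length scale D_n, and put around each point a tube
of bounded width in one direction and of length of order n D_n in the other:
along the β axis for even n, along the α axis for odd n.  The speed is u1 where
the highest tube present has even level, u0 elsewhere, mollified at unit scale.
Inside an even tube α is constant along paths, so no path crosses the tube
sideways; an even tube at α-distance of order D_n from the origin which no tube
of a higher level meets therefore keeps α = O(D_n) until α + β = (u1 - u0) t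
reaches n D_n, that is x/t >= u1 - O(1/n) at that time.  Odd tubes likewise force
x/t <= u0 + O(1/n).  If D_n grows fast enough, Borel-Cantelli provides such tubes
for all large n.  The probabilities that the processes avoid given bounded sets
determine the law, whence stationarity and mixing. *)
Require Import Defs.
From HB Require Import structures.
From mathcomp Require Import all_boot all_order all_algebra.
From mathcomp Require Import all_classical all_reals all_analysis.
From mathcomp Require Import measurable_realfun ring lra zify.
Set Implicit Arguments. Unset Strict Implicit. Unset Printing Implicit Defensive.
Import Order.TTheory GRing.Theory Num.Theory numFieldNormedType.Exports.
Local Open Scope classical_set_scope.
Local Open Scope ring_scope.

(** * Coin tossing *)

(** One field has to force both extreme mean speeds on every path, again and again, so tubes of both
    directions must occur at all scales, and they cross. Precedence of the highest level resolves
    the crossings: a tube has bounded width and length of order n D_n, so the chance that a tube of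
    level m > n comes near the box of size n D_n is of order m n D_n / D_m, and D_m is chosen
    against all smaller levels to make it at most 2^-m. The factor n in the length turns trapping
    into a statement on ratios: the transverse coordinate is still below 2 D_n when the longitudinal
    one has run through (n + 1) D_n. It also makes the expected number of usable tubes 2 (n + 1), so
    that their absence is exponentially unlikely. The width is dictated by the mollifier: a core on
    which the speed is exactly u0 or u1 has to survive. As both coordinates are monotone along any
    path, trapping applies to each solution separately. *)

Definition cyl (k : nat) (e : nat -> bool) : set (nat -> bool) :=
  [set x | forall i, (i < k)%N -> x i = e i].

(** The empty set is included to make the family closed under intersection, as uniqueness arguments
    on generators require. *)
Definition cylinders : set (set (nat -> bool)) :=
  [set A | A = set0 \/ exists k e, A = cyl k e].

Definition coin := g_sigma_algebraType cylinders.
HB.instance Definition _ := Measurable.on coin.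

Lemma cyl_nested k l e x : (k <= l)%N -> cyl k e x -> cyl l x `<=` cyl k e.
Proof. by move=> kl ex y xy i ik; rewrite xy ?ex// (leq_trans ik). Qed.

Lemma cylI k l e f : (k <= l)%N ->
  cyl k e `&` cyl l f = set0 \/ cyl k e `&` cyl l f = cyl l f.
Proof.
move=> kl; have [ef|ef] := pselect (cyl k e f); [right|left].
  by rewrite setIidr//; exact: cyl_nested.
rewrite -subset0 => x [ex fx]; apply: ef => i ik.
by rewrite -fx ?ex// (leq_trans ik).
Qed.

Lemma cylinders_setI : setI_closed cylinders.
Proof.
move=> A B [->|[k [e ->]]]; first by rewrite set0I; left.
move=> [->|[l [f ->]]]; first by rewrite setI0; left.
wlog kl : k l e f / (k <= l)%N => [hwlog|].
  by have [kl|/ltnW kl] := leqP k l; [|rewrite setIC]; exact: hwlog.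
by have [->|->] := cylI e f kl; [left|right; exists l, f].
Qed.

Lemma measurable_cyl k e : measurable (cyl k e : set coin).
Proof. by apply: sub_sigma_algebra; right; exists k, e. Qed.

(** The first [k] bits read as a binary numeral, most significant bit first, so that cylinders
    correspond to dyadic intervals. *)
Fixpoint code (k : nat) (e : nat -> bool) : nat :=
  if k is k'.+1 then ((code k' e).*2 + e k')%N else 0%N.

Lemma code_inj k e f : code k e = code k f -> cyl k e f.
Proof.
elim: k => [|k IH] /=; first by move=> _ i.
move=> h; have [h1 h2] : code k e = code k f /\ e k = f k.
  by move: h; case: (e k); case: (f k); lia.
by move=> i; rewrite ltnS leq_eqVlt => /orP[/eqP ->//|ik]; exact: (IH h1).
Qed.

Lemma code_ext k e f : cyl k e f -> code k e = code k f.
Proof.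
elim: k => [//|k IH] /= h; rewrite h//; congr (_.*2 + _)%N.
by apply: IH => i ik; apply: h; rewrite ltnS ltnW.
Qed.

Lemma code_lt k e : (code k e < 2 ^ k)%N.
Proof. by elim: k => [//|k IH] /=; rewrite expnS; case: (e k); lia. Qed.

(** * Binary digits of a real number *)

Section bits.
Context {R : realType}.

Lemma truncn_half (x : R) : 0 <= x -> (Num.truncn (x * 2))./2 = Num.truncn x.
Proof.
move=> x0; set n := Num.truncn x.
have /andP[nx xn] : n%:R <= x < n.+1%:R by exact: Num.Theory.truncn_itv.
have : (n.*2 <= Num.truncn (x * 2))%N.
  rewrite Num.Theory.truncn_ge_nat ?mulr_ge0// -muln2 natrM; lra.
have : (Num.truncn (x * 2) < n.+1.*2)%N.
  rewrite Num.Theory.truncn_lt_nat ?mulr_ge0// -muln2 natrM; lra.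
lia.
Qed.

(** Outside [0, 1[ all digits are false by convention; only [0, 1[ carries mass below. *)
Definition bits (y : R) : nat -> bool := fun k =>
  (0 <= y < 1) && odd (Num.truncn (y * 2 ^+ k.+1)).

Lemma code_bits k (y : R) : 0 <= y < 1 -> code k (bits y) = Num.truncn (y * 2 ^+ k).
Proof.
move=> y01; elim: k => [|k IH] /=.
  by rewrite expr0 mulr1; apply/eqP; rewrite eq_sym Num.Theory.truncn_eq //; case/andP: y01.
rewrite IH /bits y01 /=; set z := y * 2 ^+ k.
rewrite exprS mulrCA mulrC -/z -(@truncn_half z); last first.
  by rewrite /z mulr_ge0 ?exprn_ge0//; case/andP: y01.
by rewrite addnC odd_double_half.
Qed.

Lemma preimage_bits_cyl k e : `[0, 1[%classic `&` bits @^-1` (cyl k e) =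
  `[(code k e)%:R / 2 ^+ k, ((code k e).+1)%:R / 2 ^+ k[%classic :> set R.
Proof.
have k0 : 0 < 2 ^+ k :> R by rewrite exprn_gt0.
apply/seteqP; split => y /=; rewrite !in_itv/=.
  move=> [y01 h]; have /code_ext := h; rewrite code_bits// => c.
  have : Num.truncn (y * 2 ^+ k) == code k e by rewrite c.
  rewrite Num.Theory.truncn_eq; last by rewrite mulr_ge0// ?(ltW k0)//; case/andP: y01.
  by rewrite ler_pdivrMr// ltr_pdivlMr.
rewrite ler_pdivrMr// ltr_pdivlMr// => h.
have /andP[h1 h2] := h.
have y0 : 0 <= y by rewrite -(pmulr_lge0 _ k0) (le_trans _ h1).
have y1 : y < 1.
  rewrite -(ltr_pM2r k0) mul1r (lt_le_trans h2)//.
  by rewrite -natrX ler_nat code_lt.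
have y01 : 0 <= y < 1 by rewrite y0 y1.
split => //; apply: code_inj; rewrite code_bits//.
by apply/eqP; rewrite eq_sym; rewrite Num.Theory.truncn_eq ?mulr_ge0// ltW.
Qed.

Lemma measurable_bits : measurable_fun [set: R] (bits : R -> coin).
Proof.
apply: (measurability (cylinders : set (set coin))) => //.
move=> _ [_ [->|[k [e ->]]] <-]; rewrite setTI; first by rewrite preimage_set0.
rewrite -(setUIDK (bits @^-1` cyl k e) `[0, 1[%classic).
apply: measurableU.
  by rewrite setIC preimage_bits_cyl; exact: measurable_itv.
(* Outside [0, 1[ [bits] is constantly the zero sequence, so that part of the preimage is the whole
   complement or empty. *)
have [h|h] := pselect (cyl k e xpred0).
  suff -> : bits @^-1` cyl k e `\` `[0, 1[ = ~` `[0, 1[.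
    by apply: measurableC; exact: measurable_itv.
  apply/seteqP; split => [y []//|y /= y01]; split => // i ik.
  by rewrite /bits; move: y01; rewrite in_itv/= => /negP/negbTE ->; rewrite -h.
suff -> : bits @^-1` cyl k e `\` `[0, 1[ = set0 by [].
rewrite -subset0 => y [/= hy]; rewrite in_itv/= => /negP/negbTE y01; apply: h.
by move=> i ik; have := hy i ik; rewrite /bits y01.
Qed.

End bits.

Definition law d d' (T : measurableType d) (T' : measurableType d')
    (R : realType) (P : probability T R) (f : T -> T')
    (mf : measurable_fun setT f) : probability T' R :=
  distribution P (mfun_Sub (mem_set mf)).

Lemma lawE d d' (T : measurableType d) (T' : measurableType d')
    (R : realType) (P : probability T R) (f : T -> T')
    (mf : measurable_fun setT f) A : law P mf A = P (f @^-1` A).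
Proof. by []. Qed.

Lemma measurable_preimage d d' (T : measurableType d) (T' : measurableType d')
    (f : T -> T') X : measurable_fun setT f -> measurable X ->
  measurable (f @^-1` X).
Proof. by move=> mf mX; rewrite -[X in measurable X]setTI; exact: mf. Qed.

(** For fixed [E] the sets [C] satisfying the product formula are stable under complement and
    countable disjoint union; Dynkin's theorem does the rest. *)
Lemma indep_generator d d' (T : measurableType d) (T' : measurableType d')
    (R : realType) (P : probability T R) (Q : probability T' R)
    (G : set (set T')) (E : set T) (f : T -> T') :
  (@measurable _ T' = <<s G >>) -> setI_closed G ->
  measurable E -> measurable_fun setT f ->
  (forall C, G C -> P (E `&` f @^-1` C) = (P E * Q C)%E) ->
  forall C, measurable C -> P (E `&` f @^-1` C) = (P E * Q C)%E.
Proof.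
move=> GE GI mE mf h C; rewrite GE; move: C; apply: dynkin_induction => //.
- by rewrite preimage_setT setIT probability_setT mule1.
- move=> S mS hS; rewrite preimage_setC -setDE measureD//.
  + rewrite probability_setC// muleBr ?mule1//.
      by congr (_ - _)%E; exact: hS.
    exact: fin_num_measure.
  + exact: measurable_preimage.
  + by rewrite (le_lt_trans (probability_le1 _ _))// ltry.
- move=> F mF tF hF; rewrite preimage_bigcup setI_bigcupr.
  have mFn n : measurable (E `&` f @^-1` F n).
    by apply: measurableI => //; exact: measurable_preimage.
  rewrite measure_semi_bigcup//; last 2 first.
    apply/trivIsetP => i j _ _ ij; rewrite setIACA setIid -preimage_setI.
    by move/trivIsetP : tF => /(_ i j I I ij) ->; rewrite preimage_set0 setI0.
    exact: bigcupT_measurable.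
  rewrite measure_semi_bigcup//; last exact: bigcupT_measurable.
  have /fineK <- : P E \is a fin_num by rewrite fin_num_measure.
  rewrite -nneseriesZl//; apply: eq_eseriesr => i _.
  by rewrite fineK ?fin_num_measure//; exact: hF.
Qed.

(** * Fair coin tossing and its splitting into two independent halves *)

Section coin_measure.
Context {R : realType}.

Definition unif01 : set (measurableTypeR R) -> \bar R :=
  mrestr lebesgue_measure (measurable_itv `[0%R, 1%R[).

HB.instance Definition _ := Measure.on unif01.

Let unif01_setT : unif01 setT = 1%E.
Proof.
by rewrite /unif01 /mrestr setTI lebesgue_measure_itv/= lte_fin ltr01 sube0.
Qed.

HB.instance Definition _ := Measure_isProbability.Build _ _ R unif01 unif01_setT.

Definition coinP : probability coin R := law unif01 (@measurable_bits R).

Lemma coinP_cyl k e : coinP (cyl k e) = (2 ^- k)%:E.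
Proof.
have -> : coinP (cyl k e) =
  lebesgue_measure (bits @^-1` cyl k e `&` `[0%R, 1%R[%classic : set R) by [].
rewrite setIC preimage_bits_cyl lebesgue_measure_itv/=.
rewrite lte_fin ltr_pM2r ?invr_gt0 ?exprn_gt0// ltr_nat ltnSn.
by rewrite -EFinB -mulrBl -natr1 addrAC subrr add0r mul1r.
Qed.

Definition evens (x : coin) : coin := fun k => x k.*2.
Definition odds (x : coin) : coin := fun k => x k.*2.+1.

(** There is one cylinder for each prefix of length [k]; [pickle] turns the union over prefixes into
    a union over the naturals. *)
Lemma measurable_coord k (b : bool) : measurable [set x : coin | x k = b].
Proof.
rewrite (_ : [set x : coin | _] =
    \bigcup_c \bigcup_(i in [set e | pickle e = c /\ size e = k /\ nth b (rcons e b) k = b])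
       cyl k.+1 (nth b (rcons i b))).
  apply: bigcupT_measurable => c; have [[s Hs]|/forallNP no] :=
    pselect (exists e : seq bool, pickle e = c /\ size e = k /\ nth b (rcons e b) k = b).
    rewrite (_ : [set e | _] = [set s]) ?bigcup_set1; first exact: measurable_cyl.
    apply/seteqP; split => [e [/= ec _]|e /= -> //].
    by case: Hs => sc _; apply: (pcan_inj pickleK); rewrite ec sc.
  by rewrite (_ : [set e | _] = set0) ?bigcup_set0// -subset0 => e /no.
apply/seteqP; split => [x /= xk|x /= [c _ [e [_ [se he]] /= xe]]]; last first.
  by rewrite xe.
exists (pickle (mkseq x k)) => //; exists (mkseq x k); rewrite /= ?size_mkseq.
  by rewrite nth_rcons size_mkseq ltnn eqxx.
move=> i; rewrite ltnS leq_eqVlt nth_rcons size_mkseq => /orP[/eqP ->|ik].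
  by rewrite ltnn eqxx.
by rewrite ik nth_mkseq.
Qed.

Lemma measurable_into_coin d (T : measurableType d) (f : T -> coin) :
  (forall k b, measurable [set t | f t k = b]) -> measurable_fun setT f.
Proof.
move=> mf; apply: (measurability (cylinders : set (set coin))) => //.
move=> _ [_ [->|[k [e ->]]] <-]; rewrite setTI; first by rewrite preimage_set0.
rewrite (_ : _ @^-1` _ = \bigcap_(i < k) [set t | f t i = e i])//.
by apply: bigcap_measurableType => i _; exact: mf.
Qed.

Lemma measurable_evens : measurable_fun setT evens.
Proof. by apply: measurable_into_coin => k b; exact: measurable_coord. Qed.

Lemma measurable_odds : measurable_fun setT odds.
Proof. by apply: measurable_into_coin => k b; exact: measurable_coord. Qed.

Let upd (e : nat -> bool) k b i := if i == k then b else e i.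

Let cyl_split k e :
  cyl k e = cyl k.+1 (upd e k true) `|` cyl k.+1 (upd e k false).
Proof.
apply/seteqP; split => [x xe|x [] xe i ik].
- have h : cyl k.+1 (upd e k (x k)) x.
    move=> i; rewrite ltnS /upd leq_eqVlt; case: eqP => [->//|_ /= ik].
    exact: xe.
  by move: h; case: (x k) => ?; [left|right].
- by rewrite xe ?ltnS ?(ltnW ik)// /upd ltn_eqF.
- by rewrite xe ?ltnS ?(ltnW ik)// /upd ltn_eqF.
Qed.

Let cyl_disj k e : cyl k.+1 (upd e k true) `&` cyl k.+1 (upd e k false) = set0.
Proof.
by rewrite -subset0 => x [/(_ k (ltnSn k)) + /(_ k (ltnSn k))]; rewrite /upd eqxx => ->.
Qed.

Let mpre (f : coin -> coin) : measurable_fun setT f ->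
  forall k e, measurable (f @^-1` cyl k e).
Proof. by move=> mf k e; rewrite -[X in measurable X]setTI; apply: mf => //; exact: measurable_cyl. Qed.

Let rect k l e f := coinP (evens @^-1` cyl k e `&` odds @^-1` cyl l f).

Let half2 (k : nat) : (2 ^- k.+1)%:E + (2 ^- k.+1)%:E = (2 ^- k)%:E :> \bar R.
Proof. by rewrite -EFinD exprS invfM -mulrDl; rewrite [X in X * _](_ : _ = 1) ?mul1r//; lra. Qed.

(** Two prefixes of equal length [k] interleave to a single prefix of length [k + k]. *)
Let rect_diag k e f : rect k k e f = (2 ^- (k + k))%:E.
Proof.
rewrite -(@coinP_cyl _ (fun i => if odd i then f i./2 else e i./2)).
congr (coinP _); apply/seteqP; split => [x [/= xe xf] i ik|x xe].
  case: ifPn => oi.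
    by rewrite -xf; [rewrite /odds; congr (x _); lia|lia].
  by rewrite -xe; [rewrite /evens; congr (x _); lia|lia].
split => i ik.
  by rewrite /evens xe ?odd_double ?doubleK//; lia.
by rewrite /odds xe/= ?odd_double/= ?uphalf_double//; lia.
Qed.

(** Splitting a cylinder by its next bit yields two halves of equal probability, so the formula
    descends from the square case of lengths [l + k] and [k + l]. *)
Let rectE k l e f : rect k l e f = (2 ^- (k + l))%:E.
Proof.
have stepl m n : (forall e f, rect m.+1 n e f = (2 ^- (m.+1 + n))%:E) ->
    forall e f, rect m n e f = (2 ^- (m + n))%:E.
  move=> h {}e {}f; rewrite /rect cyl_split preimage_setU setIUl measureU//.
  - transitivity (rect m.+1 n (upd e m true) f + rect m.+1 n (upd e m false) f)%E => //.
    by rewrite !h addSn half2.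
  - by apply: measurableI; apply: mpre; [exact: measurable_evens|exact: measurable_odds].
  - by apply: measurableI; apply: mpre; [exact: measurable_evens|exact: measurable_odds].
  - by rewrite setIACA -preimage_setI cyl_disj preimage_set0 set0I.
have stepr m n : (forall e f, rect m n.+1 e f = (2 ^- (m + n.+1))%:E) ->
    forall e f, rect m n e f = (2 ^- (m + n))%:E.
  move=> h {}e {}f; rewrite /rect (cyl_split n) preimage_setU setIUr measureU//.
  - transitivity (rect m n.+1 e (upd f n true) + rect m n.+1 e (upd f n false))%E => //.
    by rewrite !h addnS half2.
  - by apply: measurableI; apply: mpre; [exact: measurable_evens|exact: measurable_odds].
  - by apply: measurableI; apply: mpre; [exact: measurable_evens|exact: measurable_odds].
  - by rewrite setIACA setIid -preimage_setI cyl_disj preimage_set0 setI0.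
have stepls j m n : (forall e f, rect (j + m) n e f = (2 ^- (j + m + n))%:E) ->
    forall e f, rect m n e f = (2 ^- (m + n))%:E.
  elim: j => [//|j IH] h; apply: IH; exact: stepl.
have steprs j m n : (forall e f, rect m (j + n) e f = (2 ^- (m + (j + n)))%:E) ->
    forall e f, rect m n e f = (2 ^- (m + n))%:E.
  elim: j => [//|j IH] h; apply: IH; exact: stepr.
apply: (stepls l) => {}e {}f; apply: (steprs k) => {}e {}f.
by rewrite [in rect _ _]addnC rect_diag; congr ((2 ^- _)%:E); lia.
Qed.

(** Independence is known on pairs of cylinders and is extended to all measurable sets one factor at
    a time. *)
Lemma coinP_split A B : measurable A -> measurable B ->
  coinP (evens @^-1` A `&` odds @^-1` B) = (coinP A * coinP B)%E.
Proof.
move=> mA mB.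
have me := measurable_evens; have mo := measurable_odds.
have mc X : cylinders X -> measurable (X : set coin).
  by move=> cX; exact: sub_sigma_algebra.
have cT : cylinders (setT : set coin).
  by right; exists 0%N, xpred0; apply/seteqP; split => // x _ i.
have cylcyl C D : cylinders C -> cylinders D ->
    coinP (evens @^-1` C `&` odds @^-1` D) = (coinP C * coinP D)%E.
  move=> [->|[k [e ->]]] [->|[l [f ->]]];
    rewrite ?preimage_set0 ?set0I ?setI0 ?measure0 ?mul0e ?mule0//.
  transitivity (rect k l e f) => //.
  by rewrite rectE !coinP_cyl exprD invfM EFinM.
have pe C : cylinders C -> coinP (evens @^-1` C) = coinP C.
  by move=> cC; have := cylcyl _ _ cC cT; rewrite preimage_setT setIT probability_setT mule1.
have po C : cylinders C -> coinP (odds @^-1` C) = coinP C.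
  by move=> cC; have := cylcyl _ _ cT cC; rewrite preimage_setT setTI probability_setT mul1e.
have pom : coinP (odds @^-1` B) = coinP B.
  rewrite -[X in coinP X]setTI (indep_generator (Q := coinP) erefl cylinders_setI)// ?probability_setT ?mul1e// => C cC.
  by rewrite setTI po// mul1e.
rewrite setIC -pom muleC.
apply: (@indep_generator _ _ _ _ R coinP coinP cylinders _ evens erefl cylinders_setI) => //; first exact: measurable_preimage.
move=> C cC; rewrite setIC -(pe _ cC) muleC pom.
apply: (@indep_generator _ _ _ _ R coinP coinP cylinders _ odds erefl cylinders_setI) => //; first by apply: measurable_preimage => //; exact: mc.
by move=> D cD; rewrite cylcyl// pe.
Qed.

End coin_measure.

(** * Uniform variables and infinite independent families *)

Section coin_real.
Context {R : realType}.
Local Notation coinP := (@coinP R).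

Definition dyadic (x : coin) : R^nat := fun k => (code k x)%:R / 2 ^+ k.

(** A left inverse of [bits] on [0, 1[. The value 1 is also attained, by the sequence of ones, but
    only on a null event. *)
Definition val (x : coin) : R := limn (dyadic x).

Lemma cvg_val x : dyadic x @ \oo --> val x.
Proof.
apply: nondecreasing_is_cvgn.
  apply/nondecreasing_seqP => k; rewrite /dyadic /=.
  rewrite ler_pdivrMr ?exprn_gt0// exprS invfM mulrA mulrVK ?unitfE ?expf_neq0//.
  by rewrite ler_pdivlMr// -natrM ler_nat; lia.
exists 1 => _ [k _ <-]; rewrite /dyadic ler_pdivrMr ?exprn_gt0// mul1r -natrX ler_nat.
exact/ltnW/code_lt.
Qed.

Lemma val_bits (y : R) : 0 <= y < 1 -> val (bits y) = y.
Proof.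
move=> y01; apply/(cvg_lim (@Rhausdorff R)).
apply/cvgrPdist_le => /= e e0.
have : GRing.exp (2^-1 : R) @ \oo --> (0 : R).
  by apply: cvg_expr; rewrite ger0_norm ?invr_ge0// invf_lt1// ltr1n.
move/cvgrPdist_le => /(_ _ e0); apply: filterS => k.
rewrite sub0r normrN exprVn ger0_norm ?invr_ge0 ?exprn_ge0// => ke.
rewrite /dyadic code_bits//; set z := y * 2 ^+ k.
have k0 : 0 < 2 ^+ k :> R by rewrite exprn_gt0.
have z0 : 0 <= z by rewrite mulr_ge0 ?(ltW k0)//; case/andP: y01.
have /andP[z1 z2] := Num.Theory.truncn_itv z0.
have -> : y = z / 2 ^+ k by rewrite /z mulfK// gt_eqF.
rewrite -mulrBl ger0_norm; last by rewrite divr_ge0 ?subr_ge0// ltW.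
apply: le_trans ke; rewrite ler_pdivrMr// mulVf ?gt_eqF//.
by move: z2; rewrite -natr1; lra.
Qed.

Lemma measurable_code k : measurable_fun setT (fun x : coin => (code k x)%:R : R).
Proof.
elim: k => [|k IH]; first exact: measurable_cst.
rewrite (_ : (fun _ => _) = (fun x : coin =>
    (code k x)%:R * 2 + \1_[set x : coin | x k = true] x)).
  apply: measurable_funD; first exact: measurable_funM.
  by apply: measurable_indic; exact: measurable_coord.
apply/funext => x; rewrite /= natrD -muln2 natrM indicE; congr (_ + _%:R).
by case: (boolP (x k)) => xk; apply/esym; [rewrite mem_set|rewrite memNset//=; rewrite (negbTE xk)].
Qed.

Lemma measurable_val : measurable_fun setT (val : coin -> R).
Proof.
apply: (@measurable_fun_cvg _ _ _ _ (fun k x => dyadic x k)).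
  by move=> k; apply: measurable_funM => //; exact: measurable_code.
by move=> x _; exact: cvg_val.
Qed.

Lemma coinP_val (Y : set R) : measurable Y ->
  coinP (val @^-1` Y) = lebesgue_measure (Y `&` `[0, 1[%classic).
Proof.
move=> mY; transitivity
  (lebesgue_measure (bits @^-1` (val @^-1` Y) `&` `[0%R, 1%R[%classic : set R)) => //.
congr (lebesgue_measure _); apply/seteqP; split => y /= [];
  by rewrite !in_itv/= => + y01; rewrite val_bits.
Qed.

(* [x] splits into the independent coin sequences [coord i x], i = 0, 1, ... *)
Definition coord (i : nat) (x : coin) : coin := evens (iter i odds x).

Lemma measurable_coord_iter i : measurable_fun setT (coord i).
Proof.
apply: (measurableT_comp measurable_evens).
elim: i => [|i IH]; first exact: measurable_id.
by apply: measurableT_comp IH; exact: measurable_odds.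
Qed.

Lemma coinP_coord n (W : nat -> set coin) (w : nat -> R) :
  (forall i, measurable (W i)) -> (forall i, coinP (W i) = (w i)%:E) ->
  coinP [set x | forall i, (i < n)%N -> W i (coord i x)] = (\prod_(i < n) w i)%:E.
Proof.
elim: n W w => [|n IH] W w mW PW.
  rewrite big_ord0 -(probability_setT coinP); congr (coinP _).
  by apply/seteqP; split.
rewrite (_ : [set x | _] = evens @^-1` (W 0%N) `&` odds @^-1`
    [set x | forall i, (i < n)%N -> W i.+1 (coord i x)]).
  rewrite coinP_split//.
    have := IH (W \o succn) (w \o succn) (fun i => mW i.+1) (fun i => PW i.+1).
    by rewrite PW /= => ->; rewrite -EFinM big_ord_recl.
  rewrite (_ : [set x | _] = \bigcap_(i < n) (coord i @^-1` W i.+1))//.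
  apply: bigcap_measurableType => i _; apply: measurable_preimage => //.
  exact: measurable_coord_iter.
apply/seteqP; split => [x h|x [h0 h] [|i] ni].
- by split=> [|i ni]; [exact: (h 0%N)|rewrite /coord -iterSr; exact: (h i.+1)].
- exact: h0.
- by rewrite /coord iterSr; exact: h.
Qed.

(** The event is a decreasing intersection of finite products. Writing the factors as exponentials
    turns the infinite product into a series, and it is the form in which void probabilities
    appear. *)
Lemma coinP_coordT (W : nat -> set coin) (a : nat -> R) (s : R) :
  (forall i, measurable (W i)) -> (forall i, coinP (W i) = (expR (- a i))%:E) ->
  series a @ \oo --> s ->
  coinP [set x | forall i, W i (coord i x)] = (expR (- s))%:E.
Proof.
move=> mW PW cs.
pose S n := [set x | forall i, (i < n)%N -> W i (coord i x)].
have SE n : S n = \bigcap_(i < n) (coord i @^-1` W i) by [].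
have mS n : measurable (S n).
  rewrite SE; apply: bigcap_measurableType => i _; apply: measurable_preimage => //.
  exact: measurable_coord_iter.
have -> : [set x | forall i, W i (coord i x)] = \bigcap_n S n.
  apply/seteqP; split => [x h n _ i _|x h i]; first exact: h.
  by apply: (h i.+1).
have c1 : coinP \o S @ \oo --> coinP (\bigcap_n S n).
  apply: nonincreasing_cvg_mu => //.
  - by rewrite (le_lt_trans (probability_le1 _ _))// ltry.
  - exact: bigcapT_measurable.
  - by move=> m n mn; apply/subsetPset => x h i im; apply: h; exact: leq_trans mn.
apply: (cvg_unique (@ereal_hausdorff R) c1).
have -> : coinP \o S = EFin \o (fun n => expR (- series a n)).
  apply/funext => n; rewrite /comp -[LHS]/(coinP (S n)) (coinP_coord n mW PW) -expR_sum; congr (expR _)%:E.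
  by rewrite /series/= -sumrN big_mkord.
apply: cvg_EFin; first exact: nearW.
apply: (@cvg_comp _ _ _ (fun n => - series a n) expR _ (nbhs (- s))).
  exact: cvgN.
exact: continuous_expR.
Qed.

End coin_real.

(** * Poisson processes *)

Section poisson_cell.
Context {R : realType}.
Local Notation coinP := (@coinP R).

(** The probability that a Poisson variable of mean 1 is strictly less than [n], so that the value
    at 0 is 0. *)
Definition poisson_cdf : R^nat := fun n => expR (- 1) * series (exp_coeff 1) n.

Lemma poisson_cdfS n :
  poisson_cdf n.+1 = poisson_cdf n + expR (- 1) * (n`!%:R)^-1.
Proof.
by rewrite /poisson_cdf seriesSr mulrDr /exp_coeff /= expr1n mul1r.
Qed.

Lemma poisson_cdf_lt : {homo poisson_cdf : m n / (m < n)%N >-> m < n}.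
Proof.
apply: homo_ltn; first exact: lt_trans.
by move=> n; rewrite poisson_cdfS ltrDl mulr_gt0 ?expR_gt0// invr_gt0 ltr0n fact_gt0.
Qed.

Lemma poisson_cdf_le : {homo poisson_cdf : m n / (m <= n)%N >-> m <= n}.
Proof.
by move=> m n; rewrite leq_eqVlt => /orP[/eqP ->//|/poisson_cdf_lt/ltW].
Qed.

Lemma poisson_cdf0 : poisson_cdf 0 = 0.
Proof. by rewrite /poisson_cdf /series/= big_geq// mulr0. Qed.

Lemma cvg_poisson_cdf : poisson_cdf @ \oo --> (1 : R).
Proof.
rewrite -(@expRxMexpNx_1 R 1) mulrC.
apply: cvgM; first exact: cvg_cst.
exact: is_cvg_series_exp_coeff.
Qed.

Lemma poisson_cdf_lt1 n : poisson_cdf n < 1.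
Proof.
apply: lt_le_trans (poisson_cdf_lt (ltnSn n)) _.
rewrite -(cvg_lim (@Rhausdorff R) cvg_poisson_cdf).
apply: (@nondecreasing_cvgn_le R poisson_cdf _ _ n.+1); first exact: poisson_cdf_le.
exact: (cvgP _ cvg_poisson_cdf).
Qed.

Lemma poisson_cdf_cover (y : R) : 0 <= y < 1 ->
  exists n, poisson_cdf n <= y < poisson_cdf n.+1.
Proof.
move=> /andP[y0 y1].
have [N /= HN] : exists N, y < poisson_cdf N.
  have /cvgrPdist_lt /(_ (1 - y)) := cvg_poisson_cdf.
  rewrite subr_gt0 => /(_ y1) [N _ /(_ N (leqnn N))] /=.
  rewrite ger0_norm ?subr_ge0 ?ltW ?poisson_cdf_lt1// => h; exists N; lra.
have ex : exists n, y < poisson_cdf n by exists N.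
have := ex_minnP ex; case=> [[|m]].
  by rewrite poisson_cdf0 ltNge y0.
move=> ym mmin; exists m; rewrite ym andbT leNgt; apply/negP => /mmin.
by rewrite ltnn.
Qed.

Section cell.
Context d (T : measurableType d) (pt : coin -> T).
Hypothesis mpt : measurable_fun setT pt.

(* [val (evens x)] is uniform and determines, by inversion of the distribution
function, the Poisson number of points of the cell: the [i]-th point is present iff
[poisson_cdf i.+1 <= val (evens x)]. *)
Definition cell_void (A : set T) : set coin :=
  [set x | forall i, poisson_cdf i.+1 <= val (evens x) ->
                     ~ A (pt (coord i (odds x)))].

Let mptA i A : measurable A -> measurable (coord i @^-1` (pt @^-1` A)).
Proof.
move=> mA; apply: measurable_preimage; first exact: measurable_coord_iter.
exact: measurable_preimage.
Qed.

Let mval (Y : set R) : measurable Y -> measurable (evens @^-1` (val @^-1` Y)).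
Proof.
move=> mY; apply: measurable_preimage; first exact: measurable_evens.
exact: measurable_preimage measurable_val mY.
Qed.

Lemma measurable_cell_void A : measurable A -> measurable (cell_void A).
Proof.
move=> mA.
rewrite (_ : cell_void A = \bigcap_i
  (~` (evens @^-1` (val @^-1` `[poisson_cdf i.+1, +oo[%classic)) `|`
   ~` (odds @^-1` (coord i @^-1` (pt @^-1` A))))); last first.
  apply/seteqP; split => [x h i _|x h i hi].
    have [hi|hi] := pselect (poisson_cdf i.+1 <= val (evens x)).
      by right; exact: h.
    by left; rewrite /= in_itv/= andbT.
  by have [/=|//] := h i I; rewrite in_itv/= andbT.
apply: bigcapT_measurable => i; apply: measurableU; apply: measurableC.
  by apply: mval; exact: measurable_itv.
by apply: measurable_preimage; [exact: measurable_odds|exact: mptA].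
Qed.

(** Given [n] points in the cell, all avoid [A] with probability [(1 - a) ^+ n]; averaging over the
    Poisson number gives e^-1 times the exponential series of 1 - a. *)
Lemma coinP_cell_void A (a : R) : measurable A -> coinP (pt @^-1` A) = a%:E ->
  coinP (cell_void A) = (expR (- a))%:E.
Proof.
move=> mA PA.
(* [D n] says that there are exactly [n] points, [V n] that the first [n] candidates avoid [A]. *)
pose D n := evens @^-1` (val @^-1` `[poisson_cdf n, poisson_cdf n.+1[%classic).
pose V n := [set x | forall i, (i < n)%N -> (~` (pt @^-1` A)) (coord i x)].
pose S n := D n `&` odds @^-1` (V n).
have mpA : measurable (pt @^-1` A) by exact: measurable_preimage.
have mD n : measurable (D n) by apply: mval; exact: measurable_itv.
have mV n : measurable (V n).
  rewrite (_ : V n = \bigcap_(i < n) (coord i @^-1` ~` (pt @^-1` A)))//.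
  apply: bigcap_measurableType => i _.
  by rewrite preimage_setC; apply: measurableC; exact: mptA.
have mS n : measurable (S n).
  by apply: measurableI => //; apply: measurable_preimage => //; exact: measurable_odds.
have tS : trivIset setT S.
  apply: ltn_trivIset => n m mn; rewrite -subset0 => x [[+ _] [+ _]].
  rewrite /D /= !in_itv/= => /andP[_ h2] /andP[h1 _].
  have := lt_le_trans h2 (le_trans (poisson_cdf_le mn) h1).
  by rewrite ltxx.
have PS n : coinP (S n) = (expR (- 1) * exp_coeff (1 - a) n)%:E.
  rewrite coinP_split//; last by apply: measurable_preimage; [exact: measurable_val|exact: measurable_itv].
  rewrite (@coinP_coord _ n (fun=> ~` (pt @^-1` A)) (fun=> 1 - a)) => [||i]; last 2 first.
    by move=> i; exact: measurableC.
    by rewrite probability_setC// PA.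
  rewrite coinP_val; last exact: measurable_itv.
  rewrite setIidl; last first.
    move=> y /=; rewrite !in_itv/= => /andP[h1 h2].
    rewrite (lt_trans h2 (poisson_cdf_lt1 _)) andbT (le_trans _ h1)//.
    by rewrite -poisson_cdf0; exact: poisson_cdf_le.
  rewrite lebesgue_measure_itv/= lte_fin poisson_cdf_lt// -EFinB -EFinM.
  rewrite poisson_cdfS addrAC subrr add0r prodr_const card_ord /exp_coeff/=.
  by rewrite -mulrA [_^-1 * _]mulrC.
(* The events [S n] exhaust [cell_void A] only where the uniform variable lies in [0, 1[; the
   exception is a null event. *)
have US : \bigcup_n S n = cell_void A `&` evens @^-1` (val @^-1` (`[0, 1[%classic : set R)).
  apply/seteqP; split => [x [n _ [hx xV]]|x [xA /=]].
    have /andP[h1 h2] : poisson_cdf n <= val (evens x) < poisson_cdf n.+1.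
      by move: hx; rewrite /D /= in_itv.
    split => [i hi|].
      apply: xV; rewrite ltnNge; apply/negP => ni.
      have := lt_le_trans h2 (le_trans (poisson_cdf_le (leq_ltn_trans ni (ltnSn i))) hi).
      by rewrite ltxx.
    rewrite /= in_itv /=; apply/andP; split; last exact: lt_trans h2 (poisson_cdf_lt1 _).
    by apply: le_trans h1; rewrite -poisson_cdf0; exact: poisson_cdf_le.
  rewrite in_itv => /poisson_cdf_cover[n hn]; exists n => //; split => /=.
    by rewrite /D /= in_itv.
  move=> i ni; apply: xA; case/andP: hn => hn _.
  exact: le_trans (poisson_cdf_le ni) hn.
have mI : measurable (evens @^-1` (val @^-1` (`[0, 1[%classic : set R))).
  by apply: mval; exact: measurable_itv.
have PI : coinP (~` (evens @^-1` (val @^-1` (`[0, 1[%classic : set R)))) = 0%E.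
  rewrite probability_setC//.
  rewrite -[X in coinP X]setIT -(preimage_setT odds) coinP_split//; last by apply: measurable_preimage; [exact: measurable_val|exact: measurable_itv].
  rewrite coinP_val; last exact: measurable_itv.
  rewrite setIid probability_setT lebesgue_measure_itv/= lte_fin ltr01.
  by rewrite mule1 sube0 subee.
have -> : coinP (cell_void A) = coinP (\bigcup_n S n).
  rewrite US; apply/eqP; rewrite eq_le; apply/andP; split; last first.
    apply: le_measure; rewrite ?inE; [|exact: measurable_cell_void|exact: subIsetl].
    by apply: measurableI => //; exact: measurable_cell_void.
  rewrite (measureDI coinP (measurable_cell_void mA) mI) -[leRHS]add0e leeD2r//.
  rewrite -PI; apply: le_measure; rewrite ?inE.
  - by apply: measurableD => //; exact: measurable_cell_void.
  - exact: measurableC.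
  - by move=> x [].
rewrite measure_semi_bigcup//; last exact: bigcupT_measurable.
apply/cvg_lim; first exact: ereal_hausdorff.
rewrite (_ : (fun n => _) =
    EFin \o (fun n => expR (- 1) * series (exp_coeff (1 - a)) n)); last first.
  apply/funext => n /=; rewrite (eq_bigr _ (fun i _ => PS i)) sumEFin.
  by rewrite /series/= mulr_sumr.
apply: cvg_EFin; first exact: nearW.
rewrite /comp /=.
have -> : expR (- a) = expR (- 1) * expR (1 - a).
  by rewrite -expRD; congr expR; lra.
apply: cvgM; [exact: cvg_cst|exact: is_cvg_series_exp_coeff].
Qed.

End cell.
End poisson_cell.

(** Countable additivity as convergence of a series of reals, the shape of the hypothesis of
    [coinP_coordT]. *)
Lemma series_partition d (T : measurableType d) (R : realType)
    (mu : {measure set T -> \bar R}) (A : set T) (I : nat -> set T) :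
  measurable A -> (mu A < +oo)%E -> (forall k, measurable (I k)) ->
  trivIset setT I -> \bigcup_k I k = setT ->
  series (fun k => fine (mu (A `&` I k))) @ \oo --> fine (mu A).
Proof.
move=> mA Aoo mI tI UI.
have mAI k : measurable (A `&` I k) by exact: measurableI.
have tAI : trivIset setT (fun k => A `&` I k) by exact: trivIset_setIl.
have UAI : \bigcup_k (A `&` I k) = A by rewrite -setI_bigcupr UI setIT.
have := @measure_semi_sigma_additive _ _ _ mu (fun k => A `&` I k) mAI tAI.
rewrite UAI => /(_ mA).
have -> : mu A = (fine (mu A))%:E by rewrite fineK// ge0_fin_numE.
move/fine_cvg; apply: cvg_trans; apply: near_eq_cvg; apply: nearW => n /=.
rewrite /series /= -sum_fine// => k _; rewrite ge0_fin_numE//.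
by apply: le_lt_trans Aoo; apply: le_measure; rewrite ?inE//; exact: subIsetl.
Qed.

(** * Translation invariance of planar Lebesgue measure *)

Section translation.
Context {R : realType}.
Local Notation lambda := (@lebesgue_measure R).
Local Notation lambda2 := (lambda \x lambda)%E.

Lemma lebesgue_measure_shift (c : R) (A : set R) : measurable A ->
  lambda ((fun y => c + y) @^-1` A) = lambda A.
Proof.
move=> mA.
have mc : measurable_fun setT ((fun y => c + y) : measurableTypeR R -> measurableTypeR R).
  by apply: measurable_funD => //; exact: measurable_cst.
transitivity (pushforward lambda
  ((fun y => c + y) : measurableTypeR R -> measurableTypeR R) A) => //.
apply/esym/lebesgue_measure_unique => //= _ [[a b]] _ <-.
rewrite /pushforward/= (_ : _ @^-1` _ = `]a - c, b - c]%classic).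
  rewrite !lebesgue_measure_itv/= !lte_fin ltrD2r.
  by case: ifPn => // _; rewrite -!EFinB; congr EFin; lra.
apply/seteqP; split => y /=; rewrite !in_itv/=; lra.
Qed.

Lemma lebesgue_measure2_shift (a b : R) (A : set (R * R)) : measurable A ->
  lambda2 ((fun p => (a + p.1, b + p.2)) @^-1` A) = lambda2 A.
Proof.
move=> mA.
have mc : measurable_fun setT ((fun p => (a + p.1, b + p.2)) :
    measurableTypeR R * measurableTypeR R -> measurableTypeR R * measurableTypeR R).
  by apply: measurable_fun_pair; apply: measurable_funD => //; exact: measurable_cst.
transitivity (pushforward lambda2 ((fun p => (a + p.1, b + p.2)) :
    measurableTypeR R * measurableTypeR R -> measurableTypeR R * measurableTypeR R) A) => //.
apply/esym/product_measure_unique => //= B C mB mC.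
rewrite /pushforward/= (_ : _ @^-1` _ =
  ((fun y => a + y) @^-1` B) `*` ((fun y => b + y) @^-1` C))//.
have ms (c : R) D : measurable D -> measurable ((fun y => c + y) @^-1` D : set R).
  move=> mD; rewrite -[X in measurable X]setTI.
  by apply: (measurable_funD (measurable_cst c) (@measurable_id _ R setT)).
rewrite product_measure1E; [|exact: ms|exact: ms].
by congr (_ * _)%E; exact: lebesgue_measure_shift.
Qed.

End translation.

(** * Unit rate Poisson processes on the plane, one for each level *)

Section poisson_process.
Context {R : realType}.
Local Notation coinP := (@coinP R).
Local Notation lambda := (@lebesgue_measure R).
Local Notation lambda2 := (lambda \x lambda)%E.

(** A bijection from the naturals onto the integers: independent coin sequences are numbered by
    naturals, the unit cells of the plane by pairs of integers. *)
Definition int_enum (k : nat) : int := if odd k then Negz k./2 else Posz k./2.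

Lemma int_enum_inj : injective int_enum.
Proof.
by move=> m n; rewrite /int_enum; case: ifP => om; case: ifP => on // -[h]; lia.
Qed.

Lemma int_enum_surj z : exists k, int_enum k = z.
Proof.
case: z => n; [exists n.*2|exists n.*2.+1]; rewrite /int_enum.
  by rewrite odd_double doubleK.
by rewrite /= odd_double /= uphalf_double.
Qed.

Definition unit_itv (k : nat) : set R :=
  [set y | (int_enum k)%:~R <= y < (int_enum k)%:~R + 1].

Lemma unit_itvE k : unit_itv k = `[(int_enum k)%:~R, (int_enum k)%:~R + 1[%classic.
Proof. by apply/seteqP; split => y /=; rewrite in_itv. Qed.

Lemma measurable_unit_itv k : measurable (unit_itv k).
Proof. by rewrite unit_itvE; exact: measurable_itv. Qed.

Lemma unit_itv_floor k y : unit_itv k y -> Num.floor y = int_enum k.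
Proof. by move=> /= h; apply: Num.Theory.floor_def; rewrite intrD. Qed.

Lemma trivIset_unit_itv : trivIset setT unit_itv.
Proof.
by move=> m n _ _ [y [/unit_itv_floor h1 /unit_itv_floor h2]];
  apply: int_enum_inj; rewrite -h1 -h2.
Qed.

Lemma bigcup_unit_itv : \bigcup_k unit_itv k = setT.
Proof.
apply/seteqP; split => // y _; have [k hk] := int_enum_surj (Num.floor y).
exists k => //; rewrite /unit_itv /= hk.
by have := Num.Theory.floor_itv y; rewrite intrD.
Qed.

Definition square_pt (i k : nat) (x : coin) : measurableTypeR R * measurableTypeR R :=
  ((int_enum i)%:~R + val (evens x), (int_enum k)%:~R + val (odds x)).

Lemma measurable_square_pt i k : measurable_fun setT (square_pt i k).
Proof.
apply: measurable_fun_pair; apply: measurable_funD; try exact: measurable_cst.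
  by apply: measurableT_comp; [exact: measurable_val|exact: measurable_evens].
by apply: measurableT_comp; [exact: measurable_val|exact: measurable_odds].
Qed.

(** The point is uniform in its unit square: both sides are finite measures in [A] that agree on
    rectangles. *)
Lemma coinP_square_pt i k (A : set (R * R)) : measurable A ->
  coinP (square_pt i k @^-1` A) = lambda2 (A `&` (unit_itv i `*` unit_itv k)).
Proof.
move=> mA.
have mI : measurable (unit_itv i `*` unit_itv k).
  by apply: measurableX; exact: measurable_unit_itv.
pose G : set (set (R * R)) := [set A `*` B | A in measurable & B in measurable].
suff : law coinP (measurable_square_pt i k) A = mrestr lambda2 mI A by [].
refine (@measure_unique _ R (measurableTypeR R * measurableTypeR R)%type G (fun=> setT) _ _ _ _
  (law coinP (measurable_square_pt i k)) (mrestr lambda2 mI) _ _ _ _) => //.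
- by rewrite measurable_prod_measurableType.
- move=> _ _ [A1 mA1 [B1 mB1 <-]] [A2 mA2 [B2 mB2 <-]].
  exists (A1 `&` A2); first exact: measurableI.
  by exists (B1 `&` B2); [exact: measurableI|rewrite setXI].
- by move=> _; exists setT => //; exists setT => //; rewrite setXTT.
- by rewrite bigcup_const.
- move=> _ [B mB [C mC <-]].
  have ms j (D : set R) : measurable D -> measurable ((fun y => (int_enum j)%:~R + y) @^-1` D : set R).
    move=> mD; rewrite -[X in measurable X]setTI.
    by apply: (measurable_funD (measurable_cst ((int_enum j)%:~R : R)) (@measurable_id _ R setT)).
  have hp j (D : set R) : measurable D ->
      coinP (val @^-1` ((fun y => (int_enum j)%:~R + y) @^-1` D : set R)) =
      lambda (D `&` unit_itv j).
    move=> mD; rewrite coinP_val; last exact: ms.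
    rewrite -[RHS](@lebesgue_measure_shift _ (int_enum j)%:~R); last first.
      by apply: (measurableI _ _ mD); exact: measurable_unit_itv.
    congr (lambda _); apply/seteqP; split => y /= [h]; rewrite ?in_itv /unit_itv/= => hy.
      by split => //; lra.
    by split => //; lra.
  transitivity (coinP (evens @^-1` (val @^-1` ((fun y => (int_enum i)%:~R + y) @^-1` B : set R)) `&`
    odds @^-1` (val @^-1` ((fun y => (int_enum k)%:~R + y) @^-1` C : set R)))) => //.
  rewrite coinP_split; last 2 first.
    by apply: measurable_preimage; [exact: measurable_val|exact: ms].
    by apply: measurable_preimage; [exact: measurable_val|exact: ms].
  rewrite !hp//.
  transitivity (lambda2 ((B `&` unit_itv i) `*` (C `&` unit_itv k))).
    rewrite product_measure1E//.
      by apply: measurableI => //; exact: measurable_unit_itv.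
    by apply: measurableI => //; exact: measurable_unit_itv.
  by rewrite setXI.
- by move=> _; rewrite (le_lt_trans (probability_le1 _ _))// ltry.
Qed.

(** The randomness of one unit square, obtained by splitting the coin sequence by level, then by
    column, then by row. [level_void] and [row_void] are nested in the same order. *)
Definition cell_state (n i k : nat) (x : coin) := coord k (coord i (coord n x)).

Definition poisson_conf (x : coin) : nat -> set (R * R) := fun n =>
  [set p | exists i k l, poisson_cdf l.+1 <= val (evens (cell_state n i k x)) :> R /\
           p = square_pt i k (coord l (odds (cell_state n i k x)))].

Definition void (A : nat -> set (R * R)) : set (nat -> set (R * R)) :=
  [set Z | forall n p, Z n p -> ~ A n p].

Definition row_void (A : set (R * R)) i : set coin :=
  [set z | forall k, cell_void (R := R) (square_pt i k) A (coord k z)].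

Definition level_void (A : set (R * R)) : set coin :=
  [set y | forall i, row_void A i (coord i y)].

Lemma poisson_conf_void (A : nat -> set (R * R)) : poisson_conf @^-1` void A =
  [set x | forall n, level_void (A n) (coord n x)].
Proof.
apply/seteqP; split => [x h n i k l hl Al|x h n p [i [k [l [hl ->]]]]].
  by apply: (h n _ _ Al); exists i, k, l.
exact: h.
Qed.

Lemma measurable_coordT (W : nat -> set coin) : (forall i, measurable (W i)) ->
  measurable [set x | forall i, W i (coord i x)].
Proof.
move=> mW; rewrite (_ : [set x | _] = \bigcap_i (coord i @^-1` W i)).
  apply: bigcapT_measurable => i; apply: measurable_preimage => //.
  exact: measurable_coord_iter.
by apply/seteqP; split => [x h i _|x h i]; [exact: h|exact: (h i I)].
Qed.

Lemma measurable_row_void A i : measurable A -> measurable (row_void A i).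
Proof.
move=> mA; apply: (measurable_coordT (W := fun k => cell_void _ A)) => k.
by apply: measurable_cell_void => //; exact: measurable_square_pt.
Qed.

Lemma measurable_level_void A : measurable A -> measurable (level_void A).
Proof.
move=> mA; apply: (measurable_coordT (W := fun i => row_void A i)) => i.
exact: measurable_row_void.
Qed.

Lemma measurable_poisson_conf_void (A : nat -> set (R * R)) :
  (forall n, measurable (A n)) -> measurable (poisson_conf @^-1` void A).
Proof.
move=> mA; rewrite poisson_conf_void.
apply: (measurable_coordT (W := fun n => level_void (A n))) => n.
exact: measurable_level_void.
Qed.

(** [coinP_coordT] is applied three times, over levels, columns and rows; the exponents add up
    because vertical strips partition the plane and unit squares partition each strip. *)
Lemma coinP_poisson_conf_void (A : nat -> set (R * R)) (a : nat -> R) (s : R) :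
  (forall n, measurable (A n)) -> (forall n, lambda2 (A n) = (a n)%:E) ->
  series a @ \oo --> s -> coinP (poisson_conf @^-1` void A) = (expR (- s))%:E.
Proof.
move=> mA Aa cs; rewrite poisson_conf_void.
apply: (@coinP_coordT _ (fun n => level_void (A n)) _ _ _ _ cs) => n.
  exact: measurable_level_void.
have mS i : measurable (setT `*` unit_itv i : set (R * R)).
  by apply: measurableX => //; exact: measurable_unit_itv.
have mT i : measurable (unit_itv i `*` setT : set (R * R)).
  by apply: measurableX => //; exact: measurable_unit_itv.
have mAT i : measurable (A n `&` (unit_itv i `*` setT)) by exact: measurableI.
have Aoo : (lambda2 (A n) < +oo)%E by rewrite Aa ltry.
have AToo i : (lambda2 (A n `&` (unit_itv i `*` setT)) < +oo)%E.
  by apply: le_lt_trans Aoo; apply: le_measure; [rewrite inE; exact: mAT|rewrite inE; exact: mA|exact: subIsetl].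
apply: (@coinP_coordT _ (fun i => row_void (A n) i) (fun i => fine (lambda2 (A n `&` (unit_itv i `*` setT))))).
- by move=> i; exact: measurable_row_void.
- move=> i; apply: (@coinP_coordT _ (fun k => cell_void (square_pt i k) (A n))
      (fun k => fine (lambda2 (A n `&` (unit_itv i `*` unit_itv k))))).
      by move=> k; apply: measurable_cell_void; [exact: measurable_square_pt|exact: mA].
    move=> k; apply: coinP_cell_void; [exact: measurable_square_pt|exact: mA|].
    rewrite fineK ?coinP_square_pt// ge0_fin_numE//.
    apply: le_lt_trans Aoo; apply: le_measure; rewrite ?inE; [|exact: mA|exact: subIsetl].
    by apply: measurableI; [exact: mA|apply: measurableX; exact: measurable_unit_itv].
  have := @series_partition _ _ _ lambda2 (A n `&` (unit_itv i `*` setT))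
    (fun k => setT `*` unit_itv k) (mAT i) (AToo i) mS.
  under [X in series X]funext => k do rewrite -setIA -setXI setIT setTI.
  apply.
    move=> j k _ _ [y [[_ h1] [_ h2]]]; apply: trivIset_unit_itv => //.
    by exists y.2.
  by rewrite -setX_bigcupr bigcup_unit_itv setXTT.
- have := @series_partition _ _ _ lambda2 (A n)
    (fun k => unit_itv k `*` setT) (mA n) Aoo mT.
  have -> : fine (lambda2 (A n)) = a n by rewrite Aa.
  apply.
    move=> j k _ _ [y [[h1 _] [h2 _]]]; apply: trivIset_unit_itv => //.
    by exists y.1.
  by rewrite -setX_bigcupl bigcup_unit_itv setXTT.
Qed.

End poisson_process.

(** * Configurations and the action of the plane *)

Section configurations.
Context {R : realType}.
Local Notation lambda := (@lebesgue_measure R).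
Local Notation lambda2 := (lambda \x lambda)%E.
Local Notation plane := (R * R)%type.

(** Openness lets rational boxes detect a point in [A n], which joint measurability of the action
    rests on. One bound for positions and levels gives finite total area, and makes a large
    translation separate two such families. *)
Definition admissible (A : nat -> set plane) : Prop :=
  [/\ forall n, open (A n), forall n, measurable (A n) &
      exists M : nat, (forall n q, A n q -> `|q.1| <= M%:R /\ `|q.2| <= M%:R) /\
                      (forall n, (M <= n)%N -> A n = set0)].

Definition void_events : set (set (nat -> set plane)) :=
  [set V | exists2 A, admissible A & V = void A].

Definition config := g_sigma_algebraType void_events.
HB.instance Definition _ := Measurable.on config.

Lemma admissible0 : admissible (fun=> set0).
Proof. by split=> [n|n|]; [exact: open0|exact: measurable0|exists 0%N; split]. Qed.

Lemma void0 : void (fun=> set0) = setT :> set (nat -> set plane).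
Proof. by apply/seteqP; split => // Z _ n p _. Qed.

Lemma admissibleU A B : admissible A -> admissible B ->
  admissible (fun n => A n `|` B n).
Proof.
move=> [oA mA [M [bA eA]]] [oB mB [N [bB eB]]]; split.
- by move=> n; exact: openU.
- by move=> n; exact: measurableU.
- exists (maxn M N); split => [n q [/bA|/bB] [h1 h2]|n].
  + by split; [apply: (le_trans h1)|apply: (le_trans h2)]; rewrite ler_nat leq_maxl.
  + by split; [apply: (le_trans h1)|apply: (le_trans h2)]; rewrite ler_nat leq_maxr.
  + by rewrite geq_max => /andP[Mn Nn]; rewrite eA// eB// setU0.
Qed.

Lemma voidI (A B : nat -> set plane) :
  void A `&` void B = void (fun n => A n `|` B n).
Proof.
apply/seteqP; split => [Z [hA hB] n p Zp [/(hA _ _ Zp)|/(hB _ _ Zp)]//|Z h].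
by split => n p Zp Ap; apply: (h n p Zp); [left|right].
Qed.

Lemma void_events_setI : setI_closed void_events.
Proof.
move=> _ _ [A hA ->] [B hB ->]; exists (fun n => A n `|` B n).
  exact: admissibleU.
exact: voidI.
Qed.

Lemma void_eventsT : void_events setT.
Proof. by exists (fun=> set0); [exact: admissible0|rewrite void0]. Qed.

Lemma measurable_void A : admissible A -> measurable (void A : set config).
Proof. by move=> hA; apply: sub_sigma_algebra; exists A. Qed.

Lemma measurable_into_config d (T : measurableType d) (f : T -> config) :
  (forall A, admissible A -> measurable (f @^-1` void A)) -> measurable_fun setT f.
Proof.
move=> mf; apply: (measurability (void_events : set (set config))) => //.
by move=> _ [_ [A hA ->] <-]; rewrite setTI; exact: mf.
Qed.

Lemma measurable_poisson_conf :
  measurable_fun setT (poisson_conf : coin -> config).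
Proof.
apply: measurable_into_config => A [_ mA _].
exact: measurable_poisson_conf_void.
Qed.

Definition configP : probability config R := law (@coinP R) measurable_poisson_conf.

Definition mass (A : nat -> set plane) : R := limn (series (fun n => fine (lambda2 (A n)))).

Lemma lambda2_box (M : R) : 0 <= M ->
  lambda2 [set q : plane | `|q.1| <= M /\ `|q.2| <= M] = ((2 * M) ^+ 2)%:E.
Proof.
move=> M0; rewrite (_ : [set q | _] = `[- M, M]%classic `*` `[- M, M]%classic).
  rewrite product_measure1E//= !lebesgue_measure_itv/= lte_fin.
  case: ifPn => [_|]; first by rewrite -EFinB -EFinM; congr EFin; ring.
  by rewrite -leNgt => h; rewrite mule0 (_ : M = 0) ?mulr0 ?expr0n//; lra.
by apply/seteqP; split => -[a b] /=; rewrite !in_itv/= !ler_norml => -[-> ->].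
Qed.

Lemma measurable_box (M : R) : measurable [set q : plane | `|q.1| <= M /\ `|q.2| <= M].
Proof.
rewrite (_ : [set q | _] = `[- M, M]%classic `*` `[- M, M]%classic).
  by apply: measurableX; exact: measurable_itv.
by apply/seteqP; split => -[a b] /=; rewrite !in_itv/= !ler_norml => -[-> ->].
Qed.

Lemma admissible_fin A n : admissible A -> lambda2 (A n) \is a fin_num.
Proof.
move=> [_ mA [M [bA _]]]; rewrite ge0_fin_numE//.
apply: (@le_lt_trans _ _ (lambda2 [set q : plane | `|q.1| <= M%:R /\ `|q.2| <= M%:R])).
  by apply: le_measure; rewrite ?inE; [exact: mA|exact: measurable_box|exact: bA].
by rewrite lambda2_box// ltry.
Qed.

Lemma cvg_mass A : admissible A ->
  series (fun n => fine (lambda2 (A n))) @ \oo --> mass A.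
Proof.
move=> [_ _ [M [_ eA]]]; apply: (@cvgP _ _ (series (fun n => fine (lambda2 (A n))) M)).
apply: cvg_near_cst; exists M => // n /= Mn.
rewrite /series/= (big_cat_nat (leq0n M) Mn)/= [X in _ + X]big_nat_cond [X in _ + X]big1 ?addr0//.
by move=> i /andP[/andP[Mi _] _]; rewrite eA// measure0.
Qed.

Lemma configP_void A : admissible A -> configP (void A) = (expR (- mass A))%:E.
Proof.
move=> hA; have [_ mA _] := hA.
apply: (coinP_poisson_conf_void mA _ (cvg_mass hA)) => n.
by rewrite fineK// admissible_fin.
Qed.

(** Avoiding [A] and avoiding [B] amount to avoiding their levelwise union, so void events are a
    generating family closed under intersection. *)
Lemma config_measure_unique (m1 m2 : {measure set config -> \bar R}) :
  (m1 setT < +oo)%E -> (forall A, admissible A -> m1 (void A) = m2 (void A)) ->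
  forall S, measurable S -> m1 S = m2 S.
Proof.
move=> m1T h S mS.
apply: (@measure_unique _ R config void_events (fun=> setT)) => //.
- exact: void_events_setI.
- by move=> _; exact: void_eventsT.
- by rewrite bigcup_const.
- by move=> _ [A hA ->]; exact: h.
Qed.

End configurations.

Section action.
Context {R : realType}.
Local Notation lambda := (@lebesgue_measure R).
Local Notation lambda2 := (lambda \x lambda)%E.
Local Notation plane := (R * R)%type.
Variables (u0 u1 : R) (D : nat -> R).

(* A configuration gives, for each level [n], a set of points in the coordinates
(α, β) / [D n]. *)
Definition disp (n : nat) (g : plane) : plane :=
  ((u1 * g.1 - g.2) / D n, (g.2 - u0 * g.1) / D n).

(** The configuration as seen from [g]: what is read off at the origin of [act g Z] is the value of
    the field of [Z] at [g]. *)
Definition act (g : plane) (Z : config) : @config R :=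
  fun n => [set q | Z n (q.1 + (disp n g).1, q.2 + (disp n g).2)].

(** The shift opposite to that of [act]: instead of the configuration, the sets to be avoided are
    moved. *)
Definition translate (g : plane) (A : nat -> set plane) : nat -> set plane :=
  fun n => [set q | A n (- (disp n g).1 + q.1, - (disp n g).2 + q.2)].

Lemma act0 Z : act (0, 0) Z = Z.
Proof.
apply/funext => n; apply/funext => -[a b].
by rewrite /act/disp /= !mulr0 !subr0 !mul0r !addr0.
Qed.

Lemma actD g h Z : act (g.1 + h.1, g.2 + h.2) Z = act g (act h Z).
Proof.
apply/funext => n; apply/funext => -[a b]; rewrite /act/=.
by congr (Z n (_, _)); ring.
Qed.

Lemma actN g Z : act g (act (- g.1, - g.2) Z) = Z.
Proof. by rewrite -(actD g (- g.1, - g.2)) /= !subrr act0. Qed.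

Lemma actNl g Z : act (- g.1, - g.2) (act g Z) = Z.
Proof. by rewrite -(actD (- g.1, - g.2) g) /= !addNr act0. Qed.

Lemma image_act g S : act g @` S = act (- g.1, - g.2) @^-1` S.
Proof.
apply/seteqP; split => [_ [Z SZ <-]|Z SZ]; first by rewrite /preimage/= actNl.
by exists (act (- g.1, - g.2) Z) => //; exact: actN.
Qed.

Lemma preimage_act_void g A : act g @^-1` void A = void (translate g A).
Proof.
apply/seteqP; split => [Z h n p Zp|Z h n p Zp].
  rewrite /translate /= => Ap; apply: (h n _ _ Ap); rewrite /act /=.
  by move: Zp; congr (Z n _); case: p Ap => a b _ /=; congr (_, _); ring.
move=> Ap; apply: (h n _ Zp); rewrite /translate/=.
by move: Ap; congr (A n _); case: p Zp => a b _ /=; congr (_, _); ring.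
Qed.

Let shift_cont (a b : R) : continuous (fun q : plane => (a + q.1, b + q.2)).
Proof.
move=> q; rewrite (_ : (fun _ => _) = (fun q : plane => (a, b) + q))//.
by apply: cvgD; [exact: cvg_cst|exact: cvg_id].
Qed.

Let measurable_shift (a b : R) (A : set plane) : measurable A ->
  measurable ((fun q : plane => (a + q.1, b + q.2)) @^-1` A).
Proof.
move=> mA; apply: measurable_preimage mA.
by apply: measurable_fun_pair; apply: measurable_funD => //; exact: measurable_cst.
Qed.

Lemma translate_admissible g A : admissible A -> admissible (translate g A).
Proof.
move=> [oA mA [M [bA eA]]]; split.
- move=> n; rewrite /translate; have := oA n; apply: open_comp => q _.
  exact: shift_cont.
- by move=> n; exact: measurable_shift.
(* Each level is displaced by a different amount; only the finitely many levels below [M] matter, so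
   the sum bounds all relevant displacements. *)
- pose s := \sum_(n < M) (`|(disp n g).1| + `|(disp n g).2|).
  have hs n : (n < M)%N -> `|(disp n g).1| + `|(disp n g).2| <= s.
    move=> nM; rewrite /s (bigD1 (Ordinal nM))//= lerDl.
    by apply: sumr_ge0 => i _; exact: addr_ge0.
  have s0 : 0 <= s by apply: sumr_ge0 => i _; exact: addr_ge0.
  exists (M + (Num.truncn s).+1)%N; split => [n q|n Mn].
    rewrite /translate/= => Aq; have [nM|Mn] := ltnP n M; last by move: Aq; rewrite eA.
    have [/= h1 h2] := bA _ _ Aq.
    have hn := hs _ nM.
    have st : s < (Num.truncn s).+1%:R by case/andP: (Num.Theory.truncn_itv s0).
    rewrite natrD.
    have ha := normr_ge0 (disp n g).1; have hb := normr_ge0 (disp n g).2.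
    split.
      rewrite -[q.1](addKr (- (disp n g).1)) opprK (le_trans (ler_normD _ _))//; lra.
    rewrite -[q.2](addKr (- (disp n g).2)) opprK (le_trans (ler_normD _ _))//; lra.
  rewrite -subset0 => q; rewrite /translate/= eA//.
  by rewrite (leq_trans _ Mn)// leq_addr.
Qed.

Lemma lambda2_translate g A n : measurable (A n) ->
  lambda2 (translate g A n) = lambda2 (A n).
Proof. by move=> mA; exact: lebesgue_measure2_shift. Qed.

Lemma mass_translate g A : admissible A -> mass (translate g A) = mass A.
Proof.
move=> [_ mA _]; rewrite /mass; congr (limn (series _)); apply/funext => n.
by rewrite lambda2_translate.
Qed.

Lemma measurable_act g : measurable_fun setT (act g).
Proof.
apply: measurable_into_config => A hA; rewrite preimage_act_void.
by apply: measurable_void; exact: translate_admissible.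
Qed.

(** Translation keeps the area on each level, hence all void probabilities, hence the law. *)
Lemma configP_act g S : measurable S -> configP (act g @^-1` S) = configP S.
Proof.
move=> mS; rewrite -(lawE configP (measurable_act g)).
apply: (config_measure_unique (m1 := law configP (measurable_act g)) (m2 := configP) _ _ mS).
  by rewrite (le_lt_trans (probability_le1 _ _))// ltry.
move=> A hA; rewrite -[LHS]/(configP (act g @^-1` void A)) preimage_act_void.
transitivity ((expR (- mass (translate g A)))%:E).
  by apply: configP_void; exact: translate_admissible.
by rewrite mass_translate//; apply/esym; exact: configP_void.
Qed.

End action.

(** * Joint measurability of the action *)

Section joint_measurability.
Context {R : realType}.
Local Notation plane := (R * R)%type.
Variables (u0 u1 : R) (D : nat -> R).

Definition open_box (c r : plane) : set plane :=
  [set q | `|q.1 - c.1| < r.1 /\ `|q.2 - c.2| < r.2].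

Lemma open_boxE c r : open_box c r =
  `]c.1 - r.1, c.1 + r.1[%classic `*` `]c.2 - r.2, c.2 + r.2[%classic.
Proof.
by apply/seteqP; split => q; rewrite /open_box /= !in_itv/= !ltr_distl => -[-> ->].
Qed.

Lemma measurable_open_box c r : measurable (open_box c r).
Proof. by rewrite open_boxE; apply: measurableX; exact: measurable_itv. Qed.

Lemma open_open_box c r : open (open_box c r).
Proof.
rewrite open_boxE -[X in open X]/(fst @^-1` _ `&` snd @^-1` _).
by apply: openI; apply: open_comp (itv_open _ _) => q _; [exact: cvg_fst|exact: cvg_snd].
Qed.

Definition box_at n c r : nat -> set plane :=
  fun m => if m == n then open_box c r else set0.

Lemma admissible_box_at n c r : admissible (box_at n c r).
Proof.
rewrite /box_at; split => [m|m|].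
- by case: ifP => _; [exact: open_open_box|exact: open0].
- by case: ifP => _; [exact: measurable_open_box|exact: measurable0].
exists (n.+1 + (Num.truncn (`|c.1| + `|c.2| + (`|r.1| + `|r.2|))).+1)%N; split => [m q|m nm].
  case: ifP => // _ [h1 h2].
  have := Num.Theory.truncnS_gt (`|c.1| + `|c.2| + (`|r.1| + `|r.2|)).
  have h3 := ler_normD (q.1 - c.1) c.1; have h4 := ler_normD (q.2 - c.2) c.2.
  rewrite !subrK in h3 h4.
  have h5 := ler_norm r.1; have h5' := ler_norm r.2; have h9 := normr_ge0 r.1; have h9' := normr_ge0 r.2; have h6 := normr_ge0 c.1; have h7 := normr_ge0 c.2.
  have h8 : 0 <= n.+1%:R :> R by [].
  by rewrite natrD; split; lra.
by rewrite gtn_eqF// (leq_trans _ nm)// leq_addr.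
Qed.

Lemma void_box_at n c r (Z : nat -> set plane) :
  void (box_at n c r) Z <-> ~ exists2 q, Z n q & open_box c r q.
Proof.
split=> [h [q Zq qb]|h m q Zq]; first by apply: (h n q Zq); rewrite /box_at eqxx.
by rewrite /box_at; case: ifP => // /eqP mn qb; apply: h; exists q; rewrite -?mn.
Qed.

Lemma rat_approx (x e : R) : 0 < e -> exists q : rat, `|x - ratr q| < e.
Proof.
move=> e0; have : x - e < x + e by lra.
by move=> /rat_in_itvoo[q]; rewrite in_itv/= => h; exists q; rewrite distrC ltr_distl.
Qed.

Local Notation disp := (disp u0 u1 D).
Local Notation act := (act u0 u1 D).

Lemma measurable_disp n : measurable_fun setT (disp n : plane -> plane).
Proof.
have m1 : measurable_fun setT (fst : plane -> R) by exact: measurable_fst.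
have m2 : measurable_fun setT (snd : plane -> R) by exact: measurable_snd.
by apply: measurable_fun_pair; apply: measurable_funM => //;
  apply: measurable_funB => //; apply: measurable_funM => //.
Qed.

(** The translated configuration meets the open set [A n] exactly when some rational box around a
    point of [Z], minus some rational box around the displacement, lies within [A n]. The complement
    of the preimage is thus a countable union of rectangles [G i] times [H i]. *)
Lemma measurable_act_joint :
  measurable_fun setT (fun z : plane * config => act z.1 z.2).
Proof.
apply: measurable_into_config => A [oA mA _].
pose I := (nat * (rat * rat) * (rat * rat) * nat)%type.
pose rp (c : rat * rat) : plane := (ratr c.1, ratr c.2).
pose rad (k : nat) : plane := (k.+1%:R^-1, k.+1%:R^-1).
pose ok (i : I) := let: (n, a, b, k) := i in
  forall q s, open_box (rp a) (rad k) q -> open_box (rp b) (rad k) s ->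
    A n (q.1 - s.1, q.2 - s.2).
pose G (i : I) : set plane := let: (n, a, b, k) := i in
  disp n @^-1` open_box (rp b) (rad k).
pose H (i : I) : set config := let: (n, a, b, k) := i in
  ~` void (box_at n (rp a) (rad k)).
pose F (i : I) : set (plane * config) :=
  if pselect (ok i) then G i `*` H i else set0.
rewrite (_ : _ @^-1` _ = ~` \bigcup_i F i).
  apply: measurableC; apply: countable_bigcupT_measurable.
    exact: countableP.
  move=> [[[n a] b] k]; rewrite /F; case: (pselect (ok _)) => [hok|hok]; last exact: measurable0.
  apply: measurableX.
    apply: measurable_preimage; first exact: measurable_disp.
    exact: measurable_open_box.
  by apply: measurableC; apply: measurable_void; exact: admissible_box_at.
apply/seteqP; split => [[g Z] /= h [[[[n a] b] k] _]|[g Z] /= h n q Zq Aq].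
  rewrite /F; case: (pselect (ok _)) => // ok_ [/= gb hv].
  have [q Zq qa] : exists2 q, Z n q & open_box (rp a) (rad k) q.
    by apply: contrapT => no; apply: hv; apply/void_box_at.
  have := ok_ _ _ qa gb; apply: (h n); rewrite /act/=.
  by rewrite !subrK -surjective_pairing.
apply: h; set s := disp n g in Zq.
have : nbhs q (A n) by exact: open_nbhs_nbhs.
move=> /nbhs_ballP[e /= e0 he].
(* Four errors of size at most the radius add up: two from the centres to the true points and two
   within the boxes. *)
have [k hk] : exists k, k.+1%:R^-1 < e / 4 :> R.
  exists (Num.truncn (e / 4)^-1).
  rewrite -[ltRHS]invrK ltf_pV2 ?posrE// ?invr_gt0 ?divr_gt0//.
  exact: Num.Theory.truncnS_gt.
set r := k.+1%:R^-1 in hk; have r0 : 0 < r by rewrite invr_gt0.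
have [a1 ha1] := rat_approx (q.1 + s.1) r0.
have [a2 ha2] := rat_approx (q.2 + s.2) r0.
have [b1 hb1] := rat_approx s.1 r0; have [b2 hb2] := rat_approx s.2 r0.
exists (n, (a1, a2), (b1, b2), k) => //; rewrite /F; case: (pselect (ok _)) => [hok|no] /=.
  split => //; move/void_box_at; apply.
  by exists (q.1 + s.1, q.2 + s.2).
exfalso; apply: no => -[p1 p2] [s1 s2] [/= hp1 hp2] [/= hs1 hs2]; apply: he.
move: ha1 ha2 hb1 hb2 hp1 hp2 hs1 hs2; rewrite -/r !ltr_distl.
move=> /andP[? ?] /andP[? ?] /andP[? ?] /andP[? ?] /andP[? ?] /andP[? ?] /andP[? ?] /andP[? ?].
by split => /=; rewrite /ball/= ltr_distl; apply/andP; split; lra.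
Qed.

Lemma lambda2_open_box (c r : plane) : 0 <= r.1 -> 0 <= r.2 ->
  (lebesgue_measure \x lebesgue_measure)%E (open_box c r) = (4 * r.1 * r.2)%:E.
Proof.
have itvE (x y : R) : 0 <= y -> lebesgue_measure (`]x - y, x + y[%classic : set R) = (2 * y)%:E.
  move=> y0; rewrite lebesgue_measure_itv/= lte_fin; case: ifPn => [_|].
    by rewrite -EFinB; congr EFin; ring.
  by rewrite -leNgt => h; congr EFin; lra.
move=> r1 r2; rewrite open_boxE product_measure1E; [|exact: measurable_itv|exact: measurable_itv].
rewrite [X in (X * _)%E](itvE c.1 r.1 r1) [X in (_ * X)%E](itvE c.2 r.2 r2).
by rewrite -EFinM; congr EFin; ring.
Qed.

Lemma mass_box_at n c r : 0 <= r.1 -> 0 <= r.2 -> mass (box_at n c r) = 4 * r.1 * r.2.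
Proof.
move=> r1 r2; apply: (cvg_unique (@Rhausdorff R) (cvg_mass (admissible_box_at n c r))).
apply: cvg_near_cst; exists n.+1 => // k /= nk.
rewrite /series/= (bigD1_seq n) ?mem_index_iota ?iota_uniq//=.
rewrite {1}/box_at eqxx lambda2_open_box//= big1 ?addr0// => i ni.
by rewrite /box_at (negbTE ni) measure0.
Qed.

Lemma configP_box_at n c r : 0 <= r.1 -> 0 <= r.2 ->
  configP (void (box_at n c r)) = (expR (- (4 * r.1 * r.2)))%:E.
Proof. by move=> r1 r2; rewrite configP_void ?mass_box_at//; exact: admissible_box_at. Qed.

End joint_measurability.

(** * Mixing *)

Section mixing_dynkin.
Context d (T : measurableType d) (R : realType) (P : probability T R).
(* [nu g S] is meant to be P(T_g^-1 S ∩ B), or P(T_g^-1 B ∩ S), for a fixed [B] with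
P(B) = [c]. *)
Variables (J : Type) (size : J -> R) (nu : J -> set T -> R) (c : R).
Hypotheses (c0 : 0 <= c) (c1 : c <= 1).
Hypothesis nu_ge0 : forall g S, measurable S -> 0 <= nu g S.
Hypothesis nu_le : forall g S, measurable S -> nu g S <= fine (P S).
Hypothesis nuT : forall g, nu g setT = c.
Hypothesis nuU : forall g S S', measurable S -> measurable S' ->
  S `&` S' = set0 -> nu g (S `|` S') = nu g S + nu g S'.

Definition decorrelates (S : set T) := forall e : R, 0 < e ->
  exists r0, forall g, r0 < size g -> `|nu g S - c * fine (P S)| <= e.

Let PU S S' : measurable S -> measurable S' -> S `&` S' = set0 ->
  fine (P (S `|` S')) = fine (P S) + fine (P S').
Proof. by move=> mS mS' SS'; rewrite measureU// fineD// fin_num_measure. Qed.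

Let decorrelatesU S S' : measurable S -> measurable S' -> S `&` S' = set0 ->
  decorrelates S -> decorrelates S' -> decorrelates (S `|` S').
Proof.
move=> mS mS' SS' h h' e e0; have e20 : 0 < e / 2 by lra.
have [r hr] := h _ e20; have [r' hr'] := h' _ e20.
exists (Num.max r r') => g; rewrite gt_max => /andP[/hr rg /hr' rg'].
rewrite nuU// PU//; move: rg rg'; rewrite !ler_norml => /andP[? ?] /andP[? ?].
by apply/andP; split; lra.
Qed.

(** For a countable disjoint union the tail is small uniformly in [g], because [nu g] is dominated
    by [P]; only a finite union is left, for which the limits can be added. *)
Lemma decorrelates_dynkin (G : set (set T)) : @measurable _ T = <<s G >> ->
  setI_closed G -> (forall S, G S -> decorrelates S) ->
  forall S, measurable S -> decorrelates S.
Proof.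
move=> GE GI hG S; rewrite GE; move: S; apply: dynkin_induction => //.
- by move=> e e0; exists 0 => g _; rewrite nuT probability_setT mulr1 subrr normr0 ltW.
- move=> S mS h e e0; have [r hr] := h _ e0; exists r => g /hr.
  have nS : nu g (~` S) = c - nu g S.
    have := @nuU g S (~` S) mS (measurableC mS) (setICr _).
    by rewrite setUv nuT; lra.
  have pS : fine (P (~` S)) = 1 - fine (P S).
    have := @PU S (~` S) mS (measurableC mS) (setICr _).
    by rewrite setUv probability_setT/=; lra.
  by rewrite nS pS -normrN; congr (`|_| <= _); ring.
- move=> F mF tF hF e e0.
  pose U n := \big[setU/set0]_(i < n) F i.
  have mU n : measurable (U n) by exact: bigsetU_measurable.
  have hU n : decorrelates (U n).
    elim: n => [|n IH].
      rewrite /U big_ord0 => e' e'0; exists 0 => g _.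
      suff -> : nu g set0 = 0 by rewrite measure0 mulr0 subrr normr0 ltW.
      have := @nuU g set0 set0 measurable0 measurable0 (setI0 _).
      by rewrite setU0; lra.
    rewrite /U big_ord_recr/=; apply: decorrelatesU; [exact: mU|exact: mF| |exact: IH|exact: hF].
    rewrite -subset0 => x []; rewrite -bigcup_mkord => -[i /= ik Fix Fnx].
    have ein := tF i n I I (ex_intro _ x (conj Fix Fnx)).
    by move: ik; rewrite ein ltnn.
  have mB : measurable (\bigcup_k F k) by exact: bigcupT_measurable.
  have UB n : U n `<=` \bigcup_k F k.
    by move=> x; rewrite /U -bigcup_mkord => -[i _ Fi]; exists i.
  have mD n : measurable (\bigcup_k F k `\` U n) by exact: measurableD.
  have dU n : U n `&` (\bigcup_k F k `\` U n) = set0 by rewrite setDIK.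
  have eU n : U n `|` (\bigcup_k F k `\` U n) = \bigcup_k F k.
    by rewrite setDUK.
  have [n hn] : exists n, fine (P (\bigcup_k F k `\` U n)) <= e / 4.
    have : (P \o U) n @[n --> \oo] --> P (\bigcup_n U n).
      apply: nondecreasing_cvg_mu => //; first exact: bigcupT_measurable.
      move=> m n mn; apply/subsetPset => x; rewrite /U -!bigcup_mkord.
      by move=> [i /= im Fi]; exists i => //=; exact: leq_trans mn.
    have -> : \bigcup_n U n = \bigcup_k F k.
      apply/seteqP; split => [x [n _ /UB]//|x [k _ Fk]].
      by exists k.+1 => //; rewrite /U -bigcup_mkord; exists k => //=.
    have /fineK <- : P (\bigcup_k F k) \is a fin_num by rewrite fin_num_measure.
    move/fine_cvg/cvgrPdist_le => /(_ (e / 4)).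
    have e40 : 0 < e / 4 by lra.
    move=> /(_ e40)[n _ /(_ n (leqnn n)) /= hn]; exists n.
    have := @PU _ _ (mU n) (mD n) (dU n); rewrite eU.
    by move: hn; rewrite ler_norml => /andP[_ ?] ?; lra.
  have e20 : 0 < e / 2 by lra.
  have [r hr] := hU n _ e20; exists r => g /hr.
  have := @PU _ _ (mU n) (mD n) (dU n); rewrite eU => ->.
  have := @nuU g _ _ (mU n) (mD n) (dU n); rewrite eU => ->.
  have k1 := nu_ge0 g (mD n); have k2 := nu_le g (mD n).
  have k3 : 0 <= fine (P (\bigcup_k F k `\` U n)) by rewrite fine_ge0.
  have k4 : 0 <= c * fine (P (\bigcup_k F k `\` U n)) by rewrite mulr_ge0.
  have k5 : c * fine (P (\bigcup_k F k `\` U n)) <= fine (P (\bigcup_k F k `\` U n)).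
    by rewrite ler_piMl.
  by rewrite mulrDr !ler_norml => /andP[? ?]; apply/andP; split; lra.
Qed.

End mixing_dynkin.

Section mixing.
Context {R : realType}.
Local Notation lambda := (@lebesgue_measure R).
Local Notation lambda2 := (lambda \x lambda)%E.
Local Notation plane := (R * R)%type.
Variables (u0 u1 : R) (D : nat -> R).
Hypotheses (h01 : u0 < u1) (D0 : forall n, 0 < D n).
Local Notation disp := (disp u0 u1 D).
Local Notation act := (act u0 u1 D).
Local Notation translate := (translate u0 u1 D).

(** As u0 < u1, the pair (α, β) is a linear coordinate system: [t] is their sum divided by u1 - u0,
    and [x] follows. A large [g] therefore displaces the plane by a large vector. *)
Lemma supnorm2_disp : exists2 C : R, 0 <= C & forall (g : plane) (K : R),
  `|u1 * g.1 - g.2| <= K -> `|g.2 - u0 * g.1| <= K -> supnorm2 g <= C * K.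
Proof.
have d0 : 0 < u1 - u0 by rewrite subr_gt0.
have a0 : 0 <= 2 / (u1 - u0) by rewrite divr_ge0// ltW.
exists (2 / (u1 - u0) * (1 + `|u1|) + 1).
  by rewrite addr_ge0// mulr_ge0// addr_ge0.
move=> [t x] K /= h1 h2.
have K0 : 0 <= K by exact: le_trans h1.
have ht : `|t| <= 2 / (u1 - u0) * K.
  have -> : t = (u1 * t - x + (x - u0 * t)) / (u1 - u0).
    by rewrite addrA subrK -mulrBl mulrC mulrA mulVf ?mul1r// gt_eqF.
  rewrite normrM normfV (ger0_norm (ltW d0)) ler_pdivrMr//.
  rewrite mulrAC mulrVK ?unitfE ?gt_eqF//.
  by rewrite (le_trans (ler_normD _ _))//; lra.
have hx : `|x| <= `|u1| * `|t| + K.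
  have -> : x = u1 * t - (u1 * t - x) by ring.
  by rewrite (le_trans (ler_normB _ _))// normrM lerD2l.
have hx' : `|u1| * `|t| <= `|u1| * (2 / (u1 - u0) * K) by rewrite ler_wpM2l.
set a := 2 / (u1 - u0) in a0 ht hx' *.
rewrite /supnorm2 ge_max /=; apply/andP; split.
  have : 0 <= a * K * `|u1| by apply: mulr_ge0 => //; exact: mulr_ge0.
  by lra.
have : 0 <= a * K by rewrite mulr_ge0.
by lra.
Qed.

Lemma massU (A B : nat -> set plane) : admissible A -> admissible B ->
  (forall n, A n `&` B n = set0) ->
  mass (fun n => A n `|` B n) = mass A + mass B.
Proof.
move=> hA hB AB; apply: (cvg_unique (@Rhausdorff R) (cvg_mass (admissibleU hA hB))).
rewrite (_ : series _ = series (fun n => fine (lambda2 (A n))) \+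
                        series (fun n => fine (lambda2 (B n)))).
  by apply: cvgD; exact: cvg_mass.
apply/funext => n; rewrite /series /= -big_split /=; apply: eq_bigr => i _.
have [_ mA _] := hA; have [_ mB _] := hB.
have mAB := measureU lambda2 (mA i) (mB i) (AB i).
by rewrite [X in fine X]mAB fineD ?admissible_fin.
Qed.

(** Once the translate of [A] is disjoint from [B] on every level, areas add and void probabilities
    multiply exactly, with no error term. *)
Lemma void_decorrelates (A B : nat -> set plane) : admissible A -> admissible B ->
  exists r0, forall g, r0 < supnorm2 g ->
  configP (act g @^-1` void A `&` void B) = (configP (void A) * configP (void B))%E.
Proof.
move=> hA hB; have [C C0 hC] := supnorm2_disp.
have [_ _ [M [bA eA]]] := hA; have [_ _ [N [bB eB]]] := hB.
(* Displacements are measured in units of [D k]; the sum over the levels below [M] serves all of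
   them at once. *)
pose K := (M%:R + N%:R) * \sum_(k < M) D k.
exists (C * K) => g Kg.
have hT := translate_admissible u0 u1 D g hA.
rewrite preimage_act_void voidI configP_void; last exact: admissibleU.
rewrite massU//; last first.
  move=> n; rewrite -subset0 => q [Aq Bq].
  have [nM|Mn] := ltnP n M; last by move: Aq; rewrite /translate /= eA.
  have Dn : D n <= \sum_(k < M) D k.
    rewrite (bigD1 (Ordinal nM))//= lerDl; apply: sumr_ge0 => i _; exact: ltW.
  have [/= a1 a2] := bA _ _ Aq; have [b1 b2] := bB _ _ Bq.
  suff : supnorm2 g <= C * K by rewrite leNgt Kg.
  have red (z y : R) : `|- (z / D n) + y| <= M%:R -> `|y| <= N%:R -> `|z| <= K.
    move=> h1 h2; have hz : `|z / D n| <= M%:R + N%:R.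
      have -> : z / D n = y - (- (z / D n) + y) by ring.
      by rewrite (le_trans (ler_normB _ _))// addrC lerD.
    move: hz; rewrite normrM normfV (gtr0_norm (D0 n)) ler_pdivrMr// => hz.
    by rewrite (le_trans hz)// ler_wpM2l// addr_ge0.
  by apply: hC; [exact: red a1 b1|exact: red a2 b2].
rewrite mass_translate// opprD expRD EFinM.
by congr (_ * _)%E; apply/esym; exact: configP_void.
Qed.

(** The product formula for void events is extended first in the translated event, with the fixed
    one void, then in the fixed event. *)
Lemma act_mixing (S S' : set (@config R)) : measurable S -> measurable S' ->
  forall e : R, 0 < e -> exists r0, forall g, r0 < supnorm2 g ->
  `|fine (configP (act g @^-1` S `&` S')) -
    fine (configP S) * fine (configP S')| <= e.
Proof.
have mact g (X : set (@config R)) : measurable X -> measurable (act g @^-1` X).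
  by apply: measurable_preimage; exact: measurable_act.
have fle g (X Y : set (@config R)) : measurable X -> measurable Y ->
    fine (configP (act g @^-1` X `&` Y)) <= fine (configP X).
  move=> mX mY; rewrite -(configP_act u0 u1 D g mX).
  apply: fine_le; rewrite ?fin_num_measure//; try by [exact: mact|apply: measurableI => //; exact: mact].
  by apply: le_measure; rewrite ?inE; [apply: measurableI => //; exact: mact|exact: mact|exact: subIsetl].
have fle' g (X Y : set (@config R)) : measurable X -> measurable Y ->
    fine (configP (act g @^-1` X `&` Y)) <= fine (configP Y).
  move=> mX mY.
  apply: fine_le; rewrite ?fin_num_measure//; try by [exact: mact|apply: measurableI => //; exact: mact].
  by apply: le_measure; rewrite ?inE; [apply: measurableI => //; exact: mact|exact: mY|exact: subIsetr].
have P01 (X : set (@config R)) : measurable X -> 0 <= fine (@configP R X) <= 1.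
  move=> mX; apply/andP; split; first exact: fine_ge0.
  by rewrite -lee_fin fineK ?fin_num_measure//; exact: probability_le1.
have step1 (V : set (@config R)) (B : nat -> set plane) : void_events V -> admissible B -> forall e : R, 0 < e ->
    exists r0, forall g, r0 < supnorm2 g ->
    `|fine (configP (act g @^-1` V `&` void B)) -
      fine (configP (void B)) * fine (configP V)| <= e.
  move=> [A hA ->] hB e e0; have [r hr] := void_decorrelates hA hB.
  have mA := measurable_void hA; have mB := measurable_void hB.
  exists r => g /hr ->; rewrite fineM; [|exact: fin_num_measure|exact: fin_num_measure].
  by rewrite mulrC subrr normr0 ltW.
have step2 (V : set (@config R)) (B : nat -> set plane) : measurable V -> admissible B -> forall e : R, 0 < e ->
    exists r0, forall g, r0 < supnorm2 g ->
    `|fine (configP (act g @^-1` V `&` void B)) -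
      fine (configP (void B)) * fine (configP V)| <= e.
  move=> mS1 hB; have mB := measurable_void hB.
  have /andP[c0 c1] := P01 _ mB.
  apply: (@decorrelates_dynkin _ config R configP _ supnorm2
    (fun g X => fine (configP (act g @^-1` X `&` void B))) _ c0 c1 _ _ _ _ void_events) => //.
  - by move=> g X mX; rewrite fine_ge0.
  - by move=> g X mX; exact: fle.
  - by move=> g; rewrite preimage_setT setTI.
  - move=> g X Y mX mY XY; rewrite preimage_setU setIUl measureU.
    + by rewrite fineD// fin_num_measure//; apply: measurableI => //; exact: mact.
    + by apply: measurableI => //; exact: mact.
    + by apply: measurableI => //; exact: mact.
    + by rewrite setIACA -preimage_setI XY preimage_set0 set0I.
  - exact: void_events_setI.
  - by move=> X hX; exact: step1.
move=> mS mS'; move: S' mS'; have /andP[c0 c1] := P01 _ mS.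
apply: (@decorrelates_dynkin _ config R configP _ supnorm2
    (fun g X => fine (configP (act g @^-1` S `&` X))) _ c0 c1 _ _ _ _ void_events) => //.
- by move=> g X mX; rewrite fine_ge0.
- by move=> g X mX; exact: fle'.
- by move=> g; rewrite setIT configP_act.
- move=> g X Y mX mY XY; rewrite setIUr measureU.
  + by rewrite fineD// fin_num_measure//; apply: measurableI => //; exact: mact.
  + by apply: measurableI => //; exact: mact.
  + by apply: measurableI => //; exact: mact.
  + by rewrite setIACA XY setI0.
- exact: void_events_setI.
- by move=> _ [B hB ->] e e0; have [r hr] := step2 _ _ mS hB _ e0;
    exists r => g /hr; rewrite mulrC.
Qed.

End mixing.

(** * From decay of correlations to weak mixing *)

Section weak_mixing.
Context {R : realType}.
Local Notation lambda := (@lebesgue_measure R).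
Local Notation lambda2 := (lambda \x lambda)%E.
Local Notation plane := (R * R)%type.
Variables (u0 u1 : R) (D : nat -> R).
Hypotheses (h01 : u0 < u1) (D0 : forall n, 0 < D n).
Local Notation act := (act u0 u1 D).

Lemma act_mp_action : mp_action (@configP R) act.
Proof.
split.
- exact: act0.
- by move=> g h w; exact: actD.
- exact: measurable_act_joint.
- exact: measurable_act.
- by move=> g A mA; exact: configP_act.
Qed.

Let supnormN (g : plane) : supnorm2 (- g.1, - g.2) = supnorm2 g.
Proof. by rewrite /supnorm2 /= !normrN. Qed.

Let ballE (r : R) : [set g : plane | supnorm2 g <= r] =
  [set q : plane | `|q.1| <= r /\ `|q.2| <= r].
Proof.
by apply/seteqP; split => g /=; rewrite /supnorm2 ge_max; [move/andP|move=> [-> ->]].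
Qed.

(** The integrand tends to 0 at infinity and is at most 1, so its averages over growing boxes tend
    to 0. *)
Lemma act_weakly_mixing : weakly_mixing (@configP R) act.
Proof.
move=> A B mA mB.
pose a := fine (@configP R A) * fine (@configP R B).
pose c g := fine (@configP R (act g @` A `&` B)).
have mI g : measurable (act g @` A `&` B).
  rewrite image_act; apply: measurableI => //.
  by apply: measurable_preimage mA; exact: measurable_act.
have P01 (X : set (@config R)) : measurable X -> 0 <= fine (configP X) <= 1.
  move=> mX; apply/andP; split; first exact: fine_ge0.
  by rewrite -lee_fin fineK ?fin_num_measure//; exact: probability_le1.
have hE g : (`|configP (act g @` A `&` B) - configP A * configP B|)%E =
    (`|c g - a|)%:E.
  by rewrite /c /a -abse_EFin EFinB EFinM !fineK ?fin_num_measure.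
under [X in X @ _ --> _]funext => r do under eq_integral => g _ do rewrite hE.
have mc : measurable_fun setT c.
  have mN : measurable_fun setT
      (fun z : plane * @config R => act (- z.1.1, - z.1.2) z.2).
    have mneg : measurable_fun setT (fun z : plane * @config R => ((- z.1.1, - z.1.2), z.2)).
      have m1 : measurable_fun setT (fun z : plane * @config R => z.1.1).
        exact: (measurableT_comp measurable_fst measurable_fst).
      have m2 : measurable_fun setT (fun z : plane * @config R => z.1.2).
        exact: (measurableT_comp measurable_snd measurable_fst).
      apply: measurable_fun_pair; last exact: measurable_snd.
      by apply: measurable_fun_pair; exact: measurable_funN.
    exact: (measurableT_comp (measurable_act_joint u0 u1 D) mneg).
  (* The correlation is the measure of a section of a jointly measurable set, hence measurable in
     [g]; the image under [act g] is the preimage under the inverse translation. *)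
  pose X : set (plane * @config R) :=
    (fun z => act (- z.1.1, - z.1.2) z.2) @^-1` A `&` snd @^-1` B.
  have mX : measurable X.
    apply: measurableI; first exact: measurable_preimage mN mA.
    exact: measurable_preimage measurable_snd mB.
  have -> : c = fine \o (@configP R \o xsection X).
    apply/funext => g; rewrite /c /=; congr (fine (configP _)).
    by apply/seteqP; split => Z; rewrite image_act /xsection /X /= inE.
  apply: measurableT_comp; first exact: fine_measurable.
  exact: measurable_fun_xsection.
have mh (S : set plane) : measurable_fun S (fun g => (`|c g - a|)%:E).
  apply/measurable_EFinP; apply: measurable_funTS; apply: measurableT_comp => //.
  by apply: measurable_funB => //.
(* The integrand is at most 1 on the box of radius [r0] and at most [e] outside. *)
have bound (e : R) : 0 < e -> exists r0 : R, 0 <= r0 /\ forall r, 0 <= r ->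
    (\int[lambda2]_(g in [set g | (supnorm2 g <= r)%R]) (`|c g - a|)%:E <=
     ((2 * r0) ^+ 2 + e * (2 * r) ^+ 2)%:E)%E.
  move=> e0; have [r1 hr1] := act_mixing h01 D0 mA mB e0.
  exists (Num.max r1 0); split; first by rewrite le_max lexx orbT.
  set r0 := Num.max r1 0 => r r_0.
  have r00 : 0 <= r0 by rewrite le_max lexx orbT.
  rewrite ballE.
  have mb := @measurable_box R.
  apply: (@le_trans _ _ (\int[lambda2]_(g in [set q : plane | (`|q.1| <= r /\ `|q.2| <= r)%R])
     ((\1_[set q : plane | (`|q.1| <= r0 /\ `|q.2| <= r0)%R] g)%:E + e%:E))%E).
    apply: ge0_le_integral; [exact: mb|by []|exact: mh| |].
    - apply: emeasurable_funD => //; apply/measurable_EFinP.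
      by apply: measurable_funTS; apply: measurable_indic; exact: mb.
    - move=> g _; rewrite -EFinD lee_fin indicE.
      have [gr|gr] := pselect (`|g.1| <= r0 /\ `|g.2| <= r0).
        rewrite mem_set//= ; have /andP[c0 c1] := P01 _ (mI g).
        have /andP[a0 a1] : 0 <= a <= 1.
          have /andP[p0 p1] := P01 _ mA; have /andP[q0 q1] := P01 _ mB.
          by rewrite mulr_ge0//= mulr_ile1.
        by rewrite ler_norml; apply/andP; split; rewrite /c; lra.
      rewrite memNset//= add0r /c image_act; apply: hr1.
      rewrite supnormN ltNge; apply/negP => h; apply: gr.
      have : [set g : plane | supnorm2 g <= r0] g.
        by rewrite /= (le_trans h)// le_max lexx.
      by rewrite ballE.
  have mi : measurable_fun [set q : plane | (`|q.1| <= r /\ `|q.2| <= r)%R]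
      (fun g => (\1_[set q : plane | (`|q.1| <= r0 /\ `|q.2| <= r0)%R] g : R)%:E).
    apply/measurable_EFinP; apply: measurable_funTS; apply: measurable_indic.
    exact: mb.
  rewrite ge0_integralD; try exact: mb; try exact: mi; try exact: measurable_cst; try (by move=> *; rewrite ?lee_fin ?(ltW e0) ?indicE).
  have -> := integral_indic lambda2 (mb r) (mb r0).
  have -> := integral_cst lambda2 (mb r) e%:E.
  rewrite EFinD [(e * _)%:E]EFinM -(lambda2_box r00) -(lambda2_box r_0).
  apply: leeD => //; apply: le_measure; rewrite ?inE; [|exact: mb|exact: subIsetl].
  by apply: measurableI; exact: mb.
have bound' (e : R) : 0 < e -> \forall r \near +oo,
    (0 <= ((2 * r) ^- 2)%:E * \int[lambda2]_(g in [set g | (supnorm2 g <= r)%R]) (`|c g - a|)%:E <= e%:E)%E.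
  move=> e0; have e20 : 0 < e / 2 by lra.
  have [r0 [r00 h]] := bound _ e20.
  near=> r.
  have r_0 : 0 < r by near: r; apply: nbhs_pinfty_gt; rewrite num_real.
  (* The constant term is then below [r * (e / 2)], which for [r >= 1] is at most the area of the
     box times [e / 2]. *)
  have rr : (2 * r0) ^+ 2 / (e / 2) < r by near: r; apply: nbhs_pinfty_gt; rewrite num_real.
  have r1 : 1 <= r by near: r; apply: nbhs_pinfty_ge; rewrite num_real.
  have k0 : 0 < (2 * r) ^+ 2 by rewrite exprn_gt0// mulr_gt0.
  apply/andP; split.
    by rewrite mule_ge0 ?lee_fin ?invr_ge0 ?(ltW k0)// integral_ge0.
  apply: (@le_trans _ _ (((2 * r) ^- 2)%:E * ((2 * r0) ^+ 2 + (e / 2) * (2 * r) ^+ 2)%:E)%E).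
    by rewrite lee_pmul2l ?lte_fin ?invr_gt0// h// ltW.
  rewrite -EFinM lee_fin mulrC ler_pdivrMr//.
  move: rr; rewrite ltr_pdivrMr// => rr.
  have : r * (e / 2) <= (2 * r) ^+ 2 * (e / 2).
    by rewrite ler_pM2r// expr2; nra.
  by lra.
have fin : \forall r \near +oo, (((2 * r) ^- 2)%:E * \int[lambda2]_(g in [set g | (supnorm2 g <= r)%R]) (`|c g - a|)%:E)%E \is a fin_num.
  move: (bound' 1 ltr01); apply: filterS => r /andP[h1 h2].
  by rewrite ge0_fin_numE// (le_lt_trans h2)// ltry.
apply: cvg_EFin => //; apply/cvgrPdist_le => e e0.
near=> r; rewrite sub0r normrN.
have hr : (0 <= ((2 * r) ^- 2)%:E * \int[lambda2]_(g in [set g | (supnorm2 g <= r)%R]) (`|c g - a|)%:E <= e%:E)%E.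
  by near: r; exact: bound'.
have fr : (((2 * r) ^- 2)%:E * \int[lambda2]_(g in [set g | (supnorm2 g <= r)%R]) (`|c g - a|)%:E)%E \is a fin_num.
  by near: r; exact: fin.
case/andP: hr => hr1 hr2; rewrite /comp ger0_norm ?fine_ge0//.
by rewrite -lee_fin fineK.
Unshelve. all: by end_near.
Qed.

End weak_mixing.

(** * Mollification *)

Section derivative_criterion.
Context {R : realType} {V : normedModType R}.

(** A remainder of second order is an estimate that survives integration, so the mollified field can
    be differentiated by integrating a pointwise bound. *)
Lemma is_derive_quadratic (f : V -> R) (x v : V) (d C r : R) : 0 < r ->
  (forall h, `|h| <= r -> `|f (h *: v + x) - f x - h * d| <= C * h ^+ 2) ->
  is_derive x v f d.
Proof.
move=> r0 hf.
have cf : h^-1 *: ((f \o shift x) (h *: v) - f x) @[h --> 0^'] --> d.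
  apply/cvgrPdist_le => e e0.
  have C0 : 0 < `|C| + 1 by rewrite ltr_wpDl.
  near=> h.
  have h0 : h != 0 by near: h; exact: nbhs_dnbhs_neq.
  have hr : `|h| <= r by near: h; apply: dnbhs0_le.
  have he : `|h| <= e / (`|C| + 1) by near: h; apply: dnbhs0_le; rewrite divr_gt0.
  have -> : d - h^-1 *: ((f \o shift x) (h *: v) - f x) =
      - (h^-1 * (f (h *: v + x) - f x - h * d)).
    by rewrite /= /GRing.scale /=; field.
  rewrite normrN normrM normfV ler_pdivrMl ?normr_gt0//.
  apply: (le_trans (hf _ hr)); rewrite -real_normK ?num_real// expr2 mulrA.
  rewrite [leRHS]mulrC ler_wpM2r//.
  move: he; rewrite ler_pdivlMr// mulrC => he; apply: le_trans he.
  rewrite ler_wpM2r//.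
  by rewrite (le_trans (ler_norm _))// lerDl.
by apply: DeriveDef; [exact: cvgP cf|exact: cvg_lim cf].
Unshelve. all: by end_near.
Qed.

Lemma is_derive_near_eq (f g : V -> R) (x v : V) (d : R) :
  {near x, f =1 g} -> is_derive x v f d -> is_derive x v g d.
Proof.
move=> fg [df dfd]; have dg := near_eq_derivable fg df.
apply: DeriveDef => //; rewrite -dfd; apply/esym.
exact: near_eq_derive.
Qed.

End derivative_criterion.

(** * A flat function and its derivatives *)

Section bump.
Context {R : realType}.

Lemma expR_ge_monomial (y : R) n : 0 <= y -> y ^+ n / n`!%:R <= expR y.
Proof.
move=> y0; rewrite /expR.
apply: (@le_trans _ _ (series (exp_coeff y) n.+1)).
  rewrite seriesSr lerDr /series/=; apply: sumr_ge0 => i _.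
  exact: exp_coeff_ge0.
apply: nondecreasing_cvgn_le; last exact: is_cvg_series_exp_coeff.
by apply: nondecreasing_series => i _ _; exact: exp_coeff_ge0.
Qed.

(* The derivatives of x |-> exp (-1/x), extended by 0, are linear combinations of
these functions. *)
Definition flat (k : nat) (x : R) : R :=
  if 0 < x then x^-1 ^+ k * expR (- x^-1) else 0.

Lemma flat_ge0 k x : 0 <= flat k x.
Proof.
rewrite /flat; case: ifPn => // x0.
by rewrite mulr_ge0 ?expR_ge0// exprn_ge0// invr_ge0 ltW.
Qed.

(** One term of the exponential series at 1/x, that of degree k + 2, leaves a factor x^2: enough for
    a zero derivative at the origin by [is_derive_quadratic]. *)
Lemma flat_le k x : flat k x <= k.+2`!%:R * x ^+ 2.
Proof.
rewrite /flat; case: ifPn => [x0|_]; last by rewrite mulr_ge0 ?sqr_ge0.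
have y0 : 0 < x^-1 by rewrite invr_gt0.
have F0 : 0 < k.+2`!%:R :> R by rewrite ltr0n fact_gt0.
have := expR_ge_monomial k.+2 (ltW y0).
rewrite ler_pdivrMr// => h; have E0 := expR_gt0 x^-1.
have -> : x^-1 ^+ k = x^-1 ^+ k.+2 * x ^+ 2.
  by rewrite -addn2 exprD -mulrA -exprMn mulVf ?gt_eqF// expr1n mulr1.
rewrite expRN mulrAC ler_wpM2r ?sqr_ge0//.
by rewrite ler_pdivrMr// mulrC.
Qed.

Lemma is_derive_flat (k : nat) (x : R) :
  is_derive x 1 (flat k) (flat k.+2 x - k%:R * flat k.+1 x).
Proof.
have [x0|x0|<-] := ltgtP 0 x.
- have hx : x != 0 by rewrite gt_eqF.
  have hV : is_derive x 1 (fun y : R => y^-1) (- x^-1 ^+ 2).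
    apply: DeriveDef; first exact: derivableV.
    by rewrite deriveV// derive_id exprVn /GRing.scale/= mulr1.
  have hE : is_derive x 1 (fun y : R => expR (- y^-1)) (expR (- x^-1) * x^-1 ^+ 2).
    have h1 : is_derive (- x^-1) 1 expR (expR (- x^-1)) by exact: is_derive_expR.
    have h2 : is_derive x 1 (- (fun y : R => y^-1)) (- - x^-1 ^+ 2) by exact: is_deriveN.
    have := @is_derive1_comp R expR (- (fun y : R => y^-1)) x _ _ h1 h2.
    by rewrite opprK.
  have hP : is_derive x 1 ((fun y : R => y^-1) ^+ k)
      ((k%:R * (x^-1) ^+ k.-1) *: (- x^-1 ^+ 2)) by exact: is_deriveX.
  have := is_deriveM hP hE; rewrite /flat x0 => hM.
  have : is_derive x 1 (((fun y : R => y^-1) ^+ k) * (fun y : R => expR (- y^-1)))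
    (x^-1 ^+ k.+2 * expR (- x^-1) - k%:R * (x^-1 ^+ k.+1 * expR (- x^-1))).
    apply: is_derive_eq hM _; rewrite /GRing.scale/=.
    have -> : ((fun y : R => y^-1) ^+ k) x = x^-1 ^+ k.
      by elim: (k) => [//|m IH]; rewrite !exprS -IH.
    case: k {hP} => [|k] /=; first by rewrite !expr0 expr2; ring.
    by rewrite -natr1 !exprS expr0; ring.
  apply: is_derive_near_eq; near=> y.
  have y0 : 0 < y by near: y; apply: (cvgr_gt x) => //; exact: cvg_id.
  rewrite /flat y0; congr (_ * _).
  by elim: (k) => [//|m IH]; rewrite !exprS -IH.
- have xx : (0 < x) = false by rewrite ltNge ltW.
  have -> : flat k.+2 x - k%:R * flat k.+1 x = 0 by rewrite /flat xx mulr0 subr0.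
  apply: (@is_derive_near_eq _ _ (cst 0)).
  near=> y; have y0 : y < 0 by near: y; apply: (cvgr_lt x) => //; exact: cvg_id.
  by rewrite /flat ifF// ltNge ltW.
- have -> : flat k.+2 (0 : R) - k%:R * flat k.+1 0 = 0 by rewrite /flat ltxx mulr0 subr0.
  apply: (@is_derive_quadratic _ _ _ _ _ _ (k.+2`!%:R) 1) => // h _.
  rewrite /GRing.scale/= mulr1 addr0 mulr0 subr0 {2}/flat ltxx subr0.
  by rewrite ger0_norm ?flat_ge0// flat_le.
Unshelve. all: by end_near.
Qed.

End bump.

Section mean_value.
Context {R : realType}.

Lemma mean_value (f f' : R -> R) (a b : R) :
  (forall x : R, is_derive x (1 : R) f (f' x)) ->
  exists2 c, `|c - a| <= `|b - a| & f b - f a = f' c * (b - a).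
Proof.
move=> df.
have cf : continuous f.
  by move=> x; apply: differentiable_continuous; apply/derivable1_diffP; have [] := df x.
have [ab|/ltW ba] := leP a b.
  have [c ] := MVT_segment ab (fun x _ => df x) (continuous_subspaceT cf).
  rewrite in_itv/= => /andP[ac cb] e; exists c => //.
  by rewrite !ger0_norm ?subr_ge0// lerB.
have [c ] := MVT_segment ba (fun x _ => df x) (continuous_subspaceT cf).
rewrite in_itv/= => /andP[ac cb] e; exists c; last first.
  by rewrite -[LHS]opprB e -mulrN opprB.
by rewrite distrC [leRHS]distrC !ger0_norm ?subr_ge0// lerB.
Qed.

End mean_value.

Section test_functions.
Context {R : realType}.

(* A class of smooth functions with support in [-1, 1], closed under
differentiation. *)
Inductive test : (R -> R) -> Prop :=
| test_flat i j : test (fun x => flat i (1 + x) * flat j (1 - x))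
| test_add f g : test f -> test g -> test (fun x => f x + g x)
| test_scale c f : test f -> test (fun x => c * f x).

Let is_derive_shift (i : nat) (x : R) : is_derive x (1 : R) (fun y => flat i (1 + y))
  (flat i.+2 (1 + x) - i%:R * flat i.+1 (1 + x)).
Proof.
have h2 : is_derive x (1 : R) (fun y : R => 1 + y) 1.
  apply: is_derive_eq (is_deriveD (is_derive_cst _ _ _) (is_derive_id _ _)) _.
  by rewrite add0r.
have := @is_derive1_comp R (flat i) (fun y => 1 + y) x _ _ (is_derive_flat i (1 + x)) h2.
by rewrite mulr1.
Qed.

Let is_derive_shiftN (i : nat) (x : R) : is_derive x (1 : R) (fun y => flat i (1 - y))
  (- (flat i.+2 (1 - x) - i%:R * flat i.+1 (1 - x))).
Proof.
have h2 : is_derive x (1 : R) (fun y : R => 1 - y) (- 1).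
  apply: is_derive_eq (is_deriveB (is_derive_cst _ _ _) (is_derive_id _ _)) _.
  by rewrite add0r.
have := @is_derive1_comp R (flat i) (fun y => 1 - y) x _ _ (is_derive_flat i (1 - x)) h2.
by rewrite mulrN1.
Qed.

Lemma test_derive f : test f ->
  exists2 f', test f' & forall x : R, is_derive x (1 : R) f (f' x).
Proof.
elim => {f} [i j|f g _ [f' tf' df] _ [g' tg' dg]|c f _ [f' tf' df]].
- exists (fun x => ((flat i.+2 (1 + x) * flat j (1 - x) +
      (- i%:R) * (flat i.+1 (1 + x) * flat j (1 - x)))
    + ((- 1) * (flat i (1 + x) * flat j.+2 (1 - x))
    + j%:R * (flat i (1 + x) * flat j.+1 (1 - x))))).
    by apply: test_add; apply: test_add; do ?apply: test_scale; exact: test_flat.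
  move=> x; have := is_deriveM (is_derive_shift i x) (is_derive_shiftN j x).
  move=> h; apply: is_derive_eq h _; rewrite /GRing.scale /=; ring.
- exists (fun x => f' x + g' x); first exact: test_add.
  by move=> x; exact: is_deriveD.
- exists (fun x => c * f' x); first exact: test_scale.
  by move=> x; exact: is_deriveZ.
Qed.

Lemma test_supp f : test f -> forall x, 1 <= `|x| -> f x = 0.
Proof.
elim => {f} [i j|f g _ hf _ hg|c f _ hf] x hx; last 2 first.
- by rewrite hf// hg// addr0.
- by rewrite hf// mulr0.
move: hx; rewrite ler_normr /flat => /orP[hx|hx].
  by rewrite [X in _ * X]ifF ?mulr0//; apply/negbTE; rewrite -leNgt; lra.
by rewrite [X in X * _]ifF ?mul0r//; apply/negbTE; rewrite -leNgt; lra.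
Qed.

Lemma test_continuous f : test f -> continuous f.
Proof.
move=> /test_derive[f' _ df] x; apply: differentiable_continuous.
by apply/derivable1_diffP; have [] := df x.
Qed.

Lemma test_bounded f : test f -> exists2 K, 0 < K & forall x, `|f x| <= K.
Proof.
move=> tf; have cf : {within `[-1, 1], continuous (fun x => `|f x|)}.
  apply: continuous_subspaceT => x; apply: continuous_comp.
    exact: test_continuous.
  exact: norm_continuous.
have h11 : -1 <= 1 :> R by lra.
have [c _ hc] := EVT_max h11 cf.
exists (`|f c| + 1); first by rewrite ltr_wpDl.
move=> x; have [x1|x1] := leP 1 `|x|.
  by rewrite (test_supp tf x1) normr0 addr_ge0.
have : `|f x| <= `|f c| by apply: hc; rewrite in_itv/= -ler_norml ltW.
by lra.
Qed.

Lemma test_lipschitz f : test f ->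
  exists2 K, 0 < K & forall x y, `|f y - f x| <= K * `|y - x|.
Proof.
move=> /test_derive[f' tf' df]; have [K K0 hK] := test_bounded tf'.
exists K => // x y; have [c _ ->] := mean_value x y df.
by rewrite normrM ler_wpM2r.
Qed.

Lemma test_quadratic f f' : test f -> test f' -> (forall x : R, is_derive x (1 : R) f (f' x)) ->
  exists2 K, 0 < K & forall x y, `|f y - f x - (y - x) * f' x| <= K * (y - x) ^+ 2.
Proof.
move=> tf tf' df; have [K K0 hK] := test_lipschitz tf'; exists K => // x y.
have [c hc ->] := mean_value x y df.
have -> : f' c * (y - x) - (y - x) * f' x = (f' c - f' x) * (y - x) by ring.
rewrite normrM -real_normK ?num_real// expr2 mulrA ler_wpM2r//.
by apply: (le_trans (hK _ _)); rewrite ler_pM2l.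
Qed.

Lemma test_measurable f : test f -> measurable_fun setT f.
Proof. by move=> /test_continuous; exact: continuous_measurable_fun. Qed.

End test_functions.

(** * Convolution of a bounded measurable function with test functions *)

Section mollification.
Context {R : realType}.
Local Notation lambda := (@lebesgue_measure R).
Local Notation plane := (R * R)%type.
Local Notation mplane := (measurableTypeR R * measurableTypeR R)%type.

Definition area : {measure set mplane -> \bar R} :=
  (lambda \x lambda)%E.

Definition cbox (g : plane) (r : R) : set plane :=
  [set q | `|q.1 - g.1| <= r /\ `|q.2 - g.2| <= r].

Lemma cboxE g r : cbox g r =
  (fun q => (- g.1 + q.1, - g.2 + q.2)) @^-1` [set q : plane | `|q.1| <= r /\ `|q.2| <= r].
Proof. by apply/seteqP; split => q; rewrite /cbox /= ![- _ + _]addrC. Qed.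

Lemma measurable_cbox g r : measurable (cbox g r : set mplane).
Proof.
rewrite cboxE; apply: (measurable_preimage (T := (measurableTypeR R * measurableTypeR R)%type)
  (T' := (measurableTypeR R * measurableTypeR R)%type)); last exact: measurable_box.
by apply: measurable_fun_pair; apply: measurable_funD => //; exact: measurable_cst.
Qed.

Lemma lambda2_cbox g r : 0 <= r -> area (cbox g r) = ((2 * r) ^+ 2)%:E.
Proof.
move=> r0; rewrite -(lambda2_box r0) cboxE.
by apply: lebesgue_measure2_shift; exact: measurable_box.
Qed.

Lemma cbox_integrable (f : mplane -> R) g (M r : R) : 0 <= r ->
  measurable_fun setT f -> (forall q, `|f q| <= M) ->
  area.-integrable (cbox g r) (EFin \o f).
Proof.
move=> r0 mf fM; apply: measurable_bounded_integrable.
- exact: measurable_cbox.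
- suff : (area (cbox g r) < +oo)%E by [].
  by rewrite lambda2_cbox// ltry.
- exact: measurable_funTS.
- by exists M; split; [exact: num_real|move=> x Mx q _ /=; exact: le_trans (fM q) (ltW Mx)].
Qed.

Lemma cbox_Rintegral_le (f : mplane -> R) g (M r : R) : 0 <= r ->
  measurable_fun setT f -> (forall q, `|f q| <= M) ->
  `|\int[area]_(q in cbox g r) f q| <= M * (2 * r) ^+ 2.
Proof.
move=> r0 mf fM.
have mB := measurable_cbox g r.
have h := le_normr_Rintegral mB (cbox_integrable g r0 mf fM).
apply: (le_trans h).
apply: (@le_trans _ _ (\int[area]_(q in cbox g r) M)).
  apply: le_Rintegral => //.
  - apply: (@cbox_integrable _ _ M) => //; first exact: measurableT_comp.
    by move=> q; rewrite normr_id.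
  - apply: (@cbox_integrable _ _ `|M|) => //.
have e : M * fine (area (cbox g r)) = M * (2 * r) ^+ 2 by rewrite lambda2_cbox.
by rewrite Rintegral_cst// le_eqVlt; apply/orP; left; apply/eqP; exact: e.
Qed.

Variable v : mplane -> R.
Hypotheses (mv : measurable_fun setT v) (v1 : forall q, `|v q| <= 1).

(** The variable [g] enters only through the kernel, so derivatives fall on [f1] and [f2], with a
    sign -1 because [g] is subtracted; [v] itself may be discontinuous. *)
Definition moll (f1 f2 : R -> R) (g : plane) : R :=
  \int[area]_q (v q * (f1 (q.1 - g.1) * f2 (q.2 - g.2))).

(** All points [g'] within distance 1 of [g] share one domain of finite area, so that values at
    different points can be compared under a single integral. *)
Lemma moll_cbox f1 f2 g g' : test f1 -> test f2 ->
  `|g'.1 - g.1| <= 1 -> `|g'.2 - g.2| <= 1 ->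
  moll f1 f2 g' =
    \int[area]_(q in cbox g 2) (v q * (f1 (q.1 - g'.1) * f2 (q.2 - g'.2))).
Proof.
move=> t1 t2 h1 h2; rewrite Rintegral_mkcond /moll; congr (Rintegral _ _ _).
apply/funext => q; rewrite patchE; case: ifPn => //.
rewrite notin_setE /cbox /= => no.
have [a|a] := leP 1 `|q.1 - g'.1|; first by rewrite (test_supp t1 a) mul0r mulr0.
have [b|b] := leP 1 `|q.2 - g'.2|; first by rewrite (test_supp t2 b) !mulr0.
exfalso; apply: no; split.
  have -> : q.1 - g.1 = (q.1 - g'.1) + (g'.1 - g.1) by ring.
  by apply: (le_trans (ler_normD _ _)); lra.
have -> : q.2 - g.2 = (q.2 - g'.2) + (g'.2 - g.2) by ring.
by apply: (le_trans (ler_normD _ _)); lra.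
Qed.

Lemma measurable_moll_kernel f1 f2 (g : plane) : test f1 -> test f2 ->
  measurable_fun setT (fun q : mplane => v q * (f1 (q.1 - g.1) * f2 (q.2 - g.2))).
Proof.
move=> t1 t2; apply: measurable_funM => //; apply: measurable_funM.
  apply: (measurableT_comp (test_measurable t1)).
  by apply: measurable_funB; [exact: measurable_fst|exact: measurable_cst].
apply: (measurableT_comp (test_measurable t2)).
by apply: measurable_funB; [exact: measurable_snd|exact: measurable_cst].
Qed.

Let kernel_le f1 f2 K1 K2 (g q : plane) : 0 < K1 -> 0 < K2 ->
  (forall x, `|f1 x| <= K1) -> (forall x, `|f2 x| <= K2) ->
  `|v q * (f1 (q.1 - g.1) * f2 (q.2 - g.2))| <= K1 * K2.
Proof.
move=> K10 K20 h1 h2; rewrite !normrM -[leRHS]mul1r.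
apply: ler_pM; [exact: normr_ge0|exact: mulr_ge0|exact: v1|].
by apply: ler_pM; rewrite ?normr_ge0.
Qed.

Lemma moll_kernel_integrable f1 f2 (g g' : plane) : test f1 -> test f2 ->
  area.-integrable (cbox g 2)
    (EFin \o (fun q : mplane => v q * (f1 (q.1 - g'.1) * f2 (q.2 - g'.2)))).
Proof.
move=> t1 t2; have [K1 K10 hK1] := test_bounded t1; have [K2 K20 hK2] := test_bounded t2.
apply: (@cbox_integrable _ _ (K1 * K2)) => //; first exact: measurable_moll_kernel.
by move=> q; exact: kernel_le.
Qed.

Lemma moll_le f1 f2 : test f1 -> test f2 ->
  exists2 K, 0 < K & forall g, `|moll f1 f2 g| <= K.
Proof.
move=> t1 t2; have [K1 K10 hK1] := test_bounded t1; have [K2 K20 hK2] := test_bounded t2.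
exists (K1 * K2 * (2 * 2) ^+ 2); first by rewrite !mulr_gt0.
move=> g; rewrite (@moll_cbox _ _ g)// ?subrr ?normr0//.
apply: cbox_Rintegral_le => //; first exact: measurable_moll_kernel.
by move=> q; exact: kernel_le.
Qed.

(** The second order remainder of [f1] is integrated over the common box of radius 2; the factor
    [(2 * 2) ^+ 2] is its area. *)
Lemma moll_is_derive1 f1 f1' f2 (g : plane) : test f1 -> test f1' -> test f2 ->
  (forall x : R, is_derive x (1 : R) f1 (f1' x)) ->
  is_derive g ((1, 0) : plane) (moll f1 f2) (moll (fun x => -1 * f1' x) f2 g).
Proof.
move=> t1 t1' t2 df.
have tN : test (fun x => -1 * f1' x) by exact: test_scale.
have [C C0 hC] := test_quadratic t1 t1' df; have [K2 K20 hK2] := test_bounded t2.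
apply: (@is_derive_quadratic _ _ _ _ _ _ (C * K2 * (2 * 2) ^+ 2) 1) => // h h1.
have -> : h *: ((1, 0) : plane) + g = (g.1 + h, g.2).
  by case: g => a b; congr (_, _); rewrite /= /GRing.scale/=; ring.
rewrite (@moll_cbox _ _ g)//=; [|by rewrite addrAC subrr add0r|by rewrite subrr normr0].
rewrite (@moll_cbox f1 _ g g) ?subrr ?normr0//.
rewrite (@moll_cbox (fun x => -1 * f1' x) _ g g) ?subrr ?normr0//.
have mB := measurable_cbox g 2.
have i1 := moll_kernel_integrable g (g.1 + h, g.2) t1 t2.
have i2 := moll_kernel_integrable g g t1 t2.
have i3 := moll_kernel_integrable g g tN t2.
have i12 := integrableB mB i1 i2.
have i4 := integrableZl mB h i3.
rewrite -RintegralZl// -RintegralB// -RintegralB//.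
have -> : C * K2 * (2 * 2) ^+ 2 * h ^+ 2 = C * h ^+ 2 * K2 * (2 * 2) ^+ 2 by ring.
apply: cbox_Rintegral_le => //.
  apply: measurable_funB; first apply: measurable_funB.
  - exact: (measurable_moll_kernel (g.1 + h, g.2) t1 t2).
  - exact: measurable_moll_kernel.
  - exact: (measurable_funM (measurable_cst h) (measurable_moll_kernel g tN t2)).
move=> q /=.
set y := q.1 - g.1.
have -> : q.1 - (g.1 + h) = y - h by rewrite /y; ring.
have -> : v q * (f1 (y - h) * f2 (q.2 - g.2)) - v q * (f1 y * f2 (q.2 - g.2)) -
   h * (v q * (-1 * f1' y * f2 (q.2 - g.2))) =
   v q * ((f1 (y - h) - f1 y - ((y - h) - y) * f1' y) * f2 (q.2 - g.2)) by ring.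
rewrite !normrM -[leRHS]mul1r; apply: ler_pM; [exact: normr_ge0|exact: mulr_ge0|exact: v1|].
apply: ler_pM; rewrite ?normr_ge0//; apply: (le_trans (hC _ _)).
by rewrite (_ : y - h - y = - h) ?sqrrN//; ring.
Qed.

Lemma moll_is_derive2 f1 f2 f2' (g : plane) : test f1 -> test f2 -> test f2' ->
  (forall x : R, is_derive x (1 : R) f2 (f2' x)) ->
  is_derive g ((0, 1) : plane) (moll f1 f2) (moll f1 (fun x => -1 * f2' x) g).
Proof.
move=> t1 t2 t2' df.
have tN : test (fun x => -1 * f2' x) by exact: test_scale.
have [C C0 hC] := test_quadratic t2 t2' df; have [K1 K10 hK1] := test_bounded t1.
apply: (@is_derive_quadratic _ _ _ _ _ _ (K1 * C * (2 * 2) ^+ 2) 1) => // h h1.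
have -> : h *: ((0, 1) : plane) + g = (g.1, g.2 + h).
  by case: g => a b; congr (_, _); rewrite /= /GRing.scale/=; ring.
rewrite (@moll_cbox _ _ g)//=; [|by rewrite subrr normr0|by rewrite addrAC subrr add0r].
rewrite (@moll_cbox f1 f2 g g) ?subrr ?normr0//.
rewrite (@moll_cbox f1 (fun x => -1 * f2' x) g g) ?subrr ?normr0//.
have mB := measurable_cbox g 2.
have i1 := moll_kernel_integrable g (g.1, g.2 + h) t1 t2.
have i2 := moll_kernel_integrable g g t1 t2.
have i3 := moll_kernel_integrable g g t1 tN.
have i12 := integrableB mB i1 i2.
have i4 := integrableZl mB h i3.
rewrite -RintegralZl// -RintegralB// -RintegralB//.
have -> : K1 * C * (2 * 2) ^+ 2 * h ^+ 2 = K1 * (C * h ^+ 2) * (2 * 2) ^+ 2 by ring.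
apply: cbox_Rintegral_le => //.
  apply: measurable_funB; first apply: measurable_funB.
  - exact: (measurable_moll_kernel (g.1, g.2 + h) t1 t2).
  - exact: measurable_moll_kernel.
  - exact: (measurable_funM (measurable_cst h) (measurable_moll_kernel g t1 tN)).
move=> q /=.
set y := q.2 - g.2.
have -> : q.2 - (g.2 + h) = y - h by rewrite /y; ring.
have -> : v q * (f1 (q.1 - g.1) * f2 (y - h)) - v q * (f1 (q.1 - g.1) * f2 y) -
   h * (v q * (f1 (q.1 - g.1) * (-1 * f2' y))) =
   v q * (f1 (q.1 - g.1) * (f2 (y - h) - f2 y - ((y - h) - y) * f2' y)) by ring.
rewrite !normrM -[leRHS]mul1r; apply: ler_pM; [exact: normr_ge0|exact: mulr_ge0|exact: v1|].
apply: ler_pM; rewrite ?normr_ge0//; apply: (le_trans (hC _ _)).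
by rewrite (_ : y - h - y = - h) ?sqrrN//; ring.
Qed.

Lemma moll_continuous f1 f2 : test f1 -> test f2 -> continuous (moll f1 f2).
Proof.
move=> t1 t2 g.
have [K1 K10 hK1] := test_bounded t1; have [K2 K20 hK2] := test_bounded t2.
have [L1 L10 hL1] := test_lipschitz t1; have [L2 L20 hL2] := test_lipschitz t2.
pose C := (L1 * K2 + K1 * L2) * (2 * 2) ^+ 2.
have C0 : 0 < C by rewrite !mulr_gt0// addr_gt0// mulr_gt0.
apply/cvgrPdist_lt => e e0.
have d0 : 0 < Num.min 1 (e / C) by rewrite lt_min ltr01 divr_gt0.
have : nbhs g (ball g (Num.min 1 (e / C))) by exact: nbhsx_ballx.
apply: filterS => g' [] /=; rewrite /ball/=.
rewrite !lt_min => /andP[a1 a2] /andP[b1 b2].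
rewrite distrC in a1; rewrite distrC in a2; rewrite distrC in b1; rewrite distrC in b2.
rewrite distrC (@moll_cbox f1 f2 g g') ?ltW//.
rewrite (@moll_cbox f1 f2 g g) ?subrr ?normr0//.
have mB := measurable_cbox g 2.
rewrite -RintegralB//; last 2 first.
  exact: moll_kernel_integrable.
  exact: moll_kernel_integrable.
pose m := Num.max `|g'.1 - g.1| `|g'.2 - g.2|.
apply: (@le_lt_trans _ _ ((L1 * K2 + K1 * L2) * m * (2 * 2) ^+ 2)); last first.
  rewrite mulrAC -/C; have : m < e / C by rewrite gt_max a2 b2.
  by rewrite ltr_pdivlMr// mulrC.
apply: cbox_Rintegral_le => //.
  by apply: measurable_funB; exact: measurable_moll_kernel.
move=> q /=; rewrite -mulrBr normrM -[leRHS]mul1r; apply: ler_pM; [exact: normr_ge0|exact: normr_ge0|exact: v1|].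
set y1 := q.1 - g.1; set y2 := q.2 - g.2; set z1 := q.1 - g'.1; set z2 := q.2 - g'.2.
have -> : f1 z1 * f2 z2 - f1 y1 * f2 y2 = (f1 z1 - f1 y1) * f2 z2 + f1 y1 * (f2 z2 - f2 y2).
  by ring.
apply: (le_trans (ler_normD _ _)); rewrite !normrM mulrDl.
have e1 : `|z1 - y1| <= m.
  by rewrite /z1 /y1 /m le_max (_ : _ - _ = - (g'.1 - g.1)) ?normrN ?lexx//; ring.
have e2 : `|z2 - y2| <= m.
  by rewrite /z2 /y2 /m le_max (_ : _ - _ = - (g'.2 - g.2)) ?normrN ?lexx ?orbT//; ring.
apply: lerD.
  rewrite mulrAC; apply: ler_pM => //; apply: (le_trans (hL1 _ _)).
  by rewrite ler_pM2l.
rewrite -mulrA; apply: ler_pM => //; apply: (le_trans (hL2 _ _)).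
by rewrite ler_pM2l.
Qed.

Lemma moll_Ck k f1 f2 : test f1 -> test f2 -> Ck k (moll f1 f2).
Proof.
elim: k f1 f2 => [|k IH] f1 f2 t1 t2 /=; first by split => //; exact: moll_continuous.
split; first exact: moll_continuous.
have [f1' t1' d1] := test_derive t1; have [f2' t2' d2] := test_derive t2.
have h1 g := moll_is_derive1 g t1 t1' t2 d1.
have h2 g := moll_is_derive2 g t1 t2 t2' d2.
split.
  by move=> g; case: (h1 g) => d1g _; case: (h2 g) => d2g _; split; [exact: d1g|exact: d2g].
split.
  rewrite (_ : 'D_(1, 0) (moll f1 f2) = moll (fun x => -1 * f1' x) f2).
    by apply: IH; [exact: test_scale|exact: t2].
  by apply/funext => g; case: (h1 g).
rewrite (_ : 'D_(0, 1) (moll f1 f2) = moll f1 (fun x => -1 * f2' x)).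
  by apply: IH; [exact: t1|exact: test_scale].
by apply/funext => g; case: (h2 g).
Qed.

End mollification.

(** * The normalised mollifier *)

Section normalization.
Context {R : realType}.
Local Notation plane := (R * R)%type.
Local Notation mplane := (measurableTypeR R * measurableTypeR R)%type.

Lemma area_shift (s : plane) (F : mplane -> R) : measurable_fun setT F ->
  (forall q, 0 <= F q) ->
  \int[area]_q F (s.1 + q.1, s.2 + q.2) = \int[area]_q F q.
Proof.
move=> mF F0; rewrite /Rintegral; congr fine.
pose phi (q : mplane) : mplane := (s.1 + q.1, s.2 + q.2).
have mphi : measurable_fun setT phi.
  by apply: measurable_fun_pair; apply: measurable_funD => //; exact: measurable_cst.
have := @ge0_integral_pushforward _ _ mplane mplane R phi mphi area setT
  (fun q => (F q)%:E) measurableT.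
rewrite preimage_setT => <-.
- apply: eq_measure_integral => A mA _.
  exact: lebesgue_measure2_shift.
- exact/measurable_EFinP.
- by move=> q _; rewrite lee_fin.
Qed.

Lemma moll_shift (v : mplane -> R) (f1 f2 : R -> R) (s g : plane) :
  measurable_fun setT v -> (forall q, 0 <= v q) -> test f1 -> test f2 ->
  (forall x, 0 <= f1 x) -> (forall x, 0 <= f2 x) ->
  moll (fun q => v (s.1 + q.1, s.2 + q.2)) f1 f2 g = moll v f1 f2 (s.1 + g.1, s.2 + g.2).
Proof.
move=> mv v0 t1 t2 p1 p2; rewrite /moll -[RHS](area_shift s).
- apply: eq_Rintegral => q _ /=; congr (_ * (f1 _ * f2 _)); ring.
- exact: measurable_moll_kernel.
- by move=> q; rewrite !mulr_ge0.
Qed.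

Lemma moll_scale (v : mplane -> R) (c : R) (f1 f2 : R -> R) (g : plane) :
  measurable_fun setT v -> (forall q, `|v q| <= 1) -> test f1 -> test f2 ->
  moll v (fun x => c * f1 x) f2 g = c * moll v f1 f2 g.
Proof.
move=> mv v1 t1 t2.
have tc : test (fun x => c * f1 x) by exact: test_scale.
rewrite (@moll_cbox _ v (fun x => c * f1 x) _ g g) ?subrr ?normr0//.
rewrite (@moll_cbox _ v f1 _ g g) ?subrr ?normr0//.
rewrite -RintegralZl; [|exact: measurable_cbox|exact: moll_kernel_integrable].
by apply: eq_Rintegral => q _; ring.
Qed.

Lemma moll_mono (v w : mplane -> R) (f1 f2 : R -> R) (g : plane) :
  measurable_fun setT v -> (forall q, `|v q| <= 1) ->
  measurable_fun setT w -> (forall q, `|w q| <= 1) ->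
  test f1 -> test f2 -> (forall x, 0 <= f1 x) -> (forall x, 0 <= f2 x) ->
  (forall q, v q <= w q) -> moll v f1 f2 g <= moll w f1 f2 g.
Proof.
move=> mv v1 mw w1 t1 t2 p1 p2 vw.
rewrite (@moll_cbox _ v f1 f2 g g) ?subrr ?normr0//.
rewrite (@moll_cbox _ w f1 f2 g g) ?subrr ?normr0//.
apply: le_Rintegral; [exact: measurable_cbox|exact: moll_kernel_integrable|
  exact: moll_kernel_integrable|].
by move=> q _; rewrite ler_wpM2r// mulr_ge0.
Qed.

Lemma moll_local (v w : mplane -> R) (f1 f2 : R -> R) (g : plane) :
  test f1 -> test f2 -> (forall q, cbox g 1 q -> v q = w q) ->
  moll v f1 f2 g = moll w f1 f2 g.
Proof.
move=> t1 t2 vw; apply: eq_Rintegral => q _.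
have [a|a] := leP 1 `|q.1 - g.1|; first by rewrite (test_supp t1 a) mul0r !mulr0.
have [b|b] := leP 1 `|q.2 - g.2|; first by rewrite (test_supp t2 b) !mulr0.
by rewrite vw//; split; exact: ltW.
Qed.

Definition bump (x : R) : R := flat 0 (1 + x) * flat 0 (1 - x).

Lemma test_bump : test bump. Proof. exact: test_flat. Qed.

Lemma bump_ge0 x : 0 <= bump x.
Proof. by rewrite mulr_ge0// flat_ge0. Qed.

Lemma bump_ge x : `|x| <= 2^-1 -> expR (- 4) <= bump x.
Proof.
have flat_ge (y : R) : 2^-1 <= y -> expR (- 2) <= flat 0 y.
  move=> hy; have y0 : 0 < y by apply: lt_le_trans hy; rewrite invr_gt0.
  rewrite /flat y0 expr0 mul1r ler_expR lerN2.
  by rewrite -[leRHS]invrK lef_pV2 ?posrE ?invr_gt0.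
rewrite ler_norml => /andP[h1 h2].
have -> : expR (- 4) = expR (- 2) * expR (- 2) :> R by rewrite -expRD; congr expR; lra.
by apply: ler_pM; rewrite ?expR_ge0//; apply: flat_ge; lra.
Qed.

Definition bump_mass : R := moll (fun=> 1) bump bump (0, 0).

Let one_le1 (q : mplane) : `|(fun=> 1 : R) q| <= 1.
Proof. by rewrite normr1. Qed.

Lemma bump_mass_gt0 : 0 < bump_mass.
Proof.
(* [e] bounds the kernel from below on the box of radius 1/2, whose area is 1. *)
pose e := expR (- 4) * expR (- 4) : R.
have e0 : 0 < e by rewrite mulr_gt0// expR_gt0.
apply: (@lt_le_trans _ _ (\int[area]_(q in cbox (0, 0) 2) (e * \1_(cbox (0, 0) 2^-1) q))).
  have i1 : area.-integrable (cbox (0, 0) 2) (EFin \o \1_(cbox (0, 0) (2^-1 : R))).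
    apply: (@cbox_integrable _ _ _ 1) => //.
      by apply: measurable_indic; exact: measurable_cbox.
    by move=> q; rewrite indicE; case: (_ \in _); rewrite ?normr1 ?normr0.
  rewrite RintegralZl; [|exact: measurable_cbox|exact: i1].
  rewrite mulr_gt0// /Rintegral integral_indic; [|exact: measurable_cbox|exact: measurable_cbox].
  rewrite setIidl; last first.
    by move=> q [a b]; split; [apply: (le_trans a)|apply: (le_trans b)]; lra.
  by rewrite lambda2_cbox//= mulrV ?unitfE// expr1n ltr01.
rewrite /bump_mass (@moll_cbox _ (fun=> 1) bump bump (0, 0) (0, 0)) ?subrr ?normr0//; try exact: test_bump.
apply: le_Rintegral; first exact: measurable_cbox.
- apply: (@cbox_integrable _ _ _ e) => //.
    apply: measurable_funM; first exact: measurable_cst.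
    by apply: measurable_indic; exact: measurable_cbox.
  move=> q; rewrite normrM (gtr0_norm e0) ler_piMr ?(ltW e0)//.
  by rewrite indicE; case: (_ \in _); rewrite ?normr1 ?normr0.
- exact: (moll_kernel_integrable (measurable_cst (1 : R)) one_le1 _ _ test_bump test_bump).
move=> q _; rewrite mul1r indicE; case: (boolP (q \in _)) => [|_]; last first.
  by rewrite mulr0 mulr_ge0// bump_ge0.
rewrite inE => -[a b]; rewrite mulr1.
by apply: ler_pM; rewrite ?expR_ge0//; exact: bump_ge.
Qed.

(** The kernel is the product of [nbump] and [bump]: the normalising constant is put on one factor
    only. *)
Definition nbump (x : R) : R := bump_mass^-1 * bump x.

Lemma test_nbump : test nbump.
Proof. by apply: test_scale; exact: test_bump. Qed.

Lemma nbump_ge0 x : 0 <= nbump x.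
Proof. by rewrite mulr_ge0 ?bump_ge0// invr_ge0 ltW// bump_mass_gt0. Qed.

Definition smoothing (v : mplane -> R) : plane -> R := moll v nbump bump.

Lemma smoothing1 g : smoothing (fun=> 1) g = 1.
Proof.
transitivity (bump_mass^-1 * moll (fun=> 1) bump bump g).
  exact: (moll_scale _ _ (measurable_cst (1 : R)) one_le1 test_bump test_bump).
have := @moll_shift (fun=> 1) bump bump g (0, 0) (measurable_cst _) (fun=> ler01)
  test_bump test_bump bump_ge0 bump_ge0.
rewrite /= !addr0 -surjective_pairing => <-.
by rewrite mulVf// gt_eqF// bump_mass_gt0.
Qed.

Lemma smoothing0 g : smoothing (fun=> 0) g = 0.
Proof.
rewrite /smoothing /moll; under eq_Rintegral do rewrite mul0r.
by rewrite /Rintegral integral0.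
Qed.

Lemma smoothing_itv (v : mplane -> R) g : measurable_fun setT v ->
  (forall q, 0 <= v q <= 1) -> 0 <= smoothing v g <= 1.
Proof.
move=> mv v01.
have v1 q : `|v q| <= 1 by case/andP: (v01 q) => ? ?; rewrite ger0_norm.
rewrite -{1}(smoothing0 g) -{1}(smoothing1 g).
apply/andP; split; apply: moll_mono => //; try exact: test_nbump; try exact: test_bump;
  try exact: nbump_ge0; try exact: bump_ge0; try exact: measurable_cst.
- by move=> q; rewrite normr0.
- by move=> q; case/andP: (v01 q).
- by move=> q; case/andP: (v01 q).
Qed.

Lemma smoothing_eq1 (v : mplane -> R) g : (forall q, cbox g 1 q -> v q = 1) ->
  smoothing v g = 1.
Proof.
move=> h; rewrite -(smoothing1 g).
by apply: moll_local; [exact: test_nbump|exact: test_bump|exact: h].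
Qed.

Lemma smoothing_eq0 (v : mplane -> R) g : (forall q, cbox g 1 q -> v q = 0) ->
  smoothing v g = 0.
Proof.
move=> h; rewrite -(smoothing0 g).
by apply: moll_local; [exact: test_nbump|exact: test_bump|exact: h].
Qed.

Lemma smoothing_shift (v : mplane -> R) (s g : plane) :
  measurable_fun setT v -> (forall q, 0 <= v q) ->
  smoothing (fun q => v (s.1 + q.1, s.2 + q.2)) g = smoothing v (s.1 + g.1, s.2 + g.2).
Proof.
move=> mv v0; apply: moll_shift => //; [exact: test_nbump|exact: test_bump|
  exact: nbump_ge0|exact: bump_ge0].
Qed.

Lemma smoothing_Ck (v : mplane -> R) k : measurable_fun setT v ->
  (forall q, `|v q| <= 1) -> Ck k (smoothing v).
Proof. by move=> mv v1; apply: moll_Ck => //; [exact: test_nbump|exact: test_bump]. Qed.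

Lemma smoothing_lipschitz (v : mplane -> R) : measurable_fun setT v ->
  (forall q, `|v q| <= 1) ->
  exists2 L, 0 < L & forall t x y, `|smoothing v (t, y) - smoothing v (t, x)| <= L * `|y - x|.
Proof.
move=> mv v1; have [f2' t2' d2] := test_derive test_bump.
have tN : test (fun x => -1 * f2' x) by exact: test_scale.
have [L L0 hL] := moll_le mv v1 test_nbump tN.
exists L => // t x y.
have dx (z : R) : is_derive z (1 : R) (fun y => smoothing v (t, y))
    (moll v nbump (fun x => -1 * f2' x) (t, z)).
  have [dz ez] := moll_is_derive2 mv v1 (t, z) test_nbump test_bump t2' d2.
  (* The derivative of the restriction to a vertical line is the partial derivative in direction (0,
     1), since the difference quotients coincide. *)
  have E : (fun h : R => h^-1 *: (((fun y => smoothing v (t, y)) \o shift z) (h *: (1 : R)) -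
      smoothing v (t, z))) = (fun h : R => h^-1 *: ((smoothing v \o shift (t, z)) (h *: ((0, 1) : plane))
      - smoothing v (t, z))).
    have hp (h : R) : h *: ((0, 1) : plane) + (t, z) = (t, h *: (1 : R) + z).
      by congr (_, _); rewrite /= /GRing.scale/=; ring.
    by apply/funext => h; rewrite /= hp.
  apply: DeriveDef; first by rewrite /derivable E.
  by rewrite -ez; exact: (congr1 (fun F : R -> R => lim (F h @[h --> 0^'])) E).
have [c _ ->] := mean_value x y dx.
by rewrite normrM ler_wpM2r.
Qed.

End normalization.

(** * Global solutions of Lipschitz equations *)

Section picard.
Context {R : realType}.

Lemma antiderivative (a c : R) (g : R -> R) : continuous g ->
  exists2 G : R -> R, G a = c & forall t, a <= t -> is_derive t (1 : R) G (g t).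
Proof.
(* Integration starts at [a - 1], so that [a] is interior and the derivative there is two-sided. *)
move=> cg; pose F y := \int[lebesgue_measure]_(t in [set` `[a - 1, y]]) (g t).
have dF t : a <= t -> is_derive t (1 : R) F (g t).
  move=> at_; have tt : t < t + 1 by rewrite ltrDl.
  have at1 : a - 1 < t by lra.
  have ig : lebesgue_measure.-integrable `[a - 1, t + 1] (EFin \o g).
    apply: continuous_compact_integrable; first exact: segment_compact.
    exact: continuous_subspaceT.
  have [d e] := continuous_FTC1_closed tt ig at1 (cg t).
  by apply: DeriveDef; [exact: d|rewrite -derive1E].
exists (fun t => F t + (c - F a)); first by ring.
move=> t at_; have := is_deriveD (dF t at_) (is_derive_cst (c - F a) t (1 : R)).
by rewrite addr0.
Qed.

Lemma is_derive_continuous (f : R -> R) (x d : R) :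
  is_derive x (1 : R) f d -> {for x, continuous f}.
Proof.
by move=> [df _]; apply: differentiable_continuous; apply/derivable1_diffP.
Qed.

Lemma ge_mean_value (f f' : R -> R) (a b : R) : a <= b ->
  (forall x, a <= x -> is_derive x (1 : R) f (f' x)) ->
  exists2 c, a <= c <= b & f b - f a = f' c * (b - a).
Proof.
move=> ab df.
have [||c] := @MVT_segment R f f' a b ab.
- by move=> x; rewrite in_itv/= => /andP[ax _]; apply: df; exact: ltW.
- apply: continuous_in_subspaceT => x; rewrite inE/= in_itv/= => /andP[ax _].
  exact: is_derive_continuous (df x ax).
by rewrite in_itv/= => h e; exists c.
Qed.

(** Both [g + f] and [g - f] have nonnegative derivative and nonnegative initial value. *)
Lemma derive_dominated (f f' g g' : R -> R) (a b : R) : a <= b ->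
  (forall x, a <= x -> is_derive x (1 : R) f (f' x)) ->
  (forall x, a <= x -> is_derive x (1 : R) g (g' x)) ->
  (forall x, a <= x -> `|f' x| <= g' x) ->
  f a = 0 -> 0 <= g a -> `|f b| <= g b.
Proof.
move=> ab df dg fg fa ga; rewrite ler_norml; apply/andP; split.
  have [c /andP[ac _]] := @ge_mean_value (fun x => f x + g x) (fun x => f' x + g' x) _ _ ab
    (fun x ax => is_deriveD (df x ax) (dg x ax)).
  rewrite fa add0r => e; have := fg c ac; rewrite ler_norml => /andP[h _].
  have : 0 <= (f' c + g' c) * (b - a) by rewrite mulr_ge0 ?subr_ge0//; lra.
  by rewrite -e; lra.
have [c /andP[ac _]] := @ge_mean_value (fun x => g x - f x) (fun x => g' x - f' x) _ _ ab
  (fun x ax => is_deriveB (dg x ax) (df x ax)).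
rewrite fa => e; have := fg c ac; rewrite ler_norml => /andP[_ h].
have : 0 <= (g' c - f' c) * (b - a) by rewrite mulr_ge0 ?subr_ge0//; lra.
by rewrite -e; lra.
Qed.

Lemma lipschitz_continuous (f : R -> R) (K : R) : 0 <= K ->
  (forall x y, `|f y - f x| <= K * `|y - x|) -> continuous f.
Proof.
move=> K0 hf x; apply/cvgrPdist_le => e e0.
have d0 : 0 < e / (K + 1) by rewrite divr_gt0// ltr_wpDl.
have : nbhs x (ball x (e / (K + 1))) by exact: nbhsx_ballx.
apply: filterS => y; rewrite /ball/= => /ltW; rewrite ler_pdivlMr ?ltr_wpDl// mulrC => h.
rewrite distrC (le_trans (hf _ _))// distrC; apply: le_trans h.
by rewrite ler_wpM2r// lerDl.
Qed.

Section existence.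
Variables (u : R * R -> R) (t0 x0 K L : R).
Hypotheses (K0 : 0 < K) (L0 : 0 < L) (cu : continuous u).
Hypothesis uK : forall p, `|u p| <= K.
Hypothesis uL : forall t x y, `|u (t, y) - u (t, x)| <= L * `|y - x|.

(** Freezing the function to the left of [t0] makes it continuous on the whole line, as
    [antiderivative] demands. *)
Let clip (W : R -> R) (s : R) : R := W (Num.max s t0).

(** [W] is the Picard iterate of [Z], in differential rather than integral form; a fixed point is a
    solution. *)
Definition picard_step (Z W : R -> R) :=
  W t0 = x0 /\ forall t, t0 <= t -> is_derive t (1 : R) W (u (t, Z t)).

Let clip_lip (W : R -> R) (C : R) :
  (forall s t, t0 <= s -> t0 <= t -> `|W t - W s| <= C * `|t - s|) -> 0 <= C ->
  forall s t, `|clip W t - clip W s| <= C * `|t - s|.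
Proof.
move=> hW C0 s t; have hm r : t0 <= Num.max r t0 by rewrite le_max lexx orbT.
apply: (le_trans (hW _ _ (hm s) (hm t))); rewrite ler_wpM2l//.
rewrite /Num.max; case: ifPn => h1; case: ifPn => h2 //.
- by rewrite subrr normr0.
- rewrite -leNgt in h2; rewrite ler0_norm ?ler0_norm; lra.
- rewrite -leNgt in h1; rewrite ger0_norm ?ger0_norm; lra.
Qed.

Let step_lip Z W : picard_step Z W ->
  forall s t, t0 <= s -> t0 <= t -> `|W t - W s| <= K * `|t - s|.
Proof.
move=> [_ dW]; suff h s t : t0 <= s -> s <= t -> `|W t - W s| <= K * `|t - s|.
  move=> s t hs ht; have [st|/ltW ts] := leP s t; first exact: h.
  by rewrite distrC [X in K * X]distrC; exact: h.
move=> hs st; have [|c _ ->] := ge_mean_value st (f' := fun t => u (t, Z t)) (f := W).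
  by move=> x sx; apply: dW; exact: le_trans sx.
by rewrite normrM ler_wpM2r.
Qed.

Let step_ex Z : continuous (clip Z) -> exists W, picard_step Z W.
Proof.
move=> cZ.
have cg : continuous (fun s => u (s, clip Z s)).
  move=> s; apply: (@continuous_comp _ _ _ (fun s => (s, clip Z s)) u); last exact: cu.
  exact: (cvg_pair (@cvg_id _ (nbhs s)) (cZ s)).
have [W W0 dW] := antiderivative t0 x0 cg.
exists W; split => // t tt; have := dW t tt.
by rewrite /clip max_l.
Qed.

Let M := K / L.

(* The n-th Picard increment is bounded by a multiple of 2^-n exp (2 L (t - t0)). *)
Let weight (n : nat) (t : R) : R := M * 2^-1 ^+ n * expR (2 * L * (t - t0)).

Let weight_derive n t : is_derive t (1 : R) (weight n) (2 * L * weight n t).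
Proof.
have h2 : is_derive t (1 : R) (fun y : R => 2 * L * (y - t0)) (2 * L).
  have h := is_deriveZ (2 * L) (is_deriveB (is_derive_id t (1 : R)) (is_derive_cst t0 t (1 : R))).
  by apply: is_derive_eq h _; rewrite /GRing.scale/= subr0 mulr1.
have h3 := @is_derive1_comp R expR (fun y => 2 * L * (y - t0)) t _ _
  (is_derive_expR _) h2.
have h4 := is_deriveZ (M * 2^-1 ^+ n) h3.
by apply: is_derive_eq h4 _; rewrite /weight /GRing.scale/=; ring.
Qed.

Let weight_ge0 n t : 0 <= weight n t.
Proof.
rewrite /weight mulr_ge0 ?expR_ge0// mulr_ge0 ?exprn_ge0 ?invr_ge0//.
by rewrite divr_ge0 ?ltW.
Qed.

Let weightS n t : weight n.+1 t = weight n t / 2.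
Proof. by rewrite /weight exprS; field. Qed.

(** The weight grows at rate 2 L while the right-hand side has Lipschitz constant L: this gives a
    contraction by 1/2 on the whole half-line at once, hence a global solution without
    continuation. *)
Let contract Z Z' W W' n : picard_step Z W -> picard_step Z' W' ->
  (forall t, t0 <= t -> `|Z' t - Z t| <= weight n t) ->
  forall t, t0 <= t -> `|W' t - W t| <= weight n.+1 t.
Proof.
move=> [W0 dW] [W0' dW'] ZZ t tt.
apply: (@derive_dominated (fun s => W' s - W s)
  (fun s => u (s, Z' s) - u (s, Z s)) (weight n.+1) (fun s => 2 * L * weight n.+1 s) _ _ tt).
- by move=> x tx; apply: is_deriveB; [exact: dW'|exact: dW].
- by move=> x _; exact: weight_derive.
- move=> x tx; apply: (le_trans (uL _ _ _)); rewrite weightS.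
  have -> : 2 * L * (weight n x / 2) = L * weight n x by field.
  by rewrite ler_pM2l//; exact: ZZ.
- by rewrite W0 W0' subrr.
- exact: weight_ge0.
Qed.

Let lip_clip_cont Z W : picard_step Z W -> continuous (clip W).
Proof.
move=> h; apply: (@lipschitz_continuous _ K) (ltW K0) _.
by apply: clip_lip; [exact: step_lip h|exact: ltW].
Qed.

Lemma picard_iterates : exists Y : nat -> R -> R,
  Y 0%N = (fun=> x0) /\ forall n, picard_step (Y n) (Y n.+1).
Proof.
(* The successor is made total by returning [Z] itself when its clipped version is not continuous,
   which never happens along the iteration. *)
have /choice[nxt hnxt] : forall Z, exists W, continuous (clip Z) -> picard_step Z W.
  move=> Z.
  have [cZ|no] := pselect (continuous (clip Z)).
    by have [W hW] := step_ex cZ; exists W.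
  by exists Z => /no.
exists (fun n => iter n nxt (fun=> x0)); split => // n; apply: (hnxt _).
elim: n => [|n IH]; first by move=> s; exact: cvg_cst.
exact: lip_clip_cont (hnxt _ IH).
Qed.

(** The iterates converge to a Lipschitz function [Z]. Instead of differentiating the limit, one
    more step [X] is taken from [Z] and shown to coincide with it. *)
Lemma picard_solution : exists x, picard_step x x.
Proof.
have [Y [Y0 hY]] := picard_iterates.
have d0 t : t0 <= t -> `|Y 1%N t - Y 0%N t| <= weight 0 t.
  move=> tt; have := step_lip (hY 0%N) (lexx t0) tt.
  have [-> _] := hY 0%N; rewrite Y0 => h; apply: (le_trans h).
  rewrite /weight expr0 mulr1 ger0_norm ?subr_ge0//.
  have e1 : 2 * L * (t - t0) <= expR (2 * L * (t - t0)).
    by apply: le_trans (expR_ge1Dx _); lra.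
  have M0 : 0 <= M by rewrite divr_ge0 ?ltW.
  have e2 : M * (2 * L * (t - t0)) <= M * expR (2 * L * (t - t0)) by rewrite ler_wpM2l.
  apply: le_trans e2; have -> : M * (2 * L * (t - t0)) = 2 * (K * (t - t0)).
    by rewrite /M; field; rewrite gt_eqF.
  have hh : 0 <= K * (t - t0) by apply: mulr_ge0; [exact: ltW|rewrite subr_ge0].
  by lra.
have dn n t : t0 <= t -> `|Y n.+1 t - Y n t| <= weight n t.
  elim: n t => [|n IH] t tt; first exact: d0.
  exact: (contract (hY n) (hY n.+1) IH).
(* The increments are bounded by a geometric sequence of ratio 1/2, whose partial sums telescope. *)
have dnm n m t : t0 <= t -> `|Y (n + m)%N t - Y n t| <= 2 * weight n t - 2 * weight (n + m)%N t.
  move=> tt; elim: m => [|m IH]; first by rewrite addn0 !subrr normr0.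
  rewrite addnS -(subrK (Y (n + m)%N t) (Y _ t)) -addrA.
  apply: (le_trans (ler_normD _ _)); apply: (le_trans (lerD (dn _ _ tt) IH)).
  by rewrite weightS; lra.
have dnm' n m t : t0 <= t -> (n <= m)%N -> `|Y m t - Y n t| <= 2 * weight n t.
  move=> tt nm; rewrite -(subnKC nm); apply: (le_trans (dnm _ _ _ tt)).
  by have := weight_ge0 (n + (m - n)) t; lra.
have w0 t : (fun n => 2 * weight n t) @ \oo --> (0 : R).
  rewrite (_ : (fun n => _) = (fun n => (2 * M * expR (2 * L * (t - t0))) * (2^-1 : R) ^+ n)).
    rewrite -[X in _ --> X](mulr0 (2 * M * expR (2 * L * (t - t0)))).
    apply: cvgM; first exact: cvg_cst.
    by apply: cvg_expr; rewrite ger0_norm ?invr_ge0// invf_lt1// ltr1n.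
  by apply/funext => n; rewrite /weight; ring.
have cY t : t0 <= t -> cvgn (fun n => Y n t).
  move=> tt; apply: cauchy_cvg; apply: cauchy_exP => e e0.
  have /cvgrPdist_lt /(_ _ e0) [N _ hN] := w0 t.
  exists (Y N t); exists N => // m /= Nm; rewrite /ball/= distrC.
  apply: (le_lt_trans (dnm' _ _ _ tt Nm)).
  by have := hN N (leqnn N); rewrite /= sub0r normrN ger0_norm// mulr_ge0.
pose Z t := limn (fun n => Y n t).
have ZY n t : t0 <= t -> `|Z t - Y n t| <= 2 * weight n t.
  move=> tt; apply/ler_addgt0Pr => e e0.
  have /cvgrPdist_lt /(_ _ e0) [N _ hN] := cY t tt.
  pose m := maxn N n.
  have h1 := hN m (leq_maxl _ _); have h2 := dnm' n m t tt (leq_maxr _ _).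
  rewrite -(subrK (Y m t) (Z t)) -addrA addrC; apply: (le_trans (ler_normD _ _)).
  by apply: lerD => //; exact: ltW.
have small e t : 0 < e -> exists N, forall m, (N <= m)%N -> 2 * weight m t <= e.
  move=> e0; have /cvgrPdist_lt /(_ _ e0) [N _ hN] := w0 t; exists N => m Nm.
  have := hN m Nm; rewrite /= sub0r normrN ger0_norm; first exact: ltW.
  exact: mulr_ge0.
have Zlip s t : t0 <= s -> t0 <= t -> `|Z t - Z s| <= K * `|t - s|.
  move=> hs ht; apply/ler_addgt0Pr => e e0; have e20 : 0 < e / 2 by lra.
  have [N hN] := small _ t e20; have [N' hN'] := small _ s e20.
  pose m := (maxn N N').+1.
  have h1 : `|Z t - Y m t| <= e / 2.
    by apply: (le_trans (ZY _ _ ht)); apply: hN; rewrite /m ltnW// ltnS leq_maxl.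
  have h2 : `|Y m s - Z s| <= e / 2.
    by rewrite distrC; apply: (le_trans (ZY _ _ hs)); apply: hN'; rewrite /m ltnW// ltnS leq_maxr.
  have h3 := step_lip (hY (maxn N N')) hs ht.
  have -> : Z t - Z s = (Z t - Y m t) + (Y m t - Y m s) + (Y m s - Z s) by ring.
  apply: (le_trans (ler_normD _ _)).
  have := ler_normD (Z t - Y m t) (Y m t - Y m s); rewrite -/m in h3; lra.
have cZ : continuous (clip Z).
  by apply: (@lipschitz_continuous _ K) (ltW K0) _; apply: clip_lip; [exact: Zlip|exact: ltW].
(* [X] has derivative [u (t, Z t)], so the equality [X = Z] makes it a solution. *)
have [X hX] := step_ex cZ.
have XZ t : t0 <= t -> X t = Z t.
  move=> tt; apply/eqP; rewrite -subr_eq0 -normr_le0; apply/ler_addgt0Pr => e e0.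
  rewrite add0r; have e20 : 0 < e / 2 by lra.
  have [N hN] := small _ t e20.
  have h1 : `|X t - Y N.+2 t| <= weight N.+1 t.
    apply: (contract (hY N.+1) hX) tt => s ss.
    by apply: (le_trans (ZY N.+1 s ss)); rewrite weightS; lra.
  have h2 := ZY N.+2 t tt.
  have h3 := hN N.+1 (leqnSn N); have h4 := hN N.+2 (ltnW (leqnSn N.+1)).
  rewrite -(subrK (Y N.+2 t) (X t)) -addrA.
  apply: (le_trans (ler_normD _ _)); rewrite [X in _ + X]distrC.
  by have := weight_ge0 N.+1 t; lra.
exists X; have [X0 dX] := hX; split => // t tt.
by rewrite XZ//; exact: dX.
Qed.

Lemma ode_solution_exists : exists x, ode_solution u t0 x0 x.
Proof.
have [x [xt0 dx]] := picard_solution; exists x; split => //.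
- apply: continuous_in_subspaceT => t; rewrite inE/= in_itv/= andbT => tt.
  exact: is_derive_continuous (dx t tt).
- move=> t tt; have [d e] := dx t (ltW tt); split; first exact: d.
  by rewrite derive1E.
Qed.

End existence.
End picard.

(** * The velocity field *)

Section area_sigma_finite.
Context {R : realType}.
Local Notation mplane := (measurableTypeR R * measurableTypeR R)%type.

(* A copy of [area] that can carry a sigma-finite structure. *)
Definition area_fun : set mplane -> \bar R := @area R.
HB.instance Definition _ := Measure.on area_fun.

Let area_fun_sigma_finite : sigma_finite setT area_fun.
Proof.
exists (fun n : nat => cbox (0, 0) n%:R).
  apply/esym/seteqP; split => // q _.
  exists (Num.truncn (`|q.1| + `|q.2|)).+1 => //.
  have h := Num.Theory.truncnS_gt (`|q.1| + `|q.2|).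
  have a := normr_ge0 q.1; have b := normr_ge0 q.2.
  by split; rewrite /= subr0; lra.
move=> n; split; first exact: measurable_cbox.
suff : (area (cbox (0%R, 0%R) (n%:R : R)) < +oo)%E by [].
by rewrite lambda2_cbox// ltry.
Qed.

HB.instance Definition _ := @Measure_isSigmaFinite.Build _ _ _ area_fun area_fun_sigma_finite.

End area_sigma_finite.

Section field.
Context {R : realType}.
Local Notation plane := (R * R)%type.
Local Notation mplane := (measurableTypeR R * measurableTypeR R)%type.
Variables (u0 u1 : R).
Hypotheses (h0 : 0 <= u0) (h01 : u0 < u1).

(* [kappa] exceeds the variation of α and β over a ball of radius 1, the range of
the mollifier; [scale] makes [configP_intrusion] hold. *)
Definition kappa : R := u1 + 2.

Fixpoint scale (n : nat) : R :=
  if n is m.+1 then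
    2 ^+ m.+1 * 16 * m.+2%:R * (2 * m.+1%:R * scale m + 4 * kappa)
  else kappa + 1.

(** Bounds both coordinates of every point that the mollifier sees from the part of a level [n] tube
    used in [speed_wall]. *)
Definition reach (n : nat) : R := 2 * n.+1%:R * scale n + 2 * kappa.

Lemma kappa_ge2 : 2 <= kappa.
Proof. by have a := h0; have b := h01; rewrite /kappa; lra. Qed.

Lemma scale_ge n : kappa + 1 <= scale n /\ scale n <= scale n.+1.
Proof.
have k2 := kappa_ge2.
have step m : kappa + 1 <= scale m -> scale m <= scale m.+1.
  move=> h /=; set c := 2 ^+ m.+1 * 16 * m.+2%:R.
  have c1 : 1 <= c.
    rewrite /c; have p1 : 1 <= 2 ^+ m.+1 :> R by rewrite exprn_ege1// ler1n.
    have p2 : 1 <= m.+2%:R :> R by rewrite ler1n.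
    by rewrite !mulr_ege1//; rewrite ler1n.
  have m1 : 1 <= m.+1%:R :> R by rewrite ler1n.
  have e1 : scale m <= m.+1%:R * scale m by rewrite ler_peMl//; lra.
  have e2 : scale m <= 2 * m.+1%:R * scale m + 4 * kappa by lra.
  by apply: (le_trans e2); rewrite ler_peMl//; lra.
elim: n => [|n [IH1 IH2]]; first by split; [|exact: step].
by split; [exact: le_trans IH2|apply: step; exact: le_trans IH2].
Qed.

Lemma scale_gt0 n : 0 < scale n.
Proof. by have [h _] := scale_ge n; have := kappa_ge2; lra. Qed.

Lemma reach_le m n : (m <= n)%N -> reach m <= reach n.
Proof.
have step k : reach k <= reach k.+1.
  rewrite /reach lerD2r; apply: ler_pM; rewrite ?mulr_ge0// ?(ltW (scale_gt0 _))//.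
    by rewrite ler_pM2l// ler_nat.
  by have [] := scale_ge k.
elim: n => [|n IH]; first by rewrite leqn0 => /eqP ->.
by rewrite leq_eqVlt => /orP[/eqP -> //|/IH h]; exact: le_trans (step n).
Qed.

(** The last factor in the recursion for [scale] is the reach of the preceding level plus
    [2 * kappa]; monotonicity of [reach] covers all lower levels. *)
Lemma scale_reach m n : (n < m)%N ->
  2 ^+ m * 16 * m.+1%:R * (reach n + 2 * kappa) <= scale m.
Proof.
case: m => // m; rewrite ltnS => nm /=; rewrite ler_wpM2l ?mulr_ge0 ?exprn_ge0//.
by have := reach_le nm; rewrite /reach; lra.
Qed.

(* The coordinate across the tubes of level [n] first, the one along them second. *)
Definition orient (n : nat) (q : plane) : plane := if odd n then (q.2, q.1) else q.

Lemma open_box_orient n (c r q : plane) :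
  open_box (orient n c) (orient n r) q =
  (`|(orient n q).1 - c.1| < r.1 /\ `|(orient n q).2 - c.2| < r.2).
Proof.
rewrite /open_box /orient; case: (odd n) => //=.
by rewrite propeqE; split => -[].
Qed.

Definition hit (n : nat) (c r : plane) : set (nat -> set plane) :=
  [set Z | exists2 q, Z n q & open_box (orient n c) (orient n r) q].

Lemma hitE n c r : hit n c r = ~` void (box_at n (orient n c) (orient n r)).
Proof.
apply/seteqP; split => [Z h /void_box_at|Z h]; first exact.
by apply: contrapT => no; apply: h; apply/void_box_at.
Qed.

Lemma measurable_hit n c r : measurable (hit n c r : set (@config R)).
Proof.
by rewrite hitE; apply: measurableC; apply: measurable_void; exact: admissible_box_at.
Qed.

(* A tube of level [n] contains the origin. *)
Definition covered (n : nat) : set (nat -> set plane) :=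
  hit n (0, 0) (2 * kappa / scale n, 3 * n.+1%:R).

(** The highest level covering the origin exists and is even. If no level covers it, or infinitely
    many do, the origin counts as slow. *)
Definition fast : set (nat -> set plane) :=
  [set Z | exists n, ~~ odd n /\ covered n Z /\ forall m, (n < m)%N -> ~ covered m Z].

Lemma measurable_fast : measurable (fast : set (@config R)).
Proof.
rewrite (_ : fast = \bigcup_(n in [set n | ~~ odd n])
   (covered n `&` \bigcap_(m in [set m | (n < m)%N]) ~` covered m)).
  apply: bigcup_measurable => n _; apply: measurableI; first exact: measurable_hit.
  apply: bigcap_measurable; first by exists n.+1 => /=.
  by move=> m _; apply: measurableC; exact: measurable_hit.
by apply/seteqP; split => [Z [n [no [cn nc]]]|Z [n no [cn nc]]]; exists n.
Qed.

Local Notation disp := (disp u0 u1 scale).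
Local Notation act := (act u0 u1 scale).

Definition indicator (Z : @config R) (g : plane) : R := \1_fast (act g Z).

Lemma indicator01 Z g : 0 <= indicator Z g <= 1.
Proof. by rewrite /indicator indicE; case: (_ \in _); rewrite ?lexx ?ler01. Qed.

Lemma indicator_norm Z g : `|indicator Z g| <= 1.
Proof. by case/andP: (indicator01 Z g) => ? ?; rewrite ger0_norm. Qed.

Lemma indicator_act g Z : indicator (act g Z) = fun q => indicator Z (g.1 + q.1, g.2 + q.2).
Proof.
apply/funext => q; rewrite /indicator -actD.
by rewrite addrC [q.2 + _]addrC.
Qed.

Lemma measurable_indicator_joint : measurable_fun setT
  (fun z : @config R * mplane => indicator z.1 z.2).
Proof.
have msw : measurable_fun setT (fun z : @config R * mplane => (z.2, z.1)).
  by apply: measurable_fun_pair; [exact: measurable_snd|exact: measurable_fst].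
have ma := measurableT_comp (measurable_act_joint u0 u1 scale) msw.
have mi : measurable_fun setT (\1_fast : @config R -> R).
  by apply: measurable_indic; exact: measurable_fast.
exact: (measurableT_comp mi ma).
Qed.

Lemma measurable_indicator Z : measurable_fun setT (indicator Z : mplane -> R).
Proof.
have mp : measurable_fun setT (fun q : mplane => (Z, q) : @config R * mplane).
  by apply: measurable_fun_pair; [exact: measurable_cst|exact: measurable_id].
exact: (measurableT_comp measurable_indicator_joint mp).
Qed.

Definition speed0 (Z : @config R) : R := u0 + (u1 - u0) * smoothing (indicator Z) (0, 0).

Definition speed (Z : @config R) (g : plane) : R := u0 + (u1 - u0) * smoothing (indicator Z) g.

(** Mollification commutes with translations, so the field read off along the orbit is one mollified
    function of the plane. *)
Lemma speed0_act Z : (fun g => speed0 (act g Z)) = speed Z.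
Proof.
apply/funext => g; rewrite /speed0 /speed indicator_act smoothing_shift.
- by rewrite /= !addr0 -surjective_pairing.
- exact: measurable_indicator.
- by move=> q; case/andP: (indicator01 Z q).
Qed.

(** The mollified value is a partial integral of a nonnegative jointly measurable function, so
    Tonelli's theorem applies, with [area_fun] as the sigma-finite measure. *)
Lemma measurable_speed0 : measurable_fun setT speed0.
Proof.
apply: measurable_funD; first exact: measurable_cst.
apply: measurable_funM; first exact: measurable_cst.
rewrite /smoothing /moll /Rintegral.
apply: measurableT_comp; first exact: fine_measurable.
pose f (z : @config R * mplane) : \bar R :=
  (indicator z.1 z.2 * (nbump (z.2.1 - 0) * bump (z.2.2 - 0)))%:E.
have f0 z : (0 <= f z)%E.
  rewrite lee_fin; apply: mulr_ge0; first by case/andP: (indicator01 z.1 z.2).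
  by apply: mulr_ge0; [exact: nbump_ge0|exact: bump_ge0].
have mf : measurable_fun setT f.
  apply/measurable_EFinP; apply: measurable_funM; first exact: measurable_indicator_joint.
  have m2 : measurable_fun setT (fun z : @config R * mplane => z.2) by exact: measurable_snd.
  apply: measurable_funM.
    apply: (measurableT_comp (test_measurable test_nbump)).
    apply: measurable_funB; last exact: measurable_cst.
    exact: (measurableT_comp measurable_fst m2).
  apply: (measurableT_comp (test_measurable test_bump)).
  apply: measurable_funB; last exact: measurable_cst.
  exact: (measurableT_comp measurable_snd m2).
exact: (@measurable_fun_fubini_tonelli_F _ _ (@config R) mplane R area_fun f mf f0).
Qed.

Lemma speedE Z g : speed Z g = u0 + (u1 - u0) * smoothing (indicator Z) g.
Proof. by []. Qed.

Lemma speed_itv Z g : u0 <= speed Z g <= u1.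
Proof.
have /andP[a b] := smoothing_itv g (measurable_indicator Z) (indicator01 Z).
have d : 0 <= u1 - u0 by rewrite subr_ge0 ltW.
have c1 : 0 <= (u1 - u0) * smoothing (indicator Z) g by rewrite mulr_ge0.
have c2 : (u1 - u0) * smoothing (indicator Z) g <= (u1 - u0) * 1 by rewrite ler_wpM2l.
by rewrite /speed; apply/andP; split; lra.
Qed.

Lemma Ck_affine k (a c : R) (f : plane -> R) : Ck k f -> Ck k (fun g => a + c * f g).
Proof.
have cont (h : plane -> R) b : continuous h -> continuous (fun g => b + c * h g).
  by move=> ch g; apply: cvgD; [exact: cvg_cst|apply: cvgM; [exact: cvg_cst|exact: ch]].
elim: k a f => [|k IH] a f /=; first by move=> [cf _]; split => //; exact: cont.
move=> [cf [df [C1 C2]]]; split; first exact: cont.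
have hd (w : plane) : (forall p, derivable f p w) ->
    forall p, is_derive p w (fun g => a + c * f g) (c * 'D_w f p).
  move=> dfw p; have h1 : is_derive p w f ('D_w f p) by apply: DeriveDef => //; exact: dfw.
  have h2 := is_deriveD (is_derive_cst a p w) (is_deriveZ c h1).
  by apply: is_derive_eq h2 _; rewrite add0r.
have E (w : plane) : (forall p, derivable f p w) ->
    'D_w (fun g => a + c * f g) = (fun g => 0 + c * 'D_w f g).
  by move=> dfw; apply/funext => p; rewrite add0r; case: (hd w dfw p).
have d1 p := proj1 (df p); have d2 p := proj2 (df p).
split.
  move=> p; case: (hd _ d1 p) => e1 _; case: (hd _ d2 p) => e2 _.
  by split; [exact: e1|exact: e2].
by split; [rewrite (E _ d1); exact: IH|rewrite (E _ d2); exact: IH].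
Qed.

Lemma speed_smooth Z : smooth2 (speed Z).
Proof.
move=> k; apply: Ck_affine; apply: smoothing_Ck; first exact: measurable_indicator.
exact: indicator_norm.
Qed.

Lemma speed_ode_exists Z t0 x0 : exists x, ode_solution (speed Z) t0 x0 x.
Proof.
have [L L0 hL] := smoothing_lipschitz (measurable_indicator Z) (indicator_norm Z).
have d : 0 < u1 - u0 by rewrite subr_gt0.
apply: (@ode_solution_exists _ (speed Z) t0 x0 (u1 + 1) ((u1 - u0) * L)).
- by have a := h0; have b := h01; lra.
- by rewrite mulr_gt0.
- by have [] := speed_smooth Z 0.
- move=> p; have /andP[a b] := speed_itv Z p; have c := h0; rewrite ger0_norm; lra.
- move=> t x y; rewrite /speed opprD addrACA subrr add0r -mulrBr.
  by rewrite normrM (gtr0_norm d) -mulrA ler_pM2l//; exact: hL.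
Qed.

End field.

(** * Almost surely, every large level has a wall free of intrusions *)

Section good_event.
Context {R : realType}.
Local Notation plane := (R * R)%type.
Variables (u0 u1 : R).
Hypotheses (h0 : 0 <= u0) (h01 : u0 < u1).
Local Notation kappa := (kappa u1).
Local Notation scale := (scale u1).
Local Notation reach := (reach u1).

(* The centre of a tube of level [n] lies at transverse distance between [scale n] and
[2 * scale n] of the origin, the tube extending past the origin lengthwise by
at least [n.+1 * scale n] on both sides. *)
Definition wall (n : nat) : set (nat -> set plane) :=
  hit n (3 / 2, 0) (2^-1, n.+1%:R).

(* Necessary for a tube of level [m] to meet the box of radius [reach n]. *)
Definition intrusion (n m : nat) : set (nat -> set plane) :=
  hit m (0, 0) ((reach n + 2 * kappa) / scale m, 3 * m.+1%:R + reach n / scale m).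

Definition bad (n : nat) : set (nat -> set plane) :=
  ~` wall n `|` \bigcup_(m in [set m | (n < m)%N]) intrusion n m.

Lemma measurable_bad n : measurable (bad n : set (@config R)).
Proof.
apply: measurableU; first by apply: measurableC; exact: measurable_hit.
by apply: bigcup_measurable => m _; exact: measurable_hit.
Qed.

Let orient_ge0 n (r : plane) : 0 <= r.1 -> 0 <= r.2 ->
  0 <= (orient n r).1 /\ 0 <= (orient n r).2.
Proof. by rewrite /orient; case: (odd n). Qed.

Let orient_mul n (r : plane) : 4 * (orient n r).1 * (orient n r).2 = 4 * r.1 * r.2.
Proof. by rewrite /orient; case: (odd n) => //=; ring. Qed.

Lemma configP_hit n (c r : plane) : 0 <= r.1 -> 0 <= r.2 ->
  @configP R (hit n c r) = (1 - expR (- (4 * r.1 * r.2)))%:E.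
Proof.
move=> r1 r2; have [p1 p2] := orient_ge0 n r1 r2.
rewrite hitE probability_setC; last by apply: measurable_void; exact: admissible_box_at.
have := configP_box_at n (orient n c) p1 p2; rewrite orient_mul.
by rewrite EFinB => <-.
Qed.

Lemma configP_no_wall n : (@configP R (~` wall n) <= (2^-1 ^+ n.+1 : R)%:E)%E.
Proof.
rewrite probability_setC; last exact: measurable_hit.
rewrite configP_hit//= ?invr_ge0// -EFinB lee_fin opprB addrC subrK.
have -> : 4 * 2^-1 * n.+1%:R = 2 * n.+1%:R :> R by field.
have e2 : expR (- 2) <= 2^-1 :> R.
  rewrite expRN lef_pV2 ?posrE ?expR_gt0//.
  by have := @expR_ge1Dx R 2; lra.
have -> : expR (- (2 * n.+1%:R)) = expR (- 2) ^+ n.+1 :> R.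
  by rewrite -expRM_natl mulrN mulrC.
by apply: lerXn2r => //; rewrite nnegrE ?expR_ge0// invr_ge0.
Qed.

(** With half-sides [a] and [b] the probability is at most the area 4 a b of the box; since b is at
    most 4 (m + 1), the growth of [scale] brings it below 2^-m. *)
Lemma configP_intrusion n m : (n < m)%N -> (@configP R (intrusion n m) <= (2^-1 ^+ m : R)%:E)%E.
Proof.
move=> nm; have k2 := kappa_ge2 h0 h01.
have s0 := scale_gt0 h0 h01 m.
have q0 : 0 <= reach n.
  by rewrite /reach addr_ge0 ?mulr_ge0 ?(ltW (scale_gt0 h0 h01 n))//; lra.
set a := (reach n + 2 * kappa) / scale m.
set b := 3 * m.+1%:R + reach n / scale m.
have a0 : 0 <= a by rewrite divr_ge0 ?(ltW s0)//; lra.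
have c0 : 0 <= reach n / scale m by apply: divr_ge0 => //; exact: ltW.
have b0 : 0 <= b by apply: addr_ge0 => //; exact: mulr_ge0.
rewrite /intrusion (configP_hit _ _ (r := (a, b)) a0 b0) lee_fin /=.
apply: (@le_trans _ _ (4 * a * b)).
  by have := expR_ge1Dx (- (4 * a * b)); lra.
have key : 2 ^+ m * (16 * m.+1%:R * a) <= 1.
  have := scale_reach h0 h01 nm; rewrite -(ler_pM2r (x := (scale m)^-1)) ?invr_gt0//.
  by rewrite mulfV ?gt_eqF// /a !mulrA.
have p0 : 0 < 2 ^+ m :> R by rewrite exprn_gt0.
have key' : 16 * m.+1%:R * a <= 2^-1 ^+ m.
  by rewrite exprVn -[leRHS]mulr1 ler_pdivlMl ?mulr1.
have m1 : 1 <= m.+1%:R :> R by rewrite ler1n.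
have c1 : reach n / scale m <= a by rewrite /a ler_pM2r ?invr_gt0//; lra.
have a1 : a <= 1.
  have : 2^-1 ^+ m <= 1 :> R by rewrite exprn_ile1 ?invr_ge0// invf_le1 ?ler1n.
  have : 16 * 1 * a <= 16 * m.+1%:R * a by rewrite ler_wpM2r// ler_pM2l.
  by lra.
have b1 : b <= 4 * m.+1%:R by rewrite /b; lra.
apply: le_trans key'; apply: (@le_trans _ _ (4 * a * (4 * m.+1%:R))).
  by rewrite ler_wpM2l// mulr_ge0.
by rewrite le_eqVlt; apply/orP; left; apply/eqP; ring.
Qed.

Let cvg_geom n : series (fun k => 2^-1 ^+ (k + n) : R) @ \oo --> (2 * 2^-1 ^+ n : R).
Proof.
have -> : series (fun k => 2^-1 ^+ (k + n) : R) = series (geometric (2^-1 ^+ n) 2^-1).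
  by congr series; apply/funext => k; rewrite /geometric/= exprD mulrC.
have h : `|2^-1 : R| < 1 by rewrite ger0_norm ?invr_ge0// invf_lt1// ltr1n.
have := @cvg_geometric_series R (2^-1 ^+ n) 2^-1 h.
by have -> : 2^-1 ^+ n / (1 - 2^-1) = 2 * 2^-1 ^+ n :> R by field.
Qed.

Let sum_geom n : (\sum_(k <oo) (2^-1 ^+ (k + n) : R)%:E = (2 * 2^-1 ^+ n : R)%:E)%E.
Proof.
apply/cvg_lim; first exact: ereal_hausdorff.
rewrite (_ : (fun _ => _) = EFin \o series (fun k => 2^-1 ^+ (k + n) : R)).
  by apply: cvg_EFin; [exact: nearW|exact: cvg_geom].
by apply/funext => k /=; rewrite sumEFin.
Qed.

Lemma configP_bad n : (@configP R (bad n) <= (2 * 2^-1 ^+ n : R)%:E)%E.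
Proof.
have mI m : measurable (intrusion n m : set (@config R)) by exact: measurable_hit.
have -> : bad n = ~` wall n `|` \bigcup_k intrusion n (k + n.+1).
  congr (_ `|` _); apply/seteqP; split => [Z [m nm h]|Z [k _ h]].
    by exists (m - n.+1)%N => //; rewrite subnK.
  by exists (k + n.+1)%N => //=; rewrite addnS ltnS leq_addl.
have mU : measurable (\bigcup_k intrusion n (k + n.+1) : set (@config R)).
  exact: bigcupT_measurable.
have mW : measurable (~` wall n : set (@config R)) by apply: measurableC; exact: measurable_hit.
apply: (le_trans (measureU2 (@configP R) mW mU)).
(* Of four equal parts one pays for the missing wall, two for the geometric sum of the intrusions,
   and one is to spare. *)
have -> : (2 * 2^-1 ^+ n : R)%:E = ((2^-1 ^+ n.+1 : R)%:E + (2 * 2^-1 ^+ n.+1 : R)%:E + (2^-1 ^+ n.+1 : R)%:E)%E.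
  by rewrite -!EFinD exprS; congr EFin; field.
rewrite -addeA; apply: leeD; first exact: configP_no_wall.
apply: (@le_trans _ _ (2 * 2^-1 ^+ n.+1 : R)%:E); last first.
  by rewrite leeDl// lee_fin exprn_ge0// invr_ge0.
rewrite -sum_geom.
have hs := @measure_sigma_subadditive _ _ _ (@configP R) _ _ (fun k => mI (k + n.+1)%N) mU (@subset_refl _ _).
apply: (le_trans hs).
by apply: lee_nneseries => // k _; apply: configP_intrusion; rewrite addnS ltnS leq_addl.
Qed.

Definition good : set (nat -> set plane) := ~` lim_sup_set bad.

Lemma measurable_good : measurable (good : set (@config R)).
Proof.
apply: measurableC; apply: bigcapT_measurable => n.
by apply: bigcup_measurable => k _; exact: measurable_bad.
Qed.

Lemma configP_good : @configP R good = 1%E.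
Proof.
have ml : measurable (lim_sup_set bad : set (@config R)).
  by rewrite -[X in measurable X]setCK; apply: measurableC; exact: measurable_good.
rewrite probability_setC// (lim_sup_set_cvg0 (mu := configP)) ?sube0//.
  exact: measurable_bad.
apply: (@le_lt_trans _ _ (2%:E * \sum_(k <oo) (2^-1 ^+ (k + 0) : R)%:E)%E).
  rewrite -nneseriesZl => [|k _]; last by rewrite lee_fin exprn_ge0// invr_ge0.
  by apply: lee_nneseries => // k _; rewrite -EFinM addn0; exact: configP_bad.
by rewrite sum_geom -EFinM ltry.
Qed.

Lemma goodP Z : good Z -> exists N, forall n, (N <= n)%N ->
  wall n Z /\ forall m, (n < m)%N -> ~ intrusion n m Z.
Proof.
move=> gZ; apply: contrapT => no; apply: gZ => N _.
apply: contrapT => no'; apply: no; exists N => n Nn; split.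
  by apply: contrapT => w; apply: no'; exists n => //; left.
by move=> m nm im; apply: no'; exists n => //; right; exists m.
Qed.

End good_event.

(** * Exact speed near the axis of a wall *)

Section walls.
Context {R : realType}.
Local Notation plane := (R * R)%type.
Variables (u0 u1 : R).
Hypotheses (h0 : 0 <= u0) (h01 : u0 < u1).
Local Notation kappa := (kappa u1).
Local Notation scale := (scale u1).
Local Notation reach := (reach u1).
Local Notation speed := (speed u0 u1).

Definition proj (g : plane) : plane := (u1 * g.1 - g.2, g.2 - u0 * g.1).

Let disp_proj m g : disp u0 u1 scale m g = ((proj g).1 / scale m, (proj g).2 / scale m).
Proof. by []. Qed.

Let orient_box n (q : plane) (x y : R) :
  (`|(orient n q).1| <= x -> `|(orient n q).2| <= x ->
   forall m, `|(orient m q).1| <= x /\ `|(orient m q).2| <= x).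
Proof. by rewrite /orient; case: (odd n) => /= h1 h2 m; case: (odd m). Qed.

Let proj_near (g q : plane) : cbox g 1 q ->
  `|(proj q).1 - (proj g).1| < kappa /\ `|(proj q).2 - (proj g).2| < kappa.
Proof.
move=> [h1 h2]; have k0 := h0; have k1 := h01.
have e1 : `|u1 * (q.1 - g.1)| <= u1.
  by rewrite normrM (ger0_norm (_ : 0 <= u1)) ?ler_piMr//; lra.
have e2 : `|u0 * (q.1 - g.1)| <= u0.
  by rewrite normrM (ger0_norm (_ : 0 <= u0)) ?ler_piMr//; lra.
move: e1 e2 h1 h2; rewrite /kappa !ler_norml !ltr_norml /proj /=.
by move=> /andP[? ?] /andP[? ?] /andP[? ?] /andP[? ?]; split; apply/andP; split; lra.
Qed.

Let proj_near_orient n (g q : plane) : cbox g 1 q ->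
  `|(orient n (proj q)).1 - (orient n (proj g)).1| < kappa /\
  `|(orient n (proj q)).2 - (orient n (proj g)).2| < kappa.
Proof. by move=> /proj_near[a b]; rewrite /orient; case: (odd n). Qed.

(** Over the unit range of the mollifier the coordinates vary by less than [kappa]. So from a point
    within [kappa] of the axis only points inside the tube are seen, and there level [n] decides as
    no higher level is present. *)
Lemma speed_wall n (Z : @config R) : wall n Z ->
  (forall m, (n < m)%N -> ~ intrusion u1 n m Z) ->
  exists a, [/\ scale n < a, a < 2 * scale n &
    forall g, `|(orient n (proj g)).1 - a| <= kappa ->
              `|(orient n (proj g)).2| <= n.+1%:R * scale n ->
              speed Z g = if odd n then u0 else u1].
Proof.
move=> [z Zz]; rewrite open_box_orient /= subr0 => -[z1 z2] quiet.
have s0 := scale_gt0 h0 h01 n; have [s1 _] := scale_ge h0 h01 n.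
have k2 := kappa_ge2 h0 h01.
set zs := (orient n z).1 in z1; set zl := (orient n z).2 in z2.
exists (scale n * zs).
move: z1; rewrite ltr_norml => /andP[z1 z1'].
have ha : scale n < scale n * zs by rewrite ltr_pMr//; lra.
have ha' : scale n * zs < 2 * scale n by rewrite [ltRHS]mulrC ltr_pM2l//; lra.
split => // g g1 g2.
have n1 : 1 <= n.+1%:R :> R by rewrite ler1n.
have sn : scale n <= n.+1%:R * scale n by rewrite ler_peMl// ltW.
(* Across, the distances [kappa] from the axis to [g] and from [g] to [q] make up the half-width
   [2 * kappa]. Along, the centre and [g] are each within [n.+1 * scale n] of the origin and [q] is
   less than [scale n] further, within the half-length [3 * n.+1 * scale n]. *)
have cov q : cbox g 1 q -> covered u1 n (act u0 u1 scale q Z).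
  move=> /(proj_near_orient n)[q1 q2].
  exists (z.1 - (disp u0 u1 scale n q).1, z.2 - (disp u0 u1 scale n q).2).
    by rewrite /act /= !subrK -surjective_pairing.
  rewrite open_box_orient /=; split.
    have -> : (orient n (z.1 - (disp u0 u1 scale n q).1, z.2 - (disp u0 u1 scale n q).2)).1 =
        (scale n * zs - (orient n (proj q)).1) / scale n.
      by rewrite /zs disp_proj /orient; case: (odd n) => /=; field; rewrite gt_eqF.
    rewrite subr0 normrM normfV (gtr0_norm s0) ltr_pM2r ?invr_gt0//.
    move: q1 g1; rewrite ltr_norml ler_norml ltr_norml => /andP[? ?] /andP[? ?].
    by apply/andP; split; lra.
  have -> : (orient n (z.1 - (disp u0 u1 scale n q).1, z.2 - (disp u0 u1 scale n q).2)).2 =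
      (scale n * zl - (orient n (proj q)).2) / scale n.
    by rewrite /zl disp_proj /orient; case: (odd n) => /=; field; rewrite gt_eqF.
  rewrite subr0 normrM normfV (gtr0_norm s0) ltr_pdivrMr//.
  have z2' : `|scale n * zl| <= scale n * n.+1%:R.
    by rewrite normrM (gtr0_norm s0) ler_pM2l// ltW.
  move: q2 g2 z2'; rewrite !ltr_norml !ler_norml => /andP[? ?] /andP[? ?] /andP[? ?].
  by apply/andP; split; lra.
(* A tube of level [m] covering [q] has its centre within [reach n] of where a tube covering the
   origin would have it; this is an intrusion. *)
have unc q m : cbox g 1 q -> (n < m)%N -> ~ covered u1 m (act u0 u1 scale q Z).
  move=> /(proj_near_orient n)[q1 q2] nm [z' Zz']; rewrite open_box_orient /= !subr0 => -[w1 w2].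
  have sm := scale_gt0 h0 h01 m.
  have r1 : `|(orient n (proj q)).1| <= reach n.
    move: q1 g1; rewrite /reach ltr_norml !ler_norml => /andP[? ?] /andP[? ?].
    by apply/andP; split; lra.
  have r2 : `|(orient n (proj q)).2| <= reach n.
    move: q2 g2; rewrite /reach ltr_norml !ler_norml => /andP[? ?] /andP[? ?].
    by apply/andP; split; lra.
  have [r1' r2'] := orient_box 0 r1 r2 m.
  apply: (quiet m nm).
  exists (z'.1 + (disp u0 u1 scale m q).1, z'.2 + (disp u0 u1 scale m q).2); first exact: Zz'.
  rewrite open_box_orient /= !subr0; split.
    have -> : (orient m (z'.1 + (disp u0 u1 scale m q).1, z'.2 + (disp u0 u1 scale m q).2)).1 =
        (orient m z').1 + (orient m (proj q)).1 / scale m.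
      by rewrite disp_proj /orient; case: (odd m).
    rewrite (le_lt_trans (ler_normD _ _))// addrC mulrDl.
    apply: ler_ltD => //; rewrite normrM normfV (gtr0_norm sm).
    by rewrite ler_pM2r ?invr_gt0.
  have -> : (orient m (z'.1 + (disp u0 u1 scale m q).1, z'.2 + (disp u0 u1 scale m q).2)).2 =
      (orient m z').2 + (orient m (proj q)).2 / scale m.
    by rewrite disp_proj /orient; case: (odd m).
  rewrite (le_lt_trans (ler_normD _ _))//.
  apply: ltr_leD => //; rewrite normrM normfV (gtr0_norm sm).
  by rewrite ler_pM2r ?invr_gt0.
rewrite speedE; case: ifPn => on.
  rewrite smoothing_eq0 ?mulr0 ?addr0// => q gq.
  rewrite /indicator indicE memNset// => -[n' [on' [c' nc']]].
  have [nn'|n'n|nn'] := ltngtP n n'.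
  - exact: (unc q n' gq nn' c').
  - exact: (nc' n n'n (cov q gq)).
  - by move: on'; rewrite -nn' on.
rewrite smoothing_eq1; first by rewrite mulr1; ring.
move=> q gq; rewrite /indicator indicE mem_set//; exists n; split => //.
by split; [exact: cov|move=> m nm; exact: unc].
Qed.

End walls.

(** * Trapping of the solutions *)

Section trapping.
Context {R : realType}.
Implicit Types (f y l : R -> R) (a b c k L t T : R).

Let within_segment f a b t0 : t0 <= a -> {within `[t0, +oo[, continuous f} ->
  {within `[a, b], continuous f}.
Proof.
move=> t0a; apply: continuous_subspaceW => t /=.
by rewrite !in_itv/= => /andP[+ _]; rewrite andbT; exact: le_trans.
Qed.

Let segment_mean_value f f' t0 a b : t0 <= a -> a <= b ->
  {within `[t0, +oo[, continuous f} ->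
  (forall t, t0 < t -> is_derive t (1 : R) f (f' t)) ->
  exists2 c, a <= c <= b & f b - f a = f' c * (b - a).
Proof.
move=> t0a ab cf df.
have [|c cab e] := @MVT_segment _ f f' a b ab _ (within_segment t0a cf).
  by move=> t; rewrite in_itv/= => /andP[at_ _]; apply: df; exact: le_lt_trans at_.
by exists c => //; move: cab; rewrite in_itv.
Qed.

Lemma ge0_derive_le f f' t0 a b : t0 <= a -> a <= b ->
  {within `[t0, +oo[, continuous f} ->
  (forall t, t0 < t -> is_derive t (1 : R) f (f' t)) ->
  (forall t, 0 <= f' t) -> f a <= f b.
Proof.
move=> t0a ab cf df f0; have [c _ e] := segment_mean_value t0a ab cf df.
by rewrite -subr_ge0 e mulr_ge0// subr_ge0.
Qed.

(** Here [y] runs across the wall at [a] and [l] along it. To exceed [a], [y] would have to grow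
    inside the strip of width [k] where its derivative vanishes. *)
Lemma trapped y y' l a k L t0 T : 0 < k -> t0 <= T ->
  {within `[t0, +oo[, continuous y} ->
  (forall t, t0 < t -> is_derive t (1 : R) y (y' t)) -> (forall t, 0 <= y' t) ->
  (forall s t, t0 <= s -> s <= t -> l s <= l t) ->
  (forall t, `|y t - a| <= k -> `|l t| <= L -> y' t = 0) ->
  y t0 <= a -> - L <= l t0 -> l T + y T = L + a -> y T <= a.
Proof.
move=> k0 t0T cy dy y'0 ml flat yt0 lt0 e.
have my s t : t0 <= s -> s <= t -> y s <= y t.
  by move=> t0s st; exact: (ge0_derive_le t0s st cy dy y'0).
rewrite leNgt; apply/negP => aT.
(* If [y T] exceeds [a], the prescribed sum at time [T] puts [l T] below [L]: the path has not
   passed the end of the wall. *)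
have lL t : t0 <= t -> t <= T -> `|l t| <= L.
  move=> t0t tT; rewrite ler_norml (le_trans lt0 (ml _ _ (lexx t0) t0t))/=.
  by apply: (le_trans (ml _ _ t0t tT)); lra.
have t0T' := my _ _ (lexx t0) t0T.
have [|s1 s1I ys1] := @IVT _ y t0 T a t0T (within_segment (lexx t0) cy).
  by rewrite (min_idPl t0T') (max_idPr t0T') yt0 ltW.
move: s1I; rewrite in_itv/= => /andP[ts1 s1T].
(* A level above [a], reached by time [T] and still inside the strip; the mean value theorem between
   [a] and [v] gives the contradiction. *)
have [v [av vT vk]] : exists v, [/\ a < v, v <= y T & v <= a + k].
  have [h|/ltW h] := leP (y T) (a + k); first by exists (y T).
  by exists (a + k); split => //; lra.
have s1T' := my _ _ ts1 s1T.
have [|s2 s2I ys2] := @IVT _ y s1 T v s1T (within_segment ts1 cy).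
  by rewrite (min_idPl s1T') (max_idPr s1T') ys1 (ltW av).
move: s2I; rewrite in_itv/= => /andP[s12 s2T].
have [c /andP[c1 c2] ec] := segment_mean_value ts1 s12 cy dy.
have tc := le_trans ts1 c1.
have y1 := my _ _ ts1 c1; have y2 := my _ _ tc c2.
have y0 : y' c = 0.
  apply: flat; first by rewrite ler_norml; apply/andP; split; lra.
  exact: lL tc (le_trans c2 s2T).
by move: ec; rewrite y0 mul0r ys1 ys2; lra.
Qed.

End trapping.

(** * Upper and lower limits at infinity in epsilon form *)

Section limits_at_infinity.
Context {R : realType}.
Implicit Types (f : R -> R) (c : R).

Lemma limf_esup_pinfty f c :
  (forall e, 0 < e -> exists M, forall t, M < t -> f t <= c + e) ->
  (forall e M, 0 < e -> exists2 t, M < t & c - e <= f t) ->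
  limf_esup (fun t => (f t)%:E) (pinfty_nbhs R) = c%:E.
Proof.
move=> hi lo; rewrite limf_esupE; apply/eqP; rewrite eq_le; apply/andP; split.
  apply/lee_addgt0Pr => e e0; have [M hM] := hi e e0.
  apply: (@le_trans _ _ (ereal_sup ((fun t => (f t)%:E) @` [set t | M < t]))).
    apply: ereal_inf_lbound; exists [set t | M < t] => //.
    by exists M; split => //; exact: num_real.
  by apply: ge_ereal_sup => _ [t /= Mt <-]; rewrite -EFinD lee_fin; exact: hM.
apply: le_ereal_inf_tmp => _ [V [M [_ MV]] <-].
apply/lee_addgt0Pr => e e0; have [t Mt ct] := lo e M e0.
apply: (@le_trans _ _ ((f t)%:E + e%:E)%E); first by rewrite -EFinD lee_fin; lra.
by apply: leeD => //; apply: ereal_sup_ubound; exists t => //; exact: MV.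
Qed.

Lemma limf_einf_pinfty f c :
  (forall e, 0 < e -> exists M, forall t, M < t -> c - e <= f t) ->
  (forall e M, 0 < e -> exists2 t, M < t & f t <= c + e) ->
  limf_einf (fun t => (f t)%:E) (pinfty_nbhs R) = c%:E.
Proof.
move=> lo hi; rewrite /limf_einf.
rewrite -[limf_esup _ _]/(limf_esup (fun t => (- f t)%:E) (pinfty_nbhs R)).
rewrite (@limf_esup_pinfty _ (- c)) ?EFinN ?oppeK// => [e e0|e M e0].
  by have [M h] := lo e e0; exists M => t /h; lra.
by have [t Mt h] := hi e M e0; exists t => //; lra.
Qed.

End limits_at_infinity.

(** * Mean speeds along a solution *)

Section solutions.
Context {R : realType}.
Variables (u0 u1 : R).
Hypotheses (h0 : 0 <= u0) (h01 : u0 < u1).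
Local Notation kappa := (kappa u1).
Local Notation scale := (scale u1).
Local Notation speed := (speed u0 u1).
Local Notation proj := (proj u0 u1).

(** Crude growth, enough to put any starting point on the near side of the walls of all large
    levels. *)
Lemma scale_ge_nat n : n%:R <= scale n.
Proof.
have k2 := kappa_ge2 h0 h01.
elim: n => [|n IH]; first exact/ltW/(scale_gt0 h0 h01).
have [s1 _] := scale_ge h0 h01 n.
have c1 : 1 <= 2 ^+ n.+1 * 16 * n.+2%:R :> R.
  by apply: mulr_ege1; [apply: mulr_ege1; [apply: exprn_ege1|]|]; rewrite ?ler1n//; lra.
have n1 : 1 <= n.+1%:R :> R by rewrite ler1n.
have sn : scale n <= n.+1%:R * scale n by rewrite ler_peMl//; lra.
have : 2 * n.+1%:R * scale n + 4 * kappa <= scale n.+1 by rewrite /= ler_peMl//; lra.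
by rewrite -(natr1 n); lra.
Qed.

Variables (Z : @config R) (t0 x0 : R) (x : R -> R).
Hypothesis sol : ode_solution (speed Z) t0 x0 x.

Let short n t := (orient n (proj (t, x t))).1.
Let long n t := (orient n (proj (t, x t))).2.
Let dshort n t := if odd n then speed Z (t, x t) - u0 else u1 - speed Z (t, x t).

Let speed01 g : u0 <= speed Z g /\ speed Z g <= u1.
Proof. by apply/andP; exact: speed_itv. Qed.

Let dshort_ge0 n t : 0 <= dshort n t.
Proof. by have [? ?] := speed01 (t, x t); rewrite /dshort; case: odd; lra. Qed.

Let short_derive n t : t0 < t -> is_derive t (1 : R) (short n) (dshort n t).
Proof.
case: sol => _ _ h /h[dx]; rewrite derive1E => ex.
have dx' : is_derive t (1 : R) x (speed Z (t, x t)) by apply: DeriveDef.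
have dl (c : R) : is_derive t (1 : R) (fun s => c * s) c.
  by apply: (is_derive_eq (is_deriveZ c (is_derive_id t (1 : R)))); rewrite /GRing.scale/= mulr1.
rewrite /short /dshort /orient; case: odd => /=; exact: is_deriveB.
Qed.

Let short_cont n : {within `[t0, +oo[, continuous (short n)}.
Proof.
case: sol => _ cx _ t.
have cl (c : R) : {within `[t0, +oo[, continuous (fun s : R => c * s)}.
  by apply: continuous_subspaceT => s; apply: cvgM; [exact: cvg_cst|exact: cvg_id].
by rewrite /short /orient; case: odd => /=; apply: cvgB; [exact: cx|exact: cl|exact: cl|exact: cx].
Qed.

Let short_le n s t : t0 <= s -> s <= t -> short n s <= short n t.
Proof.
by move=> t0s st; exact: (ge0_derive_le t0s st (@short_cont n) (@short_derive n) (dshort_ge0 n)).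
Qed.

(** The coordinate along a tube is the one across tubes of the other parity, so its monotonicity
    comes for free. *)
Let long_short n t : long n t = short n.+1 t.
Proof. by rewrite /long /short /orient /=; case: odd. Qed.

Let long_add_short n t : long n t + short n t = (u1 - u0) * t.
Proof. by rewrite /long /short /orient; case: odd => /=; ring. Qed.

(** The coordinate x - u0 t never falls below its initial value, whose contribution disappears after
    division by t. The upper bound uses u1 t - x in the same way. *)
Lemma ratio_ge e : 0 < e -> exists M, forall t, M < t -> u0 - e <= x t / t.
Proof.
move=> e0; pose b := short 1 t0; exists (Num.max (Num.max 0 t0) (- b / e)) => t.
rewrite !gt_max => /andP[/andP[t_gt0 t0t] ht].
have h := short_le 1 (lexx t0) (ltW t0t).
rewrite ler_pdivlMr//; move: ht; rewrite ltr_pdivrMr//.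
by move: h; rewrite -/b /short /=; lra.
Qed.

Lemma ratio_le e : 0 < e -> exists M, forall t, M < t -> x t / t <= u1 + e.
Proof.
move=> e0; pose b := short 0 t0; exists (Num.max (Num.max 0 t0) (- b / e)) => t.
rewrite !gt_max => /andP[/andP[t_gt0 t0t] ht].
have h := short_le 0 (lexx t0) (ltW t0t).
rewrite ler_pdivrMr//; move: ht; rewrite ltr_pdivrMr//.
by move: h; rewrite -/b /short /=; lra.
Qed.

Hypothesis goodZ : good u1 Z.

Lemma ratio_near (p : bool) e M : 0 < e -> exists t, [/\ M < t, 0 < t &
  if p then x t / t <= u0 + e else u1 - e <= x t / t].
Proof.
move=> e0; have [N hN] := goodP goodZ.
have d0 : 0 < u1 - u0 by rewrite subr_gt0.
(* The first two terms keep the initial coordinates below [scale n], the third pushes [T] beyond [M]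
   and [t0], and the last makes [2 * (u1 - u0) / n.+1] at most [e]. *)
pose K : R := `|short 0 t0| + `|short 1 t0| + (u1 - u0) * (`|M| + `|t0|) + 2 * (u1 - u0) / e.
have K0 : 0 <= 2 * (u1 - u0) / e by apply: divr_ge0; [apply: mulr_ge0|]; rewrite // ltW.
have K1 : 0 <= (u1 - u0) * (`|M| + `|t0|) by apply: mulr_ge0; [exact: ltW|apply: addr_ge0].
pose m := (N + (Num.truncn K).+1)%N.
have hm : K < m%:R.
  by apply: (lt_le_trans (Num.Theory.truncnS_gt K)); rewrite ler_nat leq_addl.
(* The parity of the level selects the speed of the wall: odd levels give u0, even levels u1. *)
pose n := (m.*2 + p)%N.
have on : odd n = p by rewrite /n oddD odd_double; case: (p).
have mn : (m <= n)%N by rewrite /n -addnn -addnA leq_addr.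
have Nn : (N <= n)%N by apply: leq_trans mn; exact: leq_addr.
have {}hm : K < n%:R by apply: (lt_le_trans hm); rewrite ler_nat.
have ns := scale_ge_nat n.
have [wn qn] := hN n Nn.
have [a [a1 a2 fl]] := speed_wall h0 h01 wn qn.
have s0 := scale_gt0 h0 h01 n.
pose L := n.+1%:R * scale n.
(* The coordinates along and across add up to (u1 - u0) t, so this is the time at which they add up
   to [L + a]. *)
pose T := (L + a) / (u1 - u0).
have eT : (u1 - u0) * T = L + a by rewrite /T mulrC divfK// gt_eqF.
have sL : scale n <= L by rewrite ler_peMl ?ler1n// ltW.
have a0 := normr_ge0 (short 0 t0); have b0 := normr_ge0 (short 1 t0).
have hT : (u1 - u0) * (`|M| + `|t0|) < (u1 - u0) * T by rewrite eT; move: hm; rewrite /K; lra.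
have {}hT : `|M| + `|t0| < T by move: hT; rewrite ltr_pM2l.
have nM := normr_ge0 M; have nt0 := normr_ge0 t0.
have lM := ler_norm M; have lt0 := ler_norm t0.
have MT : M < T by lra.
have t0T : t0 <= T by lra.
have T0 : 0 < T by lra.
have k0 : 0 < kappa by have := kappa_ge2 h0 h01; lra.
have hs j : `|short j t0| <= scale n.
  have -> : short j t0 = if odd j then short 1 t0 else short 0 t0.
    by rewrite /short /orient; case: odd.
  by move: hm; rewrite /K; case: odd; lra.
have yT : short n T <= a.
  apply: (@trapped _ _ (dshort n) (long n) a kappa L t0 T) => //.
  - exact: (@short_derive n).
  - by move=> s t ? ?; rewrite !long_short; exact: short_le.
  - move=> t h1 h2; rewrite /dshort (fl (t, x t)) //.
    by case: odd; rewrite subrr.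
  - have := hs n; rewrite ler_norml => /andP[_ h]; lra.
  - by rewrite long_short; have := hs n.+1; rewrite ler_norml => /andP[h _]; lra.
  - by rewrite long_add_short.
(* [a] is below [2 * scale n], while [(u1 - u0) * T] exceeds [n.+1 * scale n]. *)
have eL : a <= e * T.
  have en : 2 * (u1 - u0) <= e * n.+1%:R.
    have : 2 * (u1 - u0) / e <= n.+1%:R.
      by rewrite -(natr1 n); move: hm; rewrite /K; lra.
    by rewrite ler_pdivrMr// [_ * e]mulrC.
  rewrite -(ler_pM2l d0) mulrCA eT mulrDr.
  have h1 : 2 * (u1 - u0) * scale n <= e * n.+1%:R * scale n by rewrite ler_pM2r.
  have h2 : (u1 - u0) * a <= (u1 - u0) * (2 * scale n) by rewrite ler_pM2l// ltW.
  have h3 : 0 <= e * a by rewrite mulr_ge0// ltW//; exact: lt_trans a1.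
  rewrite /L [e * (_ * _)]mulrA; lra.
(* The transverse coordinate is x - u0 t for odd levels and u1 t - x for even ones; dividing its
   bound [a] by [T] gives the two estimates. *)
exists T; split => //; move: yT; rewrite /short /orient on.
case: (p) => /= h; first by rewrite ler_pdivrMr//; lra.
by rewrite ler_pdivlMr//; lra.
Qed.

End solutions.

Theorem theorem2 (R : realType) (u0 u1 : R) (h0 : 0 <= u0) (h01 : u0 < u1) :
  exists (d : measure_display) (Omega : measurableType d)
         (P : probability Omega R) (T : R * R -> Omega -> Omega) (ubar : Omega -> R),
    [/\ mp_action P T, weakly_mixing P T, measurable_fun setT ubar,
        (forall w, smooth2 (fun g => ubar (T g w)) /\
                   forall g, u0 <= ubar (T g w) <= u1) &
        exists E : set Omega, [/\ measurable E, P E = 1%E &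
          forall w, E w -> forall t0 x0 : R,
            (exists x, ode_solution (fun g => ubar (T g w)) t0 x0 x) /\
            (forall x, ode_solution (fun g => ubar (T g w)) t0 x0 x ->
               limf_einf (fun t : R => ((x t) / t)%:E) (pinfty_nbhs R) = u0%:E /\
               limf_esup (fun t : R => ((x t) / t)%:E) (pinfty_nbhs R) = u1%:E)]].
Proof.
have s0 := scale_gt0 h0 h01.
exists _, (@config R), (@configP R), (act u0 u1 (scale u1)), (speed0 u0 u1); split.
- exact: act_mp_action.
- exact: (act_weakly_mixing h01 s0).
- exact: measurable_speed0.
- move=> Z; rewrite speed0_act; split; first exact: speed_smooth.
  by move=> g; exact: speed_itv.
exists (good u1 : set (@config R)); split; [exact: measurable_good|exact: (configP_good h0 h01)|].
move=> Z goodZ t0 x0; rewrite speed0_act; split; first exact: speed_ode_exists.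
move=> x sol; split.
- apply: limf_einf_pinfty => [e e0|e M e0]; first exact: (ratio_ge h01 sol e0).
  by have [t [Mt _ h]] := ratio_near h0 h01 sol goodZ true M e0; exists t.
apply: limf_esup_pinfty => [e e0|e M e0]; first exact: (ratio_le h01 sol e0).
by have [t [Mt _ h]] := ratio_near h0 h01 sol goodZ false M e0; exists t.
Qed.
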